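(* Let $G=\mathrm{Spin}(8,\mathbb{C})$, let $T_G$ be a maximal torus of $G$, and let $P^{\alpha_4}\supset T_G$ be the maximal parabolic subgroup of $G$ corresponding to the simple root $\alpha_4$. Let $R=\bigoplus_{k\in\mathbb{Z}_{\ge0}}R_k$, where $R_k=H^0(G/P^{\alpha_4},\mathcal{L}^{\otimes k}(2\omega_4))^{T_G}$. Then the graded $\mathbb{C}$-algebra $R$ is generated by $R_1$.
   Context: Root conventions for $\mathrm{Spin}(8,\mathbb{C})$: simple roots $\alpha_i=\epsilon_i-\epsilon_{i+1}$ for $1\le i\le 3$ and $\alpha_4=\epsilon_3+\epsilon_4$; $\omega_4$ is the fundamental weight dual to the simple coroot of $\alpha_4$. $P^{\alpha_4}$ is the maximal parabolic subgroup for which the very ample generator of $\mathrm{Pic}(G/P^{\alpha_4})$ is $\mathcal{L}(\omega_4)$. Here $\mathcal{L}^{\otimes k}(2\omega_4)$ means $\mathcal{L}(2\omega_4)^{\otimes k}$, with the $T_G$-linearization restricted from the natural $G$-linearization. *)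

(* Defs.v *)
From HB Require Import structures.
From mathcomp Require Import all_boot all_order all_algebra.
From mathcomp Require Import boolp classical_sets functions.
(* Not imported: the notations of mpoly clash with those of classical_sets. *)
From mathcomp Require mpoly.

Set Implicit Arguments.
Unset Strict Implicit.
Unset Printing Implicit Defensive.

Import GRing.Theory.
Local Open Scope classical_set_scope.
Local Open Scope ring_scope.

(* Linear algebraic groups are subgroups X of some GL_n(C).  The coordinate
   ring of GL_n is C[x_ij][1/det], and the regular functions on a closed
   subset X are the restrictions to X of its elements. *)

Definition entries (C : Type) (n : nat) (g : 'M[C]_n) : 'I_(n * n) -> C :=
  fun i => mxvec g ord0 i.

Definition regular (C : fieldType) (n : nat) (X : set 'M[C]_n) (f : X -> C) :=
  exists (p : mpoly.mpoly (n * n) C) (m : nat),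
    forall g : X, f g = mpoly.meval (entries (val g)) p / \det (val g) ^+ m.

Definition is_subgroup (C : fieldType) (n : nat) (H : set 'M[C]_n) :=
  [/\ H `<=` [set g | g \in unitmx], H 1%:M,
      forall g h, H g -> H h -> H (g *m h)
    & forall g, H g -> H (invmx g)].

Definition conj_set (C : fieldType) (n : nat) (h : 'M[C]_n) (X : set 'M[C]_n) :
  set 'M[C]_n := [set h *m x *m invmx h | x in X].

Definition group_morphism (C : fieldType) (m n : nat)
    (X : set 'M[C]_m) (Y : set 'M[C]_n) (phi : 'M[C]_m -> 'M[C]_n) :=
  [/\ forall g, X g -> Y (phi g),
      forall g h, X g -> X h -> phi (g *m h) = phi g *m phi h
    & forall i j, regular (fun g : X => phi (val g) i j)].

Definition group_isomorphic (C : fieldType) (m n : nat)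
    (X : set 'M[C]_m) (Y : set 'M[C]_n) :=
  exists (phi : 'M[C]_m -> 'M[C]_n) (psi : 'M[C]_n -> 'M[C]_m),
    [/\ group_morphism X Y phi, group_morphism Y X psi,
        forall g, X g -> psi (phi g) = g & forall g, Y g -> phi (psi g) = g].

Definition diagonal_group (C : fieldType) (n : nat) : set 'M[C]_n :=
  [set g | is_diag_mx g && (g \in unitmx)].
Arguments diagonal_group C n : clear implicits.

Definition is_torus (C : fieldType) (n : nat) (H : set 'M[C]_n) :=
  is_subgroup H /\ exists r : nat, group_isomorphic (diagonal_group C r) H.

Definition maximal_torus (C : fieldType) (n : nat) (G T : set 'M[C]_n) :=
  [/\ is_torus T, T `<=` G
    & forall T' : set 'M[C]_n, is_torus T' -> T' `<=` G -> T `<=` T' -> T' = T].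

Definition is_character (C : fieldType) (n : nat) (P : set 'M[C]_n)
    (chi : 'M[C]_n -> C) :=
  [/\ forall p, P p -> chi p != 0,
      forall p q, P p -> P q -> chi (p *m q) = chi p * chi q
    & regular (fun p : P => chi (val p))].

(* The Clifford algebra of C^8 = W + W', W = C^4 and W' its dual, with the quadratic form
   q(a, b) = \sum_i a_i b_i (a in W, b in W'), acting on its spinor
   module, the exterior algebra of W.  The basis of the spinor module is indexed by
   the subsets I = {i_1 < .. < i_r} of 'I_4, standing for
   e_{i_1} /\ .. /\ e_{i_r}.  This action identifies the Clifford algebra with
   the algebra of all 16 x 16 matrices (acting on column vectors). *)

Notation spinor_dim := #|{: {set 'I_4}}|.

(* Left exterior multiplication by e_i. *)
Definition wedge (C : fieldType) (i : 'I_4) : 'M[C]_spinor_dim :=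
  \matrix_(a, b)
    let J : {set 'I_4} := enum_val a in
    let I : {set 'I_4} := enum_val b in
    if (i \notin I) && (J == i |: I)%SET
    then (-1) ^+ #|[set j in I | (j < i)%N]%SET| else 0.

(* Contraction with the i-th vector of the dual basis. *)
Definition contract (C : fieldType) (i : 'I_4) : 'M[C]_spinor_dim :=
  (wedge C i)^T.

Definition gamma (C : fieldType) (a b : 'rV[C]_4) : 'M[C]_spinor_dim :=
  \sum_(i < 4) (a ord0 i *: wedge C i + b ord0 i *: contract C i).

Definition quad (C : fieldType) (a b : 'rV[C]_4) : C :=
  \sum_(i < 4) a ord0 i * b ord0 i.

(* Products of an even number of unit vectors in the Clifford algebra. *)
Definition Spin8 (C : fieldType) : set 'M[C]_spinor_dim :=
  smallest (@is_subgroup C spinor_dim)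
    [set x | exists a b c d : 'rV[C]_4,
      [/\ quad a b = 1, quad c d = 1 & x = gamma a b *m gamma c d]].
Arguments Spin8 C : clear implicits.

(* The weights of the standard torus on the vectors e_i and f_i (the dual
   basis) are eps_i and - eps_i, and its weight on the basis spinor indexed by
   I is 1/2 (\sum_(i in I) eps_i - \sum_(i notin I) eps_i).  Hence e_i f_j and
   e_i e_j (i != j) are root vectors for eps_i - eps_j and eps_i + eps_j.
   Indices start at 0: the k-th simple root below is alpha_(k+1). *)

Definition simple_root_vec (C : fieldType) (k : 'I_4) : 'M[C]_spinor_dim :=
  if (k < 3)%N then wedge C k *m contract C (inord k.+1)
  else wedge C (inord 2) *m wedge C (inord 3).

(* For each k, simple_root_vec C k, neg_simple_root_vec C k and their commutator
   form an sl_2-triple. *)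
Definition neg_simple_root_vec (C : fieldType) (k : 'I_4) :
  'M[C]_spinor_dim :=
  if (k < 3)%N then wedge C (inord k.+1) *m contract C k
  else contract C (inord 3) *m contract C (inord 2).

(* This is exp (t *: E): the root vectors E above satisfy E *m E = 0. *)
Definition root_elt (C : fieldType) (E : 'M[C]_spinor_dim) (t : C) :
  'M[C]_spinor_dim := 1%:M + t *: E.

Definition weyl_elt (C : fieldType) (k : 'I_4) (z : C) : 'M[C]_spinor_dim :=
  root_elt (simple_root_vec C k) z
  *m root_elt (neg_simple_root_vec C k) (- z^-1)
  *m root_elt (simple_root_vec C k) z.

(* The simple coroot alpha_(k+1)^vee : C^* -> Spin(8, C), i.e. the image of
   diag(z, z^-1) under the morphism SL_2 -> Spin(8, C) attached to the simple
   root; weyl_elt k (-1) is the inverse of weyl_elt k 1. *)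
Definition simple_coroot (C : fieldType) (k : 'I_4) (z : C) :
  'M[C]_spinor_dim := weyl_elt k z *m weyl_elt k (-1).

(* Generators of the standard torus: Spin(8, C) being simply connected, the
   simple coroots form a basis of the cocharacters. *)
Definition torus_gens (C : fieldType) : set 'M[C]_spinor_dim :=
  [set x | exists (k : 'I_4) (z : C), z != 0 /\ x = simple_coroot k z].
Arguments torus_gens C : clear implicits.

Definition positive_root_gens (C : fieldType) : set 'M[C]_spinor_dim :=
  [set x | exists (i j : 'I_4) (t : C), (i < j)%N /\
    (x = root_elt (wedge C i *m contract C j) t \/
     x = root_elt (wedge C i *m wedge C j) t)].
Arguments positive_root_gens C : clear implicits.

(* The standard maximal parabolic subgroup attached to alpha_4: it is generated
   by the standard Borel subgroup and by the root subgroups of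
   - alpha_1, - alpha_2 and - alpha_3. *)
Definition std_parabolic4 (C : fieldType) : set 'M[C]_spinor_dim :=
  smallest (@is_subgroup C spinor_dim)
    (torus_gens C `|` positive_root_gens C `|`
     [set x | exists (k : 'I_4) (t : C),
       (k < 3)%N /\ x = root_elt (neg_simple_root_vec C k) t]).
Arguments std_parabolic4 C : clear implicits.

(* The character omega_4 of the parabolic subgroup h P h^-1, P the standard one:
   its restriction to the torus is dual to the simple coroot of alpha_4. *)
Definition is_omega4 (C : fieldType) (h : 'M[C]_spinor_dim)
    (chi : 'M[C]_spinor_dim -> C) :=
  is_character (conj_set h (std_parabolic4 C)) chi /\
  forall (k : 'I_4) (z : C), z != 0 ->
    chi (h *m simple_coroot k z *m invmx h) = if k == ord_max then z else 1.

Definition spin8_type (C : fieldType) := set_type (Spin8 C).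

HB.instance Definition _ (C : fieldType) := Choice.on (spin8_type C).

Lemma Spin8_1 (C : fieldType) : 1%:M \in Spin8 C.
Proof. by apply/mem_set => H [[]]. Qed.

HB.instance Definition _ (C : fieldType) :=
  isPointed.Build (spin8_type C) (exist _ 1%:M (Spin8_1 C)).

Notation spin8_fun C := (spin8_type C -> C).

(* H^0(G/P, L(lam)) for a character lam of P.  As P contains the positive root
   subgroups, this is the sign for which L(lam) is ample when lam is a positive
   multiple of omega_4. *)
Definition sections (C : fieldType) (P : set 'M[C]_spinor_dim)
    (lam : 'M[C]_spinor_dim -> C) : set (spin8_fun C) :=
  [set f | @regular C spinor_dim (Spin8 C) f /\
    forall (g g' : spin8_type C) (p : 'M[C]_spinor_dim),
      P p -> val g' = val g *m p -> f g' = lam p * f g].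

(* Invariants of the action (t . f)(g) = f(t^-1 g). *)
Definition invariants (C : fieldType) (T : set 'M[C]_spinor_dim)
    (M : set (spin8_fun C)) : set (spin8_fun C) :=
  [set f | M f /\
    forall (g g' : spin8_type C) (t : 'M[C]_spinor_dim),
      T t -> val g' = invmx t *m val g -> f g' = f g].

(* R_k, with omega the character omega_4 of P. *)
Definition Rk (C : fieldType) (T P : set 'M[C]_spinor_dim)
    (omega : 'M[C]_spinor_dim -> C) (k : nat) : set (spin8_fun C) :=
  invariants T (sections P (fun p => (omega p ^+ 2) ^+ k)).

(* Inside the polynomial ring over the functions on Spin(8, C), the elements
   whose k-th coefficient lies in M_k for all k form the external direct sum of
   the M_k, with its graded product. *)
Definition graded_sum (C : fieldType) (M : nat -> set (spin8_fun C)) :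
  set {poly (spin8_fun C)} := [set r | forall k : nat, M k r`_k].

Definition is_subalgebra (C : fieldType) (S : set {poly (spin8_fun C)}) :=
  [/\ forall c : C, S (cst c)%:P,
      forall r s, S r -> S s -> S (r + s)
    & forall r s, S r -> S s -> S (r * s)].

Definition generated_in_degree1 (C : fieldType)
    (M : nat -> set (spin8_fun C)) :=
  graded_sum M = smallest (@is_subalgebra C) [set f%:P * 'X | f in M 1%N].

(* Main.v *)
Require Import Defs.
From HB Require Import structures.
From mathcomp Require Import all_boot all_order all_algebra.
From mathcomp Require Import separable cyclotomic complex.
From mathcomp Require Import boolp classical_sets functions reals.
From mathcomp Require Import ring zify.
From mathcomp Require mpoly.
Import (canonicals) mpoly.

(* By triality the half-spin representation S of highest weight omega_4 is the
   vector representation of another copy of Spin(8), and its 8 weights come in 4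
   opposite pairs.  So T-invariant monomials of degree 2 k in the weight
   coordinates are products of k of the 4 products x_I x_J (J the complement of
   I), which are elements of R_1.

   - A maximal torus T is conjugate to the standard torus T_0.  Its elements of
     finite order in the coordinate directions of T are simultaneously
     diagonalizable on V = C^8.  These elements are squares of each other, so an
     anisotropic common eigenvector is fixed by them, whence a hyperbolic basis
     of eigenvectors.  By Witt's theorem it is the image of the standard one
     under an element of Spin(8), and the whole of T follows its elements of
     finite order by density of the roots of unity in C^*.
   - After translation, a T-invariant section is a function F on Spin(8) that is
     left invariant under T_0 and transforms by chi^(2 k) under the standard
     parabolic P.  On the opposite unipotent radical U = C^6 it is a polynomial
     f in the entries a_ij (i < j) of an alternating matrix.  Invariance under
     T_0 says that each index i occurs k times in every monomial of f, so f is a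
     polynomial of degree k in a_01 a_23, a_02 a_13 and a_03 a_12, which are the
     restrictions to U of sections from R_1.  No bound on the degree of f is
     needed besides this one.
   - Two regular functions that agree on U P agree on Spin(8): the latter is
     generated by root subgroups, all but that of alpha_4 preserve U P, and for
     t generic in this one a translate of a given point of U P is again in U P. *)

Set Implicit Arguments.
Unset Strict Implicit.
Unset Printing Implicit Defensive.

Import Order.TTheory GRing.Theory Num.Theory.
Local Open Scope classical_set_scope.
Local Open Scope ring_scope.

(** * Coordinates on the spinor module *)

(** Three of the four products x_I x_J are enough: the spinors in the orbit of the highest weight
    vector are isotropic for the invariant form of S, which makes the product for I full and J empty
    a signed sum of the other three. On U that product is, up to sign, the Pfaffian of the matrix
    (a_ij). The exponent k enters through P: an element of T_0 acting from the left can be moved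
    past U, at the price of rescaling the a_ij, to the right of U, where as an element of P it
    contributes its value under chi^(2 k). T and P are put in standard position independently of
    each other, by a left and a right translation, which commute. *)

Section Spinors.
Variable C : fieldType.
Implicit Types (i j : 'I_4) (v : 'cV[C]_spinor_dim).

(** Spinor identities are checked coordinate by coordinate. Indexing a coordinate by four booleans
    instead of a subset lets [case] and [ring] settle the finitely many cases. *)
Definition bitset (b0 b1 b2 b3 : bool) : {set 'I_4} :=
  [set i : 'I_4 | nth false [:: b0; b1; b2; b3] i]%SET.

Definition spin_coord v b0 b1 b2 b3 : C := v (enum_rank (bitset b0 b1 b2 b3)) ord0.

Lemma bitsetP (J : {set 'I_4}) : exists b0 b1 b2 b3, J = bitset b0 b1 b2 b3.
Proof.
exists (inord 0 \in J), (inord 1 \in J), (inord 2 \in J), (inord 3 \in J).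
apply/setP => i; rewrite inE.
by case: i => [[|[|[|[|//]]]] hi] /=; congr (_ \in J); apply: val_inj;
  rewrite /= inordK.
Qed.

Lemma coord_inj v w :
  (forall b0 b1 b2 b3, spin_coord v b0 b1 b2 b3 = spin_coord w b0 b1 b2 b3) -> v = w.
Proof.
move=> h; apply/matrixP => a z; rewrite ord1.
have [b0 [b1 [b2 [b3 e]]]] := bitsetP (enum_val a).
by move: (h b0 b1 b2 b3); rewrite /spin_coord -e enum_valK.
Qed.

Lemma mulmx_wedge i v J :
  (wedge C i *m v) (enum_rank J) ord0 =
  if i \in J then (-1) ^+ #|[set j in J | (j < i)%N]%SET| *
    v (enum_rank (J :\ i)%SET) ord0 else 0.
Proof.
rewrite mxE; case: ifPn => iJ; last first.
  apply: big1 => b _; rewrite mxE /= enum_rankK; case: ifP => [/andP[_ /eqP e]|].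
    by rewrite e finset.setU11 in iJ.
  by rewrite mul0r.
rewrite (bigD1 (enum_rank (J :\ i)%SET)) //= big1 ?addr0 => [|b nb].
  rewrite mxE /= !enum_rankK finset.setD11 /= finset.setD1K // eqxx.
  suff -> : [set j in J :\ i | (j < i)%N]%SET = [set j in J | (j < i)%N]%SET by [].
  by apply/setP => j; rewrite !inE; have [->|] := eqVneq j i; rewrite /= ?ltnn ?andbF.
rewrite mxE /= enum_rankK; case: ifP => [/andP[iI /eqP e]|]; last by rewrite mul0r.
by case/negP: nb; rewrite e finset.setU1K // enum_valK.
Qed.

Lemma mulmx_contract i v J :
  (contract C i *m v) (enum_rank J) ord0 =
  if i \notin J then (-1) ^+ #|[set j in J | (j < i)%N]%SET| *
    v (enum_rank (i |: J)%SET) ord0 else 0.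
Proof.
rewrite mxE; case: ifPn => iJ; last first.
  apply: big1 => b _; rewrite !mxE /= enum_rankK.
  by rewrite (negPf iJ) mul0r.
rewrite (bigD1 (enum_rank (i |: J)%SET)) //= big1 ?addr0 => [|b nb].
  by rewrite !mxE /= !enum_rankK iJ eqxx.
rewrite !mxE /= enum_rankK iJ; case: ifP => [/eqP e|]; last by rewrite mul0r.
by case/negP: nb; rewrite -e enum_valK.
Qed.

(** The sign for moving past a basis vector that occurs ([true]) or does not occur ([false]) in a
    wedge product. *)
Definition sgn (b : bool) : C := if b then -1 else 1.

Lemma coord_wedge i v b0 b1 b2 b3 :
  spin_coord (wedge C i *m v) b0 b1 b2 b3 =
  match val i with
  | 0%N => if b0 then spin_coord v false b1 b2 b3 else 0
  | 1%N => if b1 then sgn b0 * spin_coord v b0 false b2 b3 else 0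
  | 2%N => if b2 then sgn b0 * sgn b1 * spin_coord v b0 b1 false b3 else 0
  | _ => if b3 then sgn b0 * sgn b1 * sgn b2 * spin_coord v b0 b1 b2 false else 0
  end.
Proof.
rewrite /spin_coord mulmx_wedge.
have -> : (i \in bitset b0 b1 b2 b3) = nth false [:: b0; b1; b2; b3] i.
  by rewrite inE.
rewrite -sum1_card big_mkcond /= !big_ord_recl big_ord0 !inE /=.
have E c0 c1 c2 c3 : (forall j : 'I_4, (j != i) && nth false [:: b0; b1; b2; b3] j
    = nth false [:: c0; c1; c2; c3] j) ->
    (bitset b0 b1 b2 b3 :\ i)%SET = bitset c0 c1 c2 c3.
  by move=> h; apply/setP => j; rewrite !inE h.
by case: i E => [[|[|[|[|//]]]] hi] /= E; case: ifP => // _; rewrite ?andbF ?andbT;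
  [rewrite (E false b1 b2 b3)|rewrite (E b0 false b2 b3)
  |rewrite (E b0 b1 false b3)|rewrite (E b0 b1 b2 false)];
  try (by case=> [[|[|[|[|//]]]] ?]; rewrite -(inj_eq val_inj) /=);
  rewrite /sgn; do ?case: ifP => _; rewrite ?addn0 /= ?expr0 ?mul1r ?expr1 ?mulr1 ?mulN1r //
    ?opprK // ?exprS ?expr0 ?mulr1 ?mulrN1 ?opprK ?mul1r ?mulN1r.
Qed.

Lemma coord_contract i v b0 b1 b2 b3 :
  spin_coord (contract C i *m v) b0 b1 b2 b3 =
  match val i with
  | 0%N => if b0 then 0 else spin_coord v true b1 b2 b3
  | 1%N => if b1 then 0 else sgn b0 * spin_coord v b0 true b2 b3
  | 2%N => if b2 then 0 else sgn b0 * sgn b1 * spin_coord v b0 b1 true b3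
  | _ => if b3 then 0 else sgn b0 * sgn b1 * sgn b2 * spin_coord v b0 b1 b2 true
  end.
Proof.
rewrite /spin_coord mulmx_contract.
have -> : (i \in bitset b0 b1 b2 b3) = nth false [:: b0; b1; b2; b3] i.
  by rewrite inE.
rewrite if_neg -sum1_card big_mkcond /= !big_ord_recl big_ord0 !inE /=.
have E c0 c1 c2 c3 : (forall j : 'I_4, (j == i) || nth false [:: b0; b1; b2; b3] j
    = nth false [:: c0; c1; c2; c3] j) ->
    (i |: bitset b0 b1 b2 b3)%SET = bitset c0 c1 c2 c3.
  by move=> h; apply/setP => j; rewrite !inE h.
by case: i E => [[|[|[|[|//]]]] hi] /= E; case: ifP => // _; rewrite ?andbF ?andbT;
  [rewrite (E true b1 b2 b3)|rewrite (E b0 true b2 b3)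
  |rewrite (E b0 b1 true b3)|rewrite (E b0 b1 b2 true)];
  try (by case=> [[|[|[|[|//]]]] ?]; rewrite -(inj_eq val_inj) /=);
  rewrite /sgn; do ?case: ifP => _; rewrite ?addn0 /= ?expr0 ?mul1r ?expr1 ?mulr1 ?mulN1r //
    ?opprK // ?exprS ?expr0 ?mulr1 ?mulrN1 ?opprK ?mul1r ?mulN1r.
Qed.

Lemma spin_coordD v w b0 b1 b2 b3 :
  spin_coord (v + w) b0 b1 b2 b3 = spin_coord v b0 b1 b2 b3 + spin_coord w b0 b1 b2 b3.
Proof. by rewrite /spin_coord mxE. Qed.

Lemma spin_coordN v b0 b1 b2 b3 : spin_coord (- v) b0 b1 b2 b3 = - spin_coord v b0 b1 b2 b3.
Proof. by rewrite /spin_coord mxE. Qed.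

Lemma spin_coordZ t v b0 b1 b2 b3 :
  spin_coord (t *: v) b0 b1 b2 b3 = t * spin_coord v b0 b1 b2 b3.
Proof. by rewrite /spin_coord mxE. Qed.

Lemma spin_coord0 b0 b1 b2 b3 : spin_coord 0 b0 b1 b2 b3 = 0.
Proof. by rewrite /spin_coord mxE. Qed.

Lemma spinor_ext (A B : 'M[C]_spinor_dim) :
  (forall v, A *m v = B *m v) -> A = B.
Proof.
move=> h; apply/matrixP => a b.
have := h (delta_mx b ord0); rewrite -!colE => /matrixP /(_ a ord0).
by rewrite !mxE.
Qed.

Definition spin_coordE := (spin_coordD, spin_coordN, spin_coordZ, spin_coord0, coord_wedge, coord_contract).

End Spinors.

Ltac spinor := apply: spinor_ext => v; apply: coord_inj => b0 b1 b2 b3;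
  rewrite !(mulmxDl, mulmxDr, mulNmx, mulmxN, mul1mx, mul0mx, mulmx0, =^~ scalemxAl, =^~ scalemxAr, =^~ mulmxA, mul_scalar_mx);
  rewrite !spin_coordE /=.

Section Clifford.
Variable C : fieldType.
Implicit Types (i j : 'I_4).
Notation W := (wedge C).
Notation F := (contract C).

Lemma wedge_wedge i j : W i *m W j + W j *m W i = 0.
Proof.
case: i => [[|[|[|[|//]]]] hi]; case: j => [[|[|[|[|//]]]] hj];
spinor; case: b0; case: b1; case: b2; case: b3; rewrite /sgn /=; ring.
Qed.

Lemma wedge_contract i j : W i *m F j + F j *m W i = (i == j)%:R%:M.
Proof.
case: i => [[|[|[|[|//]]]] hi]; case: j => [[|[|[|[|//]]]] hj];
rewrite -(inj_eq val_inj);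
spinor; case: b0; case: b1; case: b2; case: b3; rewrite /sgn /=; ring.
Qed.

Lemma contract_contract i j : F i *m F j + F j *m F i = 0.
Proof.
by rewrite /contract -!trmx_mul -raddfD /= addrC addrC wedge_wedge trmx0.
Qed.

End Clifford.

(** * The quadratic space and the Clifford relations *)

Section Vectors.
Variable C : numClosedFieldType.
Implicit Types (i j k : 'I_4) (u v w n m : 'rV[C]_(4 + 4)) (t : C).
Notation W := (wedge C).
Notation F := (contract C).

(* Locked: otherwise unification sees through [gam v] to the sum defining [gamma]. *)
Definition gam : 'rV[C]_(4 + 4) -> 'M[C]_spinor_dim :=
  locked (fun v => gamma (lsubmx v) (rsubmx v)).

Definition qf v : C := quad (lsubmx v) (rsubmx v).

Definition bf v w : C :=
  \sum_(i < 4) (lsubmx v ord0 i * rsubmx w ord0 i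
                + rsubmx v ord0 i * lsubmx w ord0 i).

Definition ev i : 'rV[C]_(4 + 4) := row_mx (delta_mx ord0 i) 0.
Definition fv i : 'rV[C]_(4 + 4) := row_mx 0 (delta_mx ord0 i).

Lemma bfC v w : bf v w = bf w v.
Proof. by apply: eq_bigr => i _; rewrite addrC mulrC [in X in _ + X]mulrC. Qed.

Lemma bfDl u v w : bf (u + v) w = bf u w + bf v w.
Proof.
by rewrite -big_split; apply: eq_bigr => i _; rewrite !linearD !mxE /=; ring.
Qed.

Lemma bfZl t v w : bf (t *: v) w = t * bf v w.
Proof.
by rewrite big_distrr; apply: eq_bigr => i _; rewrite !linearZ !mxE /=; ring.
Qed.

Lemma bfDr u v w : bf w (u + v) = bf w u + bf w v.
Proof. by rewrite bfC bfDl !(bfC w). Qed.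

Lemma bfZr t v w : bf w (t *: v) = t * bf w v.
Proof. by rewrite bfC bfZl (bfC w). Qed.

Lemma bfNl v w : bf (- v) w = - bf v w.
Proof. by rewrite -scaleN1r bfZl mulN1r. Qed.

Lemma bfNr v w : bf w (- v) = - bf w v.
Proof. by rewrite bfC bfNl bfC. Qed.

Lemma bf0l w : bf 0 w = 0.
Proof. by rewrite -(scale0r 0) bfZl mul0r. Qed.

Lemma bf0r w : bf w 0 = 0.
Proof. by rewrite bfC bf0l. Qed.

Lemma bfvv v : bf v v = 2 * qf v.
Proof. by rewrite mulr_sumr; apply: eq_bigr => i _; ring. Qed.

Lemma bf_ev v i : bf v (ev i) = rsubmx v ord0 i.
Proof.
rewrite /bf (bigD1 i) //= big1 ?addr0 => [|j nj].
  by rewrite row_mxKl row_mxKr !mxE !eqxx /= mulr0 add0r mulr1.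
by rewrite row_mxKl row_mxKr !mxE (negPf nj) /= !mulr0 add0r.
Qed.

Lemma bf_fv v i : bf v (fv i) = lsubmx v ord0 i.
Proof.
rewrite /bf (bigD1 i) //= big1 ?addr0 => [|j nj].
  by rewrite row_mxKl row_mxKr !mxE !eqxx /= mulr0 addr0 mulr1.
by rewrite row_mxKl row_mxKr !mxE (negPf nj) /= !mulr0 add0r.
Qed.

Lemma bf_nondeg v : (forall w, bf v w = 0) -> v = 0.
Proof.
move=> h; rewrite -[v]hsubmxK -[RHS]hsubmxK; congr row_mx; apply/rowP => i.
  by rewrite linear0 [RHS]mxE -bf_fv h.
by rewrite linear0 [RHS]mxE -bf_ev h.
Qed.

Lemma bf_ee i j : bf (ev i) (ev j) = 0.
Proof. by rewrite bf_ev row_mxKr mxE. Qed.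
Lemma bf_ff i j : bf (fv i) (fv j) = 0.
Proof. by rewrite bf_fv row_mxKl mxE. Qed.
Lemma bf_ef i j : bf (ev i) (fv j) = (i == j)%:R.
Proof. by rewrite bf_fv row_mxKl !mxE eqxx eq_sym. Qed.
Lemma bf_fe i j : bf (fv i) (ev j) = (i == j)%:R.
Proof. by rewrite bfC bf_ef eq_sym. Qed.

Lemma gamE v :
  gam v = \sum_(i < 4) (bf v (fv i) *: W i + bf v (ev i) *: F i).
Proof. by rewrite /gam -lock; apply: eq_bigr => i _; rewrite bf_ev bf_fv. Qed.

Lemma bfE v w : bf v w =
  \sum_(i < 4) (bf v (fv i) * bf w (ev i) + bf v (ev i) * bf w (fv i)).
Proof. by apply: eq_bigr => i _; rewrite !bf_ev !bf_fv. Qed.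

Lemma gam_gamma v : gam v = gamma (lsubmx v) (rsubmx v).
Proof. by rewrite /gam -lock. Qed.

Lemma gam_linear : linear gam.
Proof.
move=> t u v; rewrite !gam_gamma /gamma scaler_sumr -big_split; apply: eq_bigr => i _ /=.
by rewrite scalerDr !scalerA !mxE /= !scalerDl addrACA.
Qed.
HB.instance Definition _ :=
  GRing.isLinear.Build C 'rV[C]_(4 + 4) 'M[C]_spinor_dim _ gam gam_linear.

Lemma gam_ev i : gam (ev i) = W i.
Proof.
rewrite !gam_gamma /gamma (bigD1 i) //= big1 ?addr0 => [|j nj].
  by rewrite row_mxKl row_mxKr !mxE !eqxx scale0r addr0 scale1r.
by rewrite row_mxKl row_mxKr !mxE (negPf nj) !scale0r addr0.
Qed.

Lemma gam_fv i : gam (fv i) = F i.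
Proof.
rewrite !gam_gamma /gamma (bigD1 i) //= big1 ?addr0 => [|j nj].
  by rewrite row_mxKl row_mxKr !mxE !eqxx scale0r add0r scale1r.
by rewrite row_mxKl row_mxKr !mxE (negPf nj) !scale0r addr0.
Qed.

Lemma gamD v w : gam (v + w) = gam v + gam w. Proof. exact: linearD. Qed.
Lemma gamZ t v : gam (t *: v) = t *: gam v. Proof. exact: linearZ. Qed.
Lemma gamN v : gam (- v) = - gam v. Proof. exact: linearN. Qed.
Lemma gamB v w : gam (v - w) = gam v - gam w. Proof. exact: linearB. Qed.
Lemma gam0 : gam 0 = 0. Proof. exact: linear0. Qed.

(** Both sides are bilinear, so the relations between basis vectors suffice; [H1] and [H2] extend
    them in one argument first. *)
Lemma gam_clifford v w : gam v *m gam w + gam w *m gam v = (bf v w)%:M.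
Proof.
have H1 j v' : W j *m gam v' + gam v' *m W j = (bf v' (ev j))%:M.
  rewrite gamE mulmx_suml mulmx_sumr -big_split /= (bigD1 j) //= big1 ?addr0 => [|i ni].
    rewrite mulmxDr mulmxDl -!scalemxAl -!scalemxAr addrACA -!scalerDr.
    by rewrite wedge_wedge wedge_contract eqxx scaler0 add0r scale_scalar_mx mulr1.
  rewrite mulmxDr mulmxDl -!scalemxAl -!scalemxAr addrACA -!scalerDr.
  rewrite wedge_wedge wedge_contract.
  by rewrite eq_sym (negPf ni) -scalemx1 !(scaler0, scale0r) addr0.
have H2 j v' : F j *m gam v' + gam v' *m F j = (bf v' (fv j))%:M.
  rewrite gamE mulmx_suml mulmx_sumr -big_split /= (bigD1 j) //= big1 ?addr0 => [|i ni].
    rewrite mulmxDr mulmxDl -!scalemxAl -!scalemxAr addrACA -!scalerDr.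
    rewrite contract_contract [F j *m _ + _]addrC wedge_contract.
    by rewrite eqxx scaler0 addr0 scale_scalar_mx mulr1.
  rewrite mulmxDr mulmxDl -!scalemxAl -!scalemxAr addrACA -!scalerDr.
  rewrite contract_contract [F j *m _ + _]addrC wedge_contract.
  by rewrite (negPf ni) -scalemx1 !(scaler0, scale0r) addr0.
rewrite (bfE v w) raddf_sum /= (gamE w) mulmx_sumr mulmx_suml -big_split /=.
apply: eq_bigr => i _; rewrite mulmxDr mulmxDl -!scalemxAl -!scalemxAr addrACA -!scalerDr.
rewrite [_ *m W i + _]addrC [_ *m F i + _]addrC H1 H2.
by rewrite !scale_scalar_mx -raddfD /=; congr (_%:M); ring.
Qed.

Lemma gamC v w : gam w *m gam v = (bf v w)%:M - gam v *m gam w.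
Proof. by rewrite -gam_clifford addrC addKr. Qed.

Lemma gam_sq v : gam v *m gam v = (qf v)%:M.
Proof.
have := gam_clifford v v; rewrite bfvv -mulr2n mulr_natl raddfMn /= => h.
apply: (scalerI (_ : 2%:R != 0 :> C)); first by rewrite pnatr_eq0.
by rewrite !scaler_nat.
Qed.

(** The bilinear form is recovered from anticommutators, so its nondegeneracy gives injectivity. *)
Lemma gam_inj v : gam v = 0 -> v = 0.
Proof.
move=> h; apply: bf_nondeg => w.
have := gam_clifford v w; rewrite h mul0mx mulmx0 addr0 => /esym e.
have a : 'I_spinor_dim by exact: (enum_rank (finset.set0 : {set 'I_4})).
by move/matrixP: e => /(_ a a); rewrite !mxE eqxx mulr1n.
Qed.

(** Conjugation by a unit vector is the negative of the reflection in its orthogonal hyperplane. *)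
Lemma gam_reflect n v : qf n = 1 ->
  gam n *m gam v *m gam n = gam (bf n v *: n - v).
Proof.
move=> hn; rewrite -mulmxA (gamC n) mulmxBr mulmxA gam_sq hn mul1mx.
by rewrite mul_mx_scalar gamB gamZ.
Qed.

Lemma qfD v w : qf (v + w) = qf v + qf w + bf v w.
Proof.
apply: (mulfI (_ : 2%:R != 0 :> C)); first by rewrite pnatr_eq0.
by rewrite -bfvv bfDl !bfDr !bfvv (bfC w); ring.
Qed.

Lemma qfZ t v : qf (t *: v) = t ^+ 2 * qf v.
Proof.
apply: (mulfI (_ : 2%:R != 0 :> C)); first by rewrite pnatr_eq0.
by rewrite -bfvv bfZl bfZr !bfvv; ring.
Qed.

Lemma qfN v : qf (- v) = qf v.
Proof. by rewrite -scaleN1r qfZ sqrrN expr1n mul1r. Qed.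

Lemma qf_ev i : qf (ev i) = 0.
Proof.
by apply/eqP; have := bf_ee i i; rewrite bfvv => /eqP; rewrite mulf_eq0 pnatr_eq0.
Qed.

Lemma qf_fv i : qf (fv i) = 0.
Proof.
by apply/eqP; have := bf_ff i i; rewrite bfvv => /eqP; rewrite mulf_eq0 pnatr_eq0.
Qed.

End Vectors.

(** * The spin group and its vector representation *)

Section Generated.
Variables (C : fieldType) (n : nat).
Implicit Types (S H : set 'M[C]_n).

Lemma smallest_subgroup S : S `<=` [set g | g \in unitmx] ->
  is_subgroup (smallest (@is_subgroup C n) S).
Proof.
move=> SU; have GL : is_subgroup [set g : 'M[C]_n | g \in unitmx].
  split=> //=; [exact: unitmx1|by move=> g h gU hU; rewrite unitmx_mul gU|].
  by move=> g; rewrite unitmx_inv.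
split=> [x|H|x y Sx Sy H|x Sx H] => [/(_ _ (conj GL SU))//|[[]]//|HS|HS].
- by case: (HS.1) => _ _ + _; apply; [exact: Sx|exact: Sy].
- by case: (HS.1) => _ _ _; apply; exact: Sx.
Qed.

Lemma sub_smallest_subgroup S : S `<=` smallest (@is_subgroup C n) S.
Proof. exact: sub_gen_smallest. Qed.

Lemma mulmx_unit_cancel (A B : 'M[C]_n) : A *m B = 1%:M ->
  (A \in unitmx) * (B \in unitmx) * (invmx A = B).
Proof.
move=> AB; have [uA uB] := mulmx1_unit AB.
by rewrite uA uB; split=> //; rewrite -(mulKmx uA B) AB mulmx1.
Qed.

End Generated.

Section Spin.
Variable C : numClosedFieldType.
Implicit Types (i j k : 'I_4) (u v w n m : 'rV[C]_(4 + 4)) (t : C).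
Implicit Types (g h : 'M[C]_spinor_dim).
Notation W := (wedge C).
Notation F := (contract C).
Notation gam := (@gam C).
Notation Spin := (Spin8 C).

Lemma gam_gen a b c d : @quad C a b = 1 -> quad c d = 1 ->
  (gamma a b *m gamma c d) *m (gamma c d *m gamma a b) = 1%:M.
Proof.
move=> hab hcd; have E (x y : 'rV[C]_4) : quad x y = 1 -> gamma x y *m gamma x y = 1%:M.
  move=> h; have := gam_sq (row_mx x y).
  by rewrite gam_gamma /qf row_mxKl row_mxKr h.
by rewrite mulmxA -(mulmxA (gamma a b)) E // mulmx1 E.
Qed.

Lemma Spin_subgroup : is_subgroup Spin.
Proof.
apply: smallest_subgroup => _ [a [b [c [d [hab hcd ->]]]]] /=.
by have [[]] := mulmx_unit_cancel (gam_gen hab hcd).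
Qed.

Lemma Spin_unit g : Spin g -> g \in unitmx.
Proof. by case: Spin_subgroup => + _ _ _; apply. Qed.
Lemma Spin1 : Spin 1%:M. Proof. by case: Spin_subgroup. Qed.
Lemma SpinM g h : Spin g -> Spin h -> Spin (g *m h).
Proof. by case: Spin_subgroup => _ _ + _; apply. Qed.
Lemma SpinV g : Spin g -> Spin (invmx g).
Proof. by case: Spin_subgroup => _ _ _; apply. Qed.

Lemma Spin_pair n m : qf n = 1 -> qf m = 1 -> Spin (gam n *m gam m).
Proof.
move=> hn hm; apply: sub_smallest_subgroup.
by exists (lsubmx n), (rsubmx n), (lsubmx m), (rsubmx m); rewrite -!gam_gamma.
Qed.

Lemma Spin_ind (K : set 'M[C]_spinor_dim) : is_subgroup K ->
  (forall n m, qf n = 1 -> qf m = 1 -> K (gam n *m gam m)) -> Spin `<=` K.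
Proof.
move=> Kg Kp; apply: smallest_sub => // _ [a [b [c [d [hab hcd ->]]]]].
have := Kp (row_mx a b) (row_mx c d).
by rewrite !gam_gamma /qf !row_mxKl !row_mxKr; apply.
Qed.

(** The exponential of [t *: (gam v *m gam w)] when [v] and [w] span an isotropic subspace, since
    that product then squares to zero. *)
Definition spin_root v w t := 1%:M + t *: (gam v *m gam w).

Definition null_pair v w := [/\ qf v = 0, qf w = 0 & bf v w = 0].

Lemma null_pair_sq v w : null_pair v w ->
  (gam v *m gam w) *m (gam v *m gam w) = 0.
Proof.
case=> hv hw hvw; rewrite mulmxA -(mulmxA (gam v)) (gamC v w) hvw raddf0 sub0r.
by rewrite mulmxN mulNmx mulmxA gam_sq hv raddf0 !mul0mx oppr0.
Qed.

Lemma spin_root_add v w s t : null_pair v w -> spin_root v w s *m spin_root v w t = spin_root v w (s + t).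
Proof.
move=> vw; rewrite /spin_root mulmxDl mul1mx mulmxDr mulmx1 -scalemxAl -scalemxAr.
by rewrite null_pair_sq // !scaler0 addr0 scalerDl -addrA [t *: _ + _]addrC.
Qed.

Lemma spin_root_inv v w t : null_pair v w ->
  (spin_root v w t \in unitmx) * (invmx (spin_root v w t) = spin_root v w (- t)).
Proof.
move=> vw; have := spin_root_add t (- t) vw; rewrite subrr {3}/spin_root scale0r addr0.
by move/mulmx_unit_cancel => [[-> _] ->].
Qed.

(* Multiplying by a unit vector [n] orthogonal to both [v] and [w] turns [v]
   into the unit vector [v + n]. *)
Lemma spin_root_Spin v w n t : null_pair v w ->
  qf n = 1 -> bf n v = 0 -> bf n w = 0 -> Spin (spin_root v w t).
Proof.
move=> [hv hw hvw] hn hnv hnw.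
have U x : qf x = 1 -> bf x w = 0 -> Spin (1%:M + gam x *m gam (t *: w)).
  move=> hx hxw; have -> : 1%:M + gam x *m gam (t *: w) = gam x *m gam (x + t *: w).
    by rewrite gamD mulmxDr gam_sq hx.
  by apply: Spin_pair => //; rewrite qfD bfZr hxw qfZ hw hx !mulr0 !addr0.
have -> : spin_root v w t = (1%:M + gam (v + n) *m gam (t *: w)) *m
                       (1%:M + gam (- n) *m gam (t *: w)).
  rewrite mulmxDl mul1mx mulmxDr mulmx1 mulmxA -[_ *m gam (- n)]mulmxA gamN.
  rewrite [gam (t *: w) *m - _]mulmxN (gamC n) bfZr hnw mulr0 raddf0 sub0r opprK.
  rewrite mulmxA -!mulmxA gam_sq qfZ hw mulr0 raddf0 !mulmx0 addr0 -addrA; congr (_ + _).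
  by rewrite mulNmx gamD mulmxDl addrC addrK gamZ -scalemxAr.
apply: SpinM; apply: U; rewrite ?qfN ?bfNl ?hnw ?oppr0 //.
- by rewrite qfD bfC hnv hv hn add0r addr0.
- by rewrite bfDl hvw hnw addr0.
Qed.

(** The vector representation, as an intertwining relation that avoids inverting [g]. Vectors are
    rows, hence the reversed product in [spin_actM]. *)
Definition spin_act g (A : 'M[C]_(4 + 4)) :=
  forall v, g *m gam v = gam (v *m A) *m g.

Lemma spin_actM g h A B : spin_act g A -> spin_act h B -> spin_act (g *m h) (B *m A).
Proof. by move=> gA hB v; rewrite -mulmxA hB mulmxA gA !mulmxA. Qed.

Lemma spin_act_bf g A v w : g \in unitmx -> spin_act g A ->
  bf (v *m A) (w *m A) = bf v w.
Proof.
move=> gU gA; have : g *m (gam v *m gam w + gam w *m gam v) =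
    (gam (v *m A) *m gam (w *m A) + gam (w *m A) *m gam (v *m A)) *m g.
  by rewrite mulmxDr mulmxDl !mulmxA !gA -!mulmxA !gA.
rewrite !gam_clifford scalar_mxC => /(can_inj (mulmxK gU)) e.
have a : 'I_spinor_dim by exact: (enum_rank (finset.set0 : {set 'I_4})).
by move/matrixP: e => /(_ a a); rewrite !mxE eqxx !mulr1n => ->.
Qed.

Lemma spin_act_unit g A : g \in unitmx -> spin_act g A -> A \in unitmx.
Proof.
move=> gU gA; rewrite -row_free_unit -kermx_eq0; apply/eqP/row_matrixP => i.
rewrite row0; apply: bf_nondeg => w; rewrite -(spin_act_bf _ _ gU gA).
by rewrite -row_mul mulmx_ker row0 bf0l.
Qed.

Lemma spin_actV g A : g \in unitmx -> spin_act g A -> spin_act (invmx g) (invmx A).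
Proof.
move=> gU gA v; have AU := spin_act_unit gU gA.
apply: (can_inj (mulKmx gU)); apply: (can_inj (mulmxK gU)).
by rewrite !mulmxA gA mulmxV // mul1mx -!mulmxA !mulVmx // !mulmx1.
Qed.

Lemma spin_act1 : spin_act 1%:M 1%:M.
Proof. by move=> v; rewrite mul1mx !mulmx1. Qed.

Lemma spin_act_uniq g A B : g \in unitmx -> spin_act g A -> spin_act g B -> A = B.
Proof.
move=> gU gA gB; apply/row_matrixP => i; rewrite !rowE.
apply/eqP; rewrite -subr_eq0; apply/eqP/gam_inj; rewrite gamB; apply/eqP.
by rewrite subr_eq0; apply/eqP/(can_inj (mulmxK gU)); rewrite -gA -gB.
Qed.

Lemma reflect_linear n : linear (fun v => bf n v *: n - v).
Proof.
move=> t u v; rewrite bfDr bfZr scalerDl scalerBr scalerA opprD.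
by rewrite addrACA.
Qed.

(** A product of two unit vectors acts by two negated reflections, and having a matrix passes to
    products and inverses. *)
Lemma Spin_act g : Spin g -> exists A, spin_act g A.
Proof.
pose K := [set g | g \in unitmx /\ exists A, spin_act g A].
move=> Sg; suff [] : K g by [].
apply: Spin_ind Sg => [|n m hn hm].
  split=> [x []//||x y [xU [A xA]] [yU [B yB]]|x [xU [A xA]]] /=.
  - by split; [exact: unitmx1|exists 1%:M; exact: spin_act1].
  - by split; [rewrite unitmx_mul xU|exists (B *m A); exact: spin_actM].
  - by split; [rewrite unitmx_inv|exists (invmx A); exact: spin_actV].
split; first by apply: Spin_unit; apply: Spin_pair.
have H x : qf x = 1 -> spin_act (gam x) (lin1_mx (fun v => bf x v *: x - v)).
  move=> hx v; pose f := GRing.isLinear.Build _ _ _ _ _ (reflect_linear x).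
  pose f' : {linear 'rV[C]_(4 + 4) -> 'rV[C]_(4 + 4)} := HB.pack (fun v => bf x v *: x - v) f.
  have -> : v *m lin1_mx (fun v => bf x v *: x - v) = bf x v *: x - v.
    exact: (mul_rV_lin1 f').
  by rewrite -gam_reflect // -mulmxA gam_sq hx mulmx1.
by exists (lin1_mx (fun v => bf m v *: m - v) *m lin1_mx (fun v => bf n v *: n - v));
  apply: spin_actM; exact: H.
Qed.

(** An Eichler transformation. Its usual quadratic term in [t] vanishes because [v] and [w] are both
    isotropic and orthogonal to each other. *)
Lemma spin_root_act v w u t : null_pair v w ->
  spin_root v w t *m gam u = gam (u + t *: (bf w u *: v - bf v u *: w)) *m spin_root v w t.
Proof.
move=> vw; have [hv hw hvw] := vw.
have e : gam v *m gam w *m gam u =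
    gam u *m (gam v *m gam w) + gam (bf w u *: v - bf v u *: w).
  rewrite -mulmxA (gamC u w) mulmxBr [gam v *m (_ *m _)]mulmxA (gamC u v) mulmxBl -[_ *m _ *m gam w]mulmxA.
  rewrite mul_mx_scalar mul_scalar_mx gamB !gamZ opprB addrC (bfC u w) (bfC u v).
  by rewrite addrAC addrA.
rewrite /spin_root mulmxDl mul1mx -scalemxAl e scalerDr addrA mulmxDr mulmx1 gamD gamZ.
have -> : (gam u + t *: gam (bf w u *: v - bf v u *: w)) *m (t *: (gam v *m gam w))
    = t *: (gam u *m (gam v *m gam w)).
  rewrite mulmxDl -!scalemxAl -!scalemxAr.
  suff -> : gam (bf w u *: v - bf v u *: w) *m (gam v *m gam w) = 0 by rewrite !scaler0 addr0.
  rewrite gamB !gamZ mulmxBl -!scalemxAl !mulmxA gam_sq hv raddf0 mul0mx scaler0.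
  rewrite (gamC v w) hvw raddf0 !sub0r mulNmx -mulmxA gam_sq hw raddf0 mulmx0.
  by rewrite oppr0 scaler0 oppr0.
by rewrite addrAC.
Qed.

End Spin.

(** * Generation of the spin group by root subgroups *)

Section Generation.
Variable C : numClosedFieldType.
Implicit Types (i j k : 'I_4) (u v w n m : 'rV[C]_(4 + 4)) (t : C).
Implicit Types (g h : 'M[C]_spinor_dim).
Notation gam := (@gam C).
Notation ev := (ev C).
Notation fv := (fv C).

Lemma spin_root_conj g v w v' w' t : g *m gam v = gam v' *m g ->
  g *m gam w = gam w' *m g -> g *m spin_root v w t = spin_root v' w' t *m g.
Proof.
move=> hv hw; rewrite /spin_root mulmxDr mulmxDl mulmx1 mul1mx -scalemxAr -scalemxAl.
by rewrite !mulmxA hv -!mulmxA hw.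
Qed.

(** The cross term vanishes: [gam w] anticommutes with [gam v'] and squares to zero. *)
Lemma spin_root_split v v' w t : null_pair v w -> bf w v' = 0 ->
  spin_root (v + v') w t = spin_root v w t *m spin_root v' w t.
Proof.
move=> [hv hw hvw] h; rewrite /spin_root mulmxDl mul1mx mulmxDr mulmx1 -scalemxAl -scalemxAr.
have -> : gam v *m gam w *m (gam v' *m gam w) = 0.
  rewrite mulmxA -(mulmxA (gam v)) (gamC v' w) bfC h raddf0 sub0r mulmxN mulNmx.
  by rewrite -!mulmxA gam_sq hw raddf0 !mulmx0 oppr0.
by rewrite !scaler0 addr0 gamD mulmxDl scalerDr addrAC addrA.
Qed.

Lemma spin_rootNl v w t : spin_root (- v) w t = spin_root v w (- t).
Proof. by rewrite /spin_root gamN mulNmx scalerN scaleNr. Qed.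

Lemma spin_rootNr v w t : spin_root v (- w) t = spin_root v w (- t).
Proof. by rewrite /spin_root gamN mulmxN scalerN scaleNr. Qed.

Lemma spin_rootC v w t : bf v w = 0 -> spin_root w v t = spin_root v w (- t).
Proof. by move=> h; rewrite /spin_root gamC h raddf0 sub0r scalerN scaleNr. Qed.

Lemma null_ee i j : null_pair (ev i) (ev j).
Proof. by split; rewrite ?qf_ev ?bf_ee. Qed.
Lemma null_ff i j : null_pair (fv i) (fv j).
Proof. by split; rewrite ?qf_fv ?bf_ff. Qed.
Lemma null_ef i j : i != j -> null_pair (ev i) (fv j).
Proof. by move=> /negPf h; split; rewrite ?qf_fv ?qf_ev ?bf_ef ?h. Qed.

(** The root subgroups of the Levi factor GL_4 together with those of alpha_4 and - alpha_4. The
    remaining roots are left to commutators, so that the density argument has only three kinds of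
    generators to treat. *)
Definition spin_root_gens : set 'M[C]_spinor_dim :=
  [set x | (exists i j t, i != j /\ x = spin_root (ev i) (fv j) t) \/
    (exists t, x = spin_root (ev (inord 2)) (ev (inord 3)) t \/
               x = spin_root (fv (inord 2)) (fv (inord 3)) t)].

Let K := smallest (@is_subgroup C spinor_dim) spin_root_gens.

Let K_subgroup : is_subgroup K.
Proof.
apply: smallest_subgroup => x /= [[i [j [t [ij ->]]]]|[t [->|->]]].
- by rewrite (spin_root_inv _ (null_ef ij)).
- by rewrite (spin_root_inv _ (null_ee _ _)).
- by rewrite (spin_root_inv _ (null_ff _ _)).
Qed.

Let KM g h : K g -> K h -> K (g *m h).
Proof. by case: K_subgroup => _ _ + _; apply. Qed.
Let KV g : K g -> K (invmx g).
Proof. by case: K_subgroup => _ _ _; apply. Qed.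
Let KU g : K g -> g \in unitmx.
Proof. by case: K_subgroup => + _ _ _; apply. Qed.

Let K_ef i j t : i != j -> K (spin_root (ev i) (fv j) t).
Proof. by move=> ij; apply: sub_smallest_subgroup; left; exists i, j, t. Qed.

Let o2 : 'I_4 := inord 2.
Let o3 : 'I_4 := inord 3.

Let o23 : o2 != o3.
Proof. by rewrite -(inj_eq val_inj) /= !inordK. Qed.

(** Conjugation by the root element of [ev i] and [fv o2] turns [ev o2] into [ev o2 + ev i], and
    [spin_root_split] then isolates the factor of [ev i] and [ev o3]. *)
Let K_ee i t : i != o3 -> K (spin_root (ev i) (ev o3) t).
Proof.
have K2 s : K (spin_root (ev o2) (ev o3) s).
  by apply: sub_smallest_subgroup; right; exists s; left.
move=> i3; have [->//|i2] := eqVneq i o2.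
have e : spin_root (ev i) (fv o2) 1 *m spin_root (ev o2) (ev o3) t =
    spin_root (ev o2) (ev o3) t *m spin_root (ev i) (ev o3) t *m spin_root (ev i) (fv o2) 1.
  rewrite -spin_root_split ?bf_ee //; last exact: null_ee.
  apply: spin_root_conj; rewrite (spin_root_act _ _ (null_ef i2)) ?bf_ee ?bf_fe ?eqxx ?(negPf o23) ?scale1r ?scale0r
    ?subr0 ?scaler0 ?addr0 //.
have U := KU (K_ef 1 i2).
have -> : spin_root (ev i) (ev o3) t = invmx (spin_root (ev o2) (ev o3) t) *m
   (spin_root (ev i) (fv o2) 1 *m spin_root (ev o2) (ev o3) t *m invmx (spin_root (ev i) (fv o2) 1)).
  by rewrite e mulmxK // mulKmx // KU.
by apply: KM; [exact: KV|apply: KM; [apply: KM => //; exact: K_ef|by apply: KV; apply: K_ef]].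
Qed.

Let K_ff i t : i != o3 -> K (spin_root (fv i) (fv o3) t).
Proof.
have K2 s : K (spin_root (fv o2) (fv o3) s).
  by apply: sub_smallest_subgroup; right; exists s; right.
move=> i3; have [->//|i2] := eqVneq i o2.
rewrite eq_sym in i2.
have e : spin_root (ev o2) (fv i) (-1) *m spin_root (fv o2) (fv o3) t =
    spin_root (fv o2) (fv o3) t *m spin_root (fv i) (fv o3) t *m spin_root (ev o2) (fv i) (-1).
  rewrite -spin_root_split ?bf_ff //; last exact: null_ff.
  apply: spin_root_conj; rewrite (spin_root_act _ _ (null_ef i2)) ?bf_ff ?bf_ef ?eqxx ?(negPf o23) ?scale1r ?scale0r
    ?sub0r ?scaleN1r ?opprK ?oppr0 ?addr0 //.
have U := KU (K_ef (-1) i2).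
have -> : spin_root (fv i) (fv o3) t = invmx (spin_root (fv o2) (fv o3) t) *m
   (spin_root (ev o2) (fv i) (-1) *m spin_root (fv o2) (fv o3) t *m invmx (spin_root (ev o2) (fv i) (-1))).
  by rewrite e mulmxK // mulKmx // KU.
by apply: KM; [exact: KV|apply: KM; [apply: KM => //; exact: K_ef|by apply: KV; apply: K_ef]].
Qed.

Let base := ev o3 + fv o3.

Let qf_base : qf base = 1.
Proof. by rewrite qfD qf_ev qf_fv bf_ef eqxx !add0r. Qed.

Let gam_base_conj v : gam base *m gam v = gam (bf base v *: base - v) *m gam base.
Proof. by rewrite -gam_reflect // -!mulmxA gam_sq qf_base mulmx1. Qed.

Let base_ev i : gam base *m gam (ev i) = gam (if i == o3 then fv o3 else - ev i) *m gam base.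
Proof.
rewrite gam_base_conj bfDl bf_ee bf_fe add0r eq_sym; case: eqP => [->|_].
  by rewrite scale1r addrAC subrr add0r.
by rewrite scale0r sub0r.
Qed.

Let base_fv i : gam base *m gam (fv i) = gam (if i == o3 then ev o3 else - fv i) *m gam base.
Proof.
rewrite gam_base_conj bfDl bf_ff bf_ef addr0 eq_sym; case: eqP => [->|_].
  by rewrite scale1r addrK.
by rewrite scale0r sub0r.
Qed.

(** Conjugation by [gam base] exchanges [ev o3] and [fv o3] and negates the other basis vectors, so
    it carries each generator to a root element already known to lie in [K]. *)
Let base_norm g : K g -> K (gam base *m g *m gam base).
Proof.
have bb : gam base *m gam base = 1%:M by rewrite gam_sq qf_base.
have R v w v' w' t : gam base *m gam v = gam v' *m gam base ->
    gam base *m gam w = gam w' *m gam base -> K (spin_root v' w' t) ->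
    K (gam base *m spin_root v w t *m gam base).
  by move=> hv hw; rewrite (spin_root_conj _ hv hw) -mulmxA bb mulmx1.
pose K' := [set g | K g /\ K (gam base *m g *m gam base)].
move=> Kg; suff [] : K' g by [].
apply: smallest_sub Kg => [|x /=].
  split=> [x [/KU]//||x y [xK x'] [yK y']|x [xK x']] /=.
  - by split; [case: K_subgroup|rewrite mulmx1 bb; case: K_subgroup].
  - split; first exact: KM.
    suff -> : gam base *m (x *m y) *m gam base =
      (gam base *m x *m gam base) *m (gam base *m y *m gam base) by apply: KM.
    by rewrite -!mulmxA (mulmxA (gam base) (gam base)) bb mul1mx.
  - split; first exact: KV.
    have e : (gam base *m x *m gam base) *m (gam base *m invmx x *m gam base) = 1%:M.
      rewrite -!mulmxA (mulmxA (gam base) (gam base)) bb mul1mx.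
      by rewrite (mulmxA x) mulmxV ?KU // mul1mx bb.
    by rewrite -(mulmx_unit_cancel e).2; exact: KV.
case=> [[i [j [t [ij ->]]]]|[t [->|->]]].
- split; first exact: K_ef.
  apply: R (base_ev i) (base_fv j) _.
  have [i3|i3] := eqVneq i o3; have [j3|j3] := eqVneq j o3.
  + by rewrite i3 j3 eqxx in ij.
  + rewrite spin_rootNr spin_rootC ?bf_ff //; exact: K_ff.
  + rewrite spin_rootNl; exact: K_ee.
  + rewrite spin_rootNl spin_rootNr; exact: K_ef.
- split; first exact: K_ee.
  apply: R (base_ev _) (base_ev _) _; rewrite (negPf o23) eqxx spin_rootNl; exact: K_ef.
- split; first exact: K_ff.
  apply: R (base_fv _) (base_fv _) _; rewrite (negPf o23) eqxx spin_rootNl.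
  rewrite spin_rootC; first by apply: K_ef; rewrite eq_sym.
  by rewrite bf_ef eq_sym (negPf o23).
Qed.

Let tr n n' := exists2 g, K g & g *m gam n = gam n' *m g.

Let tr_trans n1 n2 n3 : tr n1 n2 -> tr n2 n3 -> tr n1 n3.
Proof.
move=> [g Kg hg] [h Kh hh]; exists (h *m g); first exact: KM.
by rewrite -mulmxA hg !mulmxA hh.
Qed.

Let tr_ef i j t n : i != j ->
  tr n (n + t *: (bf (fv j) n *: ev i - bf (ev i) n *: fv j)).
Proof.
move=> ij; exists (spin_root (ev i) (fv j) t); first exact: K_ef.
by apply: spin_root_act; exact: null_ef.
Qed.

Let tr_set1 i j n : i != j -> bf n (fv j) != 0 ->
  exists2 n', tr n n' & bf n' (fv i) = 1.
Proof.
move=> ij h; exists (n + ((1 - bf n (fv i)) / bf n (fv j)) *: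
  (bf (fv j) n *: ev i - bf (ev i) n *: fv j)); first exact: tr_ef.
rewrite bfDl bfZl bfDl bfNl !bfZl bf_ef bf_ff eqxx mulr1 mulr0 subr0.
by rewrite (bfC (fv j)) divfK // addrC subrK.
Qed.

(** Gaussian elimination: make the coordinate along [ev o3] equal to 1, use it to clear the other
    coordinates along the [ev], then those along the [fv]. The condition q = 1 forces the last
    remaining coordinate to be 1. *)
Let tr_base n : qf n = 1 -> tr n base.
Proof.
have qf_tr n1 n2 : tr n1 n2 -> qf n2 = qf n1.
  move=> [g /KU gU hg]; apply: (mulfI (_ : 2%:R != 0 :> C)); first by rewrite pnatr_eq0.
  rewrite -!bfvv.
  have : g *m (gam n1 *m gam n1) = gam n2 *m gam n2 *m g.
    by rewrite !mulmxA hg -!mulmxA hg.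
  rewrite !gam_sq scalar_mxC => /(can_inj (mulmxK gU)) e; rewrite !bfvv.
  have a : 'I_spinor_dim by exact: (enum_rank (finset.set0 : {set 'I_4})).
  by move/matrixP: e => /(_ a a); rewrite !mxE eqxx !mulr1n => ->.
move=> hn.
have [n1 n_n1 h1] : exists2 n1, tr n n1 & bf n1 (fv o3) = 1.
  have [h|h] := boolP [exists j, (j != o3) && (bf n (fv j) != 0)].
    by case/existsP: h => j /andP[j3 hj]; apply: tr_set1 hj; rewrite eq_sym.
  have h3 : bf n (fv o3) != 0.
    apply/eqP => h3; suff : qf n = 0 by rewrite hn => /eqP; rewrite oner_eq0.
    apply: big1 => j _; rewrite -bf_fv.
    have [->|j3] := eqVneq j o3; first by rewrite h3 mul0r.
    move: h; rewrite negb_exists => /forallP /(_ j); rewrite j3 /= negbK => /eqP ->.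
    by rewrite mul0r.
  (* Only the coordinate along [ev o3] is nonzero, and it cannot rescale itself: produce a 1 along
     [ev o2], then use that to produce one along [ev o3]. *)
  have [n1 t1 h1] := tr_set1 o23 h3.
  have [n2 t2 h2] : exists2 n2, tr n1 n2 & bf n2 (fv o3) = 1.
    by apply: (@tr_set1 o3 o2); rewrite ?h1 ?oner_eq0 // eq_sym.
  by exists n2 => //; apply: tr_trans t1 t2.
(* One elimination pass: the coordinates outside [o3] are cleared one at a time while the invariant
   [P] is kept. *)
have kill (P : 'rV[C]_(4 + 4) -> Prop) (f : 'I_4 -> 'rV[C]_(4 + 4)) :
    (forall i n, i != o3 -> P n ->
      exists n', [/\ tr n n', P n', bf n' (f i) = 0 &
       forall k, k != i -> bf n (f k) = 0 -> bf n' (f k) = 0]) ->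
  forall n, P n -> exists n', [/\ tr n n', P n' & forall i, i != o3 -> bf n' (f i) = 0].
  move=> H m Pm; pose s := [:: inord 0; inord 1; inord 2] : seq 'I_4.
  have : exists n', [/\ tr m n', P n' & forall i, i \in s -> bf n' (f i) = 0].
    have : all (fun i => i != o3) s.
      by rewrite /s /= -!(inj_eq val_inj) /= !inordK.
    elim: s => [_|i s IH /= /andP[i3 /IH [n' [t' P' z']]]].
      by exists m; split=> //; exists 1%:M; [case: K_subgroup|rewrite mul1mx mulmx1].
    have [n'' [t'' P'' z'' k'']] := H i n' i3 P'.
    exists n''; split=> //; first exact: tr_trans t' t''.
    move=> k; rewrite inE; have [->//|ki /=] := eqVneq k i.
    by move=> /z'; exact: k''.
  move=> [n' [t' P' z']]; exists n'; split=> // i i3; apply: z'.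
  rewrite !inE -!(inj_eq val_inj) /= !inordK //.
  by case: i i3 => [[|[|[|[|//]]]] hi]; rewrite -(inj_eq val_inj) /= inordK.
have [n2 [t2 h2 z2]] : exists n', [/\ tr n1 n', bf n' (fv o3) = 1 &
    forall i, i != o3 -> bf n' (fv i) = 0].
  apply: (kill (fun n => bf n (fv o3) = 1)) => // i m i3 hm.
  exists (m + (- bf m (fv i)) *: (bf (fv o3) m *: ev i - bf (ev i) m *: fv o3)).
  split; first exact: tr_ef.
  - by rewrite bfDl bfZl bfDl bfNl !bfZl bf_ef bf_ff (negPf i3) !mulr0 subrr mulr0 addr0.
  - rewrite bfDl bfZl bfDl bfNl !bfZl bf_ef bf_ff eqxx (bfC (fv o3)) hm.
    by rewrite !mulr1 mulr0 subr0 mulr1 subrr.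
  - move=> k ki hk; rewrite bfDl bfZl bfDl bfNl !bfZl bf_ef bf_ff hk.
    by rewrite eq_sym (negPf ki) !mulr0 subrr mulr0 addr0.
have [n3 [t3 [h3 z3] w3]] : exists n', [/\ tr n2 n',
    bf n' (fv o3) = 1 /\ (forall i, i != o3 -> bf n' (fv i) = 0) &
    forall i, i != o3 -> bf n' (ev i) = 0].
  apply: (kill (fun n => bf n (fv o3) = 1 /\ forall i, i != o3 -> bf n (fv i) = 0)) => //.
  move=> i m i3 [hm zm].
  exists (m + (- bf m (ev i)) *: (bf (fv o3) m *: fv i - bf (fv i) m *: fv o3)).
  split.
  - exists (spin_root (fv i) (fv o3) (- bf m (ev i))); first exact: K_ff.
    by apply: spin_root_act; exact: null_ff.
  - by split=> [|k k3]; rewrite bfDl bfZl bfDl bfNl !bfZl !bf_ff !mulr0 subrr mulr0 addr0 //; exact: zm.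
  - rewrite bfDl bfZl bfDl bfNl !bfZl !bf_fe eqxx (bfC (fv o3)) hm (bfC (fv i)) zm //.
    by rewrite !mulr1 mul0r subr0 mulr1 subrr.
  - move=> k ki hk; rewrite bfDl bfZl bfDl bfNl !bfZl !bf_fe hk (bfC (fv i)) zm //.
    by rewrite eq_sym (negPf ki) mul0r !mulr0 subrr mulr0 addr0.
have q3 : qf n3 = 1 by rewrite (qf_tr _ _ t3) (qf_tr _ _ t2) (qf_tr _ _ n_n1).
suff -> : base = n3 by apply: tr_trans t3; apply: tr_trans t2.
have e3 : bf n3 (ev o3) = 1.
  rewrite -q3 /qf /quad (bigD1 o3) //= big1 => [|i i3]; rewrite -bf_fv -bf_ev.
    by rewrite h3 mul1r addr0.
  by rewrite z3 // mul0r.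
apply/eqP; rewrite eq_sym -subr_eq0; apply/eqP/gam_inj; rewrite gamE big1 // => i _.
rewrite !bfDl !bfNl !bfDl bf_ee bf_ef bf_fe bf_ff eq_sym addr0 add0r.
have [->|i3] := eqVneq i o3; first by rewrite h3 e3 subrr !scale0r addr0.
by rewrite z3 // w3 // subrr !scale0r addr0.
Qed.

(** If [g] in [K] carries [n] to [base], then [gam n *m gam base] is [invmx g] times the conjugate
    of [g] by [gam base], which is in [K] because [gam base] normalizes [K]. A product of two unit
    vectors is a quotient of two such elements. *)
Lemma Spin_generated :
  Spin8 C `<=` smallest (@is_subgroup C spinor_dim) spin_root_gens.
Proof.
have bb : gam base *m gam base = 1%:M by rewrite gam_sq qf_base.
have H n : qf n = 1 -> K (gam n *m gam base).
  move=> /tr_base [g Kg hg].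
  have -> : gam n *m gam base = invmx g *m (gam base *m g *m gam base).
    by rewrite -hg -!mulmxA mulKmx // KU.
  by apply: KM; [exact: KV|exact: base_norm].
apply: Spin_ind => [|n m hn hm]; first exact: K_subgroup.
have -> : gam n *m gam m = (gam n *m gam base) *m invmx (gam m *m gam base).
  have e : (gam m *m gam base) *m (gam base *m gam m) = 1%:M.
    by rewrite mulmxA -(mulmxA (gam m)) bb mulmx1 gam_sq hm.
  rewrite (mulmx_unit_cancel e).2.
  by rewrite mulmxA -(mulmxA (gam n)) bb mulmx1.
by apply: KM; [exact: H|by apply: KV; apply: H].
Qed.

End Generation.

(** * Simple coroots *)

Section Coroots.
Variable C : fieldType.
Implicit Types (k : 'I_4) (z t : C) (v : 'cV[C]_spinor_dim).

Lemma inord4 k : (k < 4)%N -> exists h, @inord 3 k = @Ordinal 4 k h :> 'I_4.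
Proof. by move=> h; exists h; apply: val_inj; rewrite /= inordK. Qed.

Lemma coord_simple_root k v b0 b1 b2 b3 :
  spin_coord (simple_root_vec C k *m v) b0 b1 b2 b3 =
  match val k with
  | 0%N => if b0 && ~~ b1 then spin_coord v false true b2 b3 else 0
  | 1%N => if b1 && ~~ b2 then spin_coord v b0 false true b3 else 0
  | 2%N => if b2 && ~~ b3 then spin_coord v b0 b1 false true else 0
  | _ => if b2 && b3 then spin_coord v b0 b1 false false else 0
  end.
Proof.
rewrite /simple_root_vec; case: k => [[|[|[|[|//]]]] hk] /=.
- by have [h ->] := @inord4 1 isT; rewrite -mulmxA !spin_coordE /=; case: b0; case: b1; rewrite /= /sgn ?mul1r.
- by have [h ->] := @inord4 2 isT; rewrite -mulmxA !spin_coordE /=; case: b0; case: b1; case: b2; rewrite /= /sgn; ring.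
- by have [h ->] := @inord4 3 isT; rewrite -mulmxA !spin_coordE /=; case: b0; case: b1; case: b2; case: b3; rewrite /= /sgn; ring.
- have [h ->] := @inord4 2 isT; have [h' ->] := @inord4 3 isT.
  by rewrite -mulmxA !spin_coordE /=; case: b0; case: b1; case: b2; case: b3; rewrite /= /sgn; ring.
Qed.

Lemma coord_neg_simple_root k v b0 b1 b2 b3 :
  spin_coord (neg_simple_root_vec C k *m v) b0 b1 b2 b3 =
  match val k with
  | 0%N => if ~~ b0 && b1 then spin_coord v true false b2 b3 else 0
  | 1%N => if ~~ b1 && b2 then spin_coord v b0 true false b3 else 0
  | 2%N => if ~~ b2 && b3 then spin_coord v b0 b1 true false else 0
  | _ => if ~~ b2 && ~~ b3 then spin_coord v b0 b1 true true else 0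
  end.
Proof.
rewrite /neg_simple_root_vec; case: k => [[|[|[|[|//]]]] hk] /=.
- by have [h ->] := @inord4 1 isT; rewrite -mulmxA !spin_coordE /=; case: b0; case: b1; rewrite /= /sgn; ring.
- by have [h ->] := @inord4 2 isT; rewrite -mulmxA !spin_coordE /=; case: b0; case: b1; case: b2; rewrite /= /sgn; ring.
- by have [h ->] := @inord4 3 isT; rewrite -mulmxA !spin_coordE /=; case: b0; case: b1; case: b2; case: b3; rewrite /= /sgn; ring.
- have [h ->] := @inord4 2 isT; have [h' ->] := @inord4 3 isT.
  by rewrite -mulmxA !spin_coordE /=; case: b0; case: b1; case: b2; case: b3; rewrite /= /sgn; ring.
Qed.

Lemma coord_root_elt E t v b0 b1 b2 b3 :
  spin_coord (root_elt E t *m v) b0 b1 b2 b3 =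
  spin_coord v b0 b1 b2 b3 + t * spin_coord (E *m v) b0 b1 b2 b3.
Proof. by rewrite /root_elt mulmxDl mul1mx -scalemxAl spin_coordD spin_coordZ. Qed.

(** [z] to the pairing of the coroot with the weight of the basis spinor. Half-spin weights are
    minuscule, so the pairing is -1, 0 or 1. For the last coroot, that of eps_2 + eps_3, the sign of
    eps_3 is reversed, hence the negated [b3]. *)
Definition coroot_weight k (b0 b1 b2 b3 : bool) z : C :=
  let w (b b' : bool) := if b then (if b' then 1 else z) else (if b' then z^-1 else 1) in
  match val k with
  | 0%N => w b0 b1 | 1%N => w b1 b2 | 2%N => w b2 b3 | _ => w b2 (~~ b3)
  end.

Lemma coord_weyl_elt k z v b0 b1 b2 b3 : z != 0 ->
  spin_coord (weyl_elt k z *m v) b0 b1 b2 b3 =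
  let w (b b' : bool) x y :=
    if b then (if b' then spin_coord v b0 b1 b2 b3 else z * x)
    else (if b' then - z^-1 * y else spin_coord v b0 b1 b2 b3) in
  match val k with
  | 0%N => w b0 b1 (spin_coord v false true b2 b3) (spin_coord v true false b2 b3)
  | 1%N => w b1 b2 (spin_coord v b0 false true b3) (spin_coord v b0 true false b3)
  | 2%N => w b2 b3 (spin_coord v b0 b1 false true) (spin_coord v b0 b1 true false)
  | _ => w b2 (~~ b3) (spin_coord v b0 b1 false false) (spin_coord v b0 b1 true true)
  end.
Proof.
move=> z0; rewrite /weyl_elt -!mulmxA; case: k => [[|[|[|[|//]]]] hk] /=;
  [case: b0; case: b1|case: b1; case: b2|case: b2; case: b3|case: b2; case: b3];
  do !(rewrite ?coord_root_elt ?coord_simple_root ?coord_neg_simple_root /=);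
  by field.
Qed.

Lemma coord_simple_coroot k z v b0 b1 b2 b3 : z != 0 ->
  spin_coord (simple_coroot k z *m v) b0 b1 b2 b3 =
  coroot_weight k b0 b1 b2 b3 z * spin_coord v b0 b1 b2 b3.
Proof.
move=> z0; have n0 : (-1 : C) != 0 by rewrite oppr_eq0 oner_eq0.
rewrite /simple_coroot /coroot_weight -mulmxA coord_weyl_elt //.
case: k => [[|[|[|[|//]]]] hk] /=;
  [case: b0; case: b1|case: b1; case: b2|case: b2; case: b3|case: b2; case: b3];
  rewrite !coord_weyl_elt //= ?invrN1; ring.
Qed.

End Coroots.

(** * The standard parabolic subgroup *)

Section Parabolic.
Variable C : numClosedFieldType.
Implicit Types (i j k : 'I_4) (u v w n m : 'rV[C]_(4 + 4)) (t : C).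
Implicit Types (g h : 'M[C]_spinor_dim).
Notation gam := (@gam C).
Notation ev := (ev C).
Notation fv := (fv C).
Notation Spin := (Spin8 C).
Notation P0 := (std_parabolic4 C).

Lemma exists_other i j : exists k, (k != i) && (k != j).
Proof.
have : (0 < #|~: [set i; j]%SET|)%N.
  by rewrite cardsCs finset.setCK card_ord subn_gt0 cards2; case: (i != j).
by rewrite card_gt0 => /set0Pn [k]; rewrite !inE negb_or; exists k.
Qed.

Lemma root_elt_we i j t : root_elt (wedge C i *m wedge C j) t = spin_root (ev i) (ev j) t.
Proof. by rewrite /spin_root !gam_ev. Qed.
Lemma root_elt_wc i j t : root_elt (wedge C i *m contract C j) t = spin_root (ev i) (fv j) t.
Proof. by rewrite /spin_root gam_ev gam_fv. Qed.
Lemma root_elt_cc i j t : root_elt (contract C i *m contract C j) t = spin_root (fv i) (fv j) t.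
Proof. by rewrite /spin_root !gam_fv. Qed.

Lemma qf_hyp k : qf (ev k + fv k) = 1.
Proof. by rewrite qfD qf_ev qf_fv bf_ef eqxx !add0r. Qed.

Lemma Spin_ee i j t : Spin (spin_root (ev i) (ev j) t).
Proof.
have [k /andP[ki kj]] := exists_other i j.
apply: (spin_root_Spin t (null_ee C i j) (qf_hyp k));
by rewrite bfDl bf_ee bf_fe ?(negPf ki) ?(negPf kj) addr0.
Qed.

Lemma Spin_ff i j t : Spin (spin_root (fv i) (fv j) t).
Proof.
have [k /andP[ki kj]] := exists_other i j.
apply: (spin_root_Spin t (null_ff C i j) (qf_hyp k));
by rewrite bfDl bf_ff bf_ef ?(negPf ki) ?(negPf kj) addr0.
Qed.

Lemma Spin_ef i j t : i != j -> Spin (spin_root (ev i) (fv j) t).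
Proof.
move=> ij; have [k /andP[ki kj]] := exists_other i j.
apply: (spin_root_Spin t (null_ef C ij) (qf_hyp k)).
- by rewrite bfDl bf_ee bf_fe (negPf ki) addr0.
- by rewrite bfDl bf_ff bf_ef (negPf kj) addr0.
Qed.

Lemma inord_neq (a b : nat) : (a < 4)%N -> (b < 4)%N -> a != b ->
  (inord a : 'I_4) != inord b.
Proof. by move=> ha hb; rewrite -(inj_eq val_inj) /= !inordK. Qed.

Lemma succ_neq k : (k < 3)%N -> k != inord k.+1 :> 'I_4.
Proof. by move=> k3; rewrite -(inj_eq val_inj) /= inordK // neq_ltn leqnn. Qed.

Lemma simple_root_Spin k t :
  Spin (root_elt (simple_root_vec C k) t) /\ Spin (root_elt (neg_simple_root_vec C k) t).
Proof.
rewrite /simple_root_vec /neg_simple_root_vec; case: ifP => k3.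
  by rewrite !root_elt_wc; split; apply: Spin_ef; rewrite 1?eq_sym ?succ_neq // eq_sym succ_neq.
by rewrite root_elt_we root_elt_cc; split; [exact: Spin_ee|exact: Spin_ff].
Qed.

Lemma simple_coroot_Spin k t : Spin (simple_coroot k t).
Proof.
by do !apply: SpinM; by [case: (simple_root_Spin k t)|case: (simple_root_Spin k (- t^-1))
  |case: (simple_root_Spin k (-1))|case: (simple_root_Spin k (- (-1)^-1))].
Qed.

Lemma parabolic_gens_Spin :
  torus_gens C `|` positive_root_gens C `|`
     [set x | exists (k : 'I_4) (t : C),
       (k < 3)%N /\ x = root_elt (neg_simple_root_vec C k) t] `<=` Spin.
Proof.
move=> x [[[k [z [z0 ->]]]|[i [j [t [ij [->|->]]]]]]|[k [t [k3 ->]]]].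
- exact: simple_coroot_Spin.
- by rewrite root_elt_wc; apply: Spin_ef; rewrite -(inj_eq val_inj) neq_ltn ij.
- by rewrite root_elt_we; apply: Spin_ee.
- by case: (simple_root_Spin k t).
Qed.

Lemma P0_Spin : P0 `<=` Spin.
Proof. by apply: smallest_sub; [exact: Spin_subgroup|exact: parabolic_gens_Spin]. Qed.

Lemma P0_subgroup : is_subgroup P0.
Proof.
by apply: smallest_subgroup => x /parabolic_gens_Spin /Spin_unit.
Qed.

Lemma P0M g h : P0 g -> P0 h -> P0 (g *m h).
Proof. by case: P0_subgroup => _ _ + _; apply. Qed.
Lemma P0V g : P0 g -> P0 (invmx g).
Proof. by case: P0_subgroup => _ _ _; apply. Qed.
Lemma P01 : P0 1%:M. Proof. by case: P0_subgroup. Qed.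

Lemma P0_coroot k z : z != 0 -> P0 (simple_coroot k z).
Proof. by move=> z0; apply: sub_smallest_subgroup; left; left; exists k, z. Qed.

Lemma P0_ee i j t : i != j -> P0 (spin_root (ev i) (ev j) t).
Proof.
have H i' j' t' : (i' < j')%N -> P0 (spin_root (ev i') (ev j') t').
  move=> ij; rewrite -root_elt_we; apply: sub_smallest_subgroup; left; right.
  by exists i', j', t'; split=> //; right.
rewrite -(inj_eq val_inj) neq_ltn => /orP[|] ij; first exact: H.
by rewrite spin_rootC ?bf_ee //; apply: H.
Qed.

(* The commutator of the root subgroups of [eps_i - eps_k] and [eps_k - eps_j]
   is the one of [eps_i - eps_j]. *)
Lemma P0_ef_trans i j k : i != k -> k != j -> i != j ->
  (forall t, P0 (spin_root (ev i) (fv k) t)) -> (forall t, P0 (spin_root (ev k) (fv j) t)) ->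
  forall t, P0 (spin_root (ev i) (fv j) t).
Proof.
move=> ik kj ij Pik Pkj t.
have e : spin_root (ev i) (fv k) 1 *m spin_root (ev k) (fv j) t =
    spin_root (ev k) (fv j) t *m spin_root (ev i) (fv j) t *m spin_root (ev i) (fv k) 1.
  rewrite -spin_root_split; last by rewrite bf_fe eq_sym (negPf ij).
    apply: spin_root_conj; rewrite (spin_root_act _ _ (null_ef C ik)) ?bf_ee ?bf_fe ?bf_ff ?bf_ef
      ?eqxx ?(negPf ij) ?(negPf kj) ?scale1r ?scale0r ?subr0 ?scaler0 ?addr0 //.
  exact: null_ef.
have U g : P0 g -> g \in unitmx by move=> /P0_Spin /Spin_unit.
have -> : spin_root (ev i) (fv j) t = invmx (spin_root (ev k) (fv j) t) *m
   (spin_root (ev i) (fv k) 1 *m spin_root (ev k) (fv j) t *m invmx (spin_root (ev i) (fv k) 1)).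
  by rewrite e mulmxK ?mulKmx // U.
by apply: P0M; [exact: P0V|apply: P0M; [apply: P0M|exact: P0V]].
Qed.

Lemma P0_ef i j t : i != j -> P0 (spin_root (ev i) (fv j) t).
Proof.
have pos i' j' t' : (i' < j')%N -> P0 (spin_root (ev i') (fv j') t').
  move=> ij; rewrite -root_elt_wc; apply: sub_smallest_subgroup; left; right.
  by exists i', j', t'; split=> //; left.
have neg (k : nat) t' : (k < 3)%N -> P0 (spin_root (ev (inord k.+1)) (fv (inord k)) t').
  move=> k3; have hk : (inord k : 'I_4) = k :> nat by rewrite inordK // ltnS ltnW.
  apply: sub_smallest_subgroup; right; exists (inord k), t'; rewrite hk; split=> //.
  by rewrite /neg_simple_root_vec hk k3 root_elt_wc.
have i4 k : k = inord k :> 'I_4 by rewrite inord_val.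
have neg20 t' : P0 (spin_root (ev (inord 2)) (fv (inord 0)) t').
  by apply: (@P0_ef_trans _ _ (inord 1)); [exact: inord_neq|exact: inord_neq|exact: inord_neq|move=> s; exact (neg 1%N s isT)|move=> s; exact (neg 0%N s isT)].
have neg31 t' : P0 (spin_root (ev (inord 3)) (fv (inord 1)) t').
  by apply: (@P0_ef_trans _ _ (inord 2)); [exact: inord_neq|exact: inord_neq|exact: inord_neq|move=> s; exact (neg 2%N s isT)|move=> s; exact (neg 1%N s isT)].
have neg30 t' : P0 (spin_root (ev (inord 3)) (fv (inord 0)) t').
  by apply: (@P0_ef_trans _ _ (inord 1)); [exact: inord_neq|exact: inord_neq|exact: inord_neq|move=> s; exact (neg31 s)|move=> s; exact (neg 0%N s isT)].
rewrite -(inj_eq val_inj) neq_ltn => /orP[|] ij; first exact: pos.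
have low a b s : (a < 4)%N -> (b < a)%N -> P0 (spin_root (ev (inord a)) (fv (inord b)) s).
  case: a => [|[|[|[|//]]]]; case: b => [|[|[|//]]] // _ _.
  - exact (neg 0%N s isT).
  - exact (neg 1%N s isT).
  - exact (neg 2%N s isT).
by rewrite (i4 i) (i4 j); apply: low.
Qed.

(** The highest weight spinor, of weight omega_4; the standard parabolic subgroup preserves its
    line. *)
Definition vac : 'cV[C]_spinor_dim := delta_mx (enum_rank (bitset true true true true)) ord0.

Lemma bitset_inj b0 b1 b2 b3 c0 c1 c2 c3 :
  bitset b0 b1 b2 b3 = bitset c0 c1 c2 c3 -> [/\ b0 = c0, b1 = c1, b2 = c2 & b3 = c3].
Proof.
move/setP => h.
by split; [have := h (@Ordinal 4 0 isT)|have := h (@Ordinal 4 1 isT)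
  |have := h (@Ordinal 4 2 isT)|have := h (@Ordinal 4 3 isT)]; rewrite !inE.
Qed.

Lemma coord_vac b0 b1 b2 b3 : spin_coord vac b0 b1 b2 b3 = [&& b0, b1, b2 & b3]%:R.
Proof.
rewrite /spin_coord /vac mxE eqxx andbT (inj_eq enum_rank_inj); congr (_%:R); congr nat_of_bool.
apply/eqP/and4P => [/bitset_inj [-> -> -> ->]//|[-> -> -> ->]//].
Qed.

(** A matrix coefficient of the spinor module; on the standard parabolic subgroup it is the
    character omega_4. *)
Definition chi g : C := spin_coord (g *m vac) true true true true.

Lemma vac_fix E t : E *m vac = 0 -> root_elt E t *m vac = vac.
Proof. by move=> h; rewrite /root_elt mulmxDl mul1mx -scalemxAl h scaler0 addr0. Qed.

Lemma wedge_vac i : wedge C i *m vac = 0.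
Proof.
apply: coord_inj => b0 b1 b2 b3; rewrite !spin_coordE !coord_vac.
by case: i => [[|[|[|[|//]]]] hi] /=; rewrite ?andbF /= ?mulr0 ?if_same.
Qed.

Lemma wc_vac i j : i != j -> wedge C i *m contract C j *m vac = 0.
Proof.
move=> ij; have := wedge_contract C i j; rewrite (negPf ij) raddf0 => /eqP.
by rewrite addr_eq0 => /eqP ->; rewrite mulNmx -mulmxA wedge_vac mulmx0 oppr0.
Qed.

Lemma chi1 : chi 1%:M = 1.
Proof. by rewrite /chi mul1mx coord_vac. Qed.

Lemma chi_fix g : g *m vac = vac -> chi g = 1.
Proof. by move=> h; rewrite /chi h coord_vac. Qed.

Lemma chi_coroot k z : z != 0 -> simple_coroot k z *m vac = (if k == ord_max then z else 1) *: vac.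
Proof.
move=> z0; apply: coord_inj => b0 b1 b2 b3; rewrite spin_coordZ coord_simple_coroot // coord_vac.
case: k => [[|[|[|[|//]]]] hk]; rewrite -(inj_eq val_inj) /= /coroot_weight /=;
by case: b0; case: b1; case: b2; case: b3; rewrite /= ?mulr0.
Qed.

Lemma P0_gen_vac x :
  (torus_gens C `|` positive_root_gens C `|`
     [set x | exists (k : 'I_4) (t : C),
       (k < 3)%N /\ x = root_elt (neg_simple_root_vec C k) t]) x ->
  x *m vac = chi x *: vac.
Proof.
case=> [[[k [z [z0 ->]]]|[i [j [t [ij [->|->]]]]]]|[k [t [k3 ->]]]].
- by rewrite /chi chi_coroot // spin_coordZ coord_vac mulr1.
- have ne : i != j by rewrite -(inj_eq val_inj) neq_ltn ij.
  by rewrite chi_fix vac_fix ?scale1r ?wc_vac.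
- by rewrite chi_fix vac_fix ?scale1r // -mulmxA wedge_vac mulmx0.
- rewrite /neg_simple_root_vec k3; have ne := succ_neq k3; rewrite eq_sym in ne.
  by rewrite chi_fix vac_fix ?scale1r ?wc_vac.
Qed.

Lemma P0_vac g : P0 g -> g *m vac = chi g *: vac.
Proof.
pose K := [set g | P0 g /\ g *m vac = chi g *: vac].
move=> Pg; suff [] : K g by [].
have chiE a x : x *m vac = a *: vac -> x *m vac = chi x *: vac.
  by move=> h; rewrite /chi h spin_coordZ coord_vac mulr1.
apply: smallest_sub Pg => [|x Gx]; last first.
  by split; [exact: sub_smallest_subgroup|exact: P0_gen_vac].
split=> [x [/P0_Spin /Spin_unit]//||x y [xP xv] [yP yv]|x [xP xv]] /=.
- by split; [exact: P01|rewrite mul1mx chi1 scale1r].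
- split; first exact: P0M.
  by apply: (chiE (chi y * chi x)); rewrite -mulmxA yv -scalemxAr xv scalerA.
- split; first exact: P0V.
  have xU : x \in unitmx by exact: Spin_unit (P0_Spin xP).
  have c0 : chi x != 0.
    apply/eqP => c0; move: xv; rewrite c0 scale0r => xv.
    have : vac = 0 by rewrite -(mulKmx xU vac) xv mulmx0.
    move/(congr1 (fun s : 'cV[C]_spinor_dim => spin_coord s true true true true)).
    by rewrite coord_vac spin_coord0 => /eqP; rewrite oner_eq0.
  apply: (chiE (chi x)^-1); apply: (can_inj (mulKmx xU)).
  by rewrite mulKVmx // -scalemxAr xv scalerA mulVf // scale1r.
Qed.

Lemma chiM g h : P0 h -> chi (g *m h) = chi g * chi h.
Proof.
by move=> /P0_vac hv; rewrite {1}/chi -mulmxA hv -scalemxAr spin_coordZ mulrC.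
Qed.

End Parabolic.

(** * Density of the big cell *)

Section BigCell.
Variable C : numClosedFieldType.
Implicit Types (i j : 'I_4) (k : 'I_6) (s t : C) (a : 'I_6 -> C).
Implicit Types (g h x p : 'M[C]_spinor_dim).
Notation gam := (@gam C).
Notation ev := (ev C).
Notation fv := (fv C).
Notation P0 := (std_parabolic4 C).

(** The roots - eps_i - eps_j of the opposite unipotent radical. The pair (2, 3), for - alpha_4,
    comes last so that its factor in [uelt] stands next to the parabolic factor in
    [root4_big_cell]. *)
Definition upair k : 'I_4 * 'I_4 :=
  nth (ord0, ord0) [:: (inord 0, inord 1); (inord 0, inord 2); (inord 1, inord 3);
    (inord 0, inord 3); (inord 1, inord 2); (inord 2, inord 3)] k.

Definition uroot k t := spin_root (fv (upair k).1) (fv (upair k).2) t.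

Definition uelt a := \big[mulmx/1%:M]_(k < 6) uroot k (a k).

Lemma spin_root0 v w : spin_root v w (0 : C) = 1%:M.
Proof. by rewrite /spin_root scale0r addr0. Qed.

Lemma uroot_comm k k' s t : uroot k s *m uroot k' t = uroot k' t *m uroot k s.
Proof.
by apply: spin_root_conj; rewrite (spin_root_act _ _ (null_ff C _ _)) !bf_ff
  !scale0r subrr scaler0 addr0.
Qed.

Lemma uelt_mul a b : uelt a *m uelt b = uelt (fun k => a k + b k).
Proof.
rewrite /uelt; elim: (index_enum _) => [|k r IH]; first by rewrite !big_nil mulmx1.
have e : uroot k (a k + b k) = uroot k (a k) *m uroot k (b k).
  by rewrite /uroot spin_root_add //; exact: null_ff.
rewrite !big_cons -IH e -!mulmxA; congr (_ *m _).
rewrite !mulmxA; congr (_ *m _).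
elim: r {IH} => [|l r IH]; first by rewrite !big_nil mul1mx mulmx1.
by rewrite !big_cons -mulmxA IH !mulmxA uroot_comm.
Qed.

Definition ugroup : set 'M[C]_spinor_dim := [set x | exists a, x = uelt a].

Lemma ugroupM x y : ugroup x -> ugroup y -> ugroup (x *m y).
Proof. by move=> [a ->] [b ->]; rewrite uelt_mul; exists (fun k => a k + b k). Qed.

Lemma ugroup1 : ugroup 1%:M.
Proof.
exists (fun=> 0); rewrite /uelt; apply/esym.
by elim/big_rec: _ => // k x _ ->; rewrite mulmx1 /uroot spin_root0.
Qed.

Lemma ugroup_uroot k t : ugroup (uroot k t).
Proof.
exists (fun l => if l == k then t else 0); rewrite /uelt.
have : k \in index_enum 'I_6 by rewrite mem_index_enum.
have : uniq (index_enum 'I_6) by rewrite index_enum_uniq.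
elim: (index_enum _) => // l r IH /= /andP[lr ur]; rewrite inE big_cons.
have [kl|kl /= kr] := eqVneq k l.
  move: lr; rewrite -kl => lr _; suff -> : \big[mulmx/1%:M]_(j <- r) uroot j (if j == k then t else 0) = 1%:M.
    by rewrite mulmx1.
  rewrite big_seq; elim/big_rec: _ => // l' x lr' ->; rewrite mulmx1.
  by case: eqP lr' lr => [->->//|_ _ _]; rewrite /uroot spin_root0.
by rewrite -IH // /uroot spin_root0 mul1mx.
Qed.

Lemma ugroup_ff i j t : ugroup (spin_root (fv i) (fv j) t).
Proof.
have H (n m : nat) s : (n < m)%N -> (m < 4)%N -> ugroup (spin_root (fv (inord n)) (fv (inord m)) s).
  case: m => [|[|[|[|//]]]]; case: n => [|[|[|//]]] // _ _.
  - exact: (ugroup_uroot (@Ordinal 6 0 isT)).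
  - exact: (ugroup_uroot (@Ordinal 6 1 isT)).
  - exact: (ugroup_uroot (@Ordinal 6 4 isT)).
  - exact: (ugroup_uroot (@Ordinal 6 3 isT)).
  - exact: (ugroup_uroot (@Ordinal 6 2 isT)).
  - exact: (ugroup_uroot (@Ordinal 6 5 isT)).
have [->|] := eqVneq i j.
  by rewrite /spin_root gam_sq qf_fv raddf0 scaler0 addr0; exact: ugroup1.
rewrite -(inj_eq val_inj) neq_ltn => /orP[|] ij.
  by have := H i j t ij (ltn_ord j); rewrite !inord_val.
by rewrite spin_rootC ?bf_ff //; have := H j i (- t) ij (ltn_ord i); rewrite !inord_val.
Qed.

(** The Levi factor normalizes U: its root elements preserve the span of the [fv], on which
    [spin_root] is additive in each argument. *)
Lemma ugroup_levi i j t x : i != j -> ugroup x -> exists2 y, ugroup y &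
  spin_root (ev i) (fv j) t *m x = y *m spin_root (ev i) (fv j) t.
Proof.
move=> ij [a ->]; rewrite /uelt; elim/big_rec: _ => [|k y _ [z zu hz]].
  by exists 1%:M; [exact: ugroup1|rewrite mul1mx mulmx1].
suff [w wu hw] : exists2 w, ugroup w &
    spin_root (ev i) (fv j) t *m uroot k (a k) = w *m spin_root (ev i) (fv j) t.
  by exists (w *m z); [exact: ugroupM|rewrite mulmxA hw -!mulmxA hz].
have act l : spin_root (ev i) (fv j) t *m gam (fv l) =
    gam (fv l + (- (t * (i == l)%:R)) *: fv j) *m spin_root (ev i) (fv j) t.
  by rewrite (spin_root_act _ _ (null_ef C ij)) bf_ff bf_ef scale0r sub0r scalerN scalerA scaleNr.
exists (spin_root (fv (upair k).1 + (- (t * (i == (upair k).1)%:R)) *: fv j)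
  (fv (upair k).2 + (- (t * (i == (upair k).2)%:R)) *: fv j) (a k)); last exact: spin_root_conj.
have sc c v w s : spin_root (c *: v) w s = spin_root v w (s * c) :> 'M[C]_spinor_dim.
  by rewrite /spin_root gamZ -scalemxAl scalerA.
have N c l m : null_pair (fv l + c *: fv j) (fv m).
  by case: (null_ff C l m) => h1 h2 h3; split; rewrite ?qfD ?qfZ ?qf_fv ?bfDl ?bfDr ?bfZl ?bfZr ?bf_ff ?mulr0 ?addr0.
rewrite spin_rootC; last by rewrite !bfDl !bfDr !bfZl !bfZr !bf_ff !mulr0 !addr0.
set c1 := - _; set c2 := - (t * _).
have N' l m c : null_pair (fv l) (fv m + c *: fv j).
  by split; rewrite ?qfD ?qfZ ?qf_fv ?bfDl ?bfDr ?bfZl ?bfZr ?bf_ff ?mulr0 ?addr0.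
rewrite spin_root_split; last first.
- by rewrite bfDl !bfZr bfZl !bf_ff !mulr0 addr0.
- exact: N'.
rewrite sc; apply: ugroupM; rewrite spin_rootC ?bfDl ?bfDr ?bfZl ?bfZr ?bf_ff ?mulr0 ?addr0 //.
  by rewrite spin_root_split ?sc; [apply: ugroupM; exact: ugroup_ff|exact: null_ff|rewrite bfZr bf_ff mulr0].
by rewrite spin_root_split ?sc; [apply: ugroupM; exact: ugroup_ff|exact: null_ff|rewrite bfZr bf_ff mulr0].
Qed.

Definition big_cell : set 'M[C]_spinor_dim := [set g | exists2 x, ugroup x &
  exists2 p, P0 p & g = x *m p].

Lemma big_cell_ugroup x g : ugroup x -> big_cell g -> big_cell (x *m g).
Proof.
move=> xu [y yu [p Pp ->]]; exists (x *m y); first exact: ugroupM.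
by exists p; rewrite ?mulmxA.
Qed.

Lemma big_cell_levi i j t g : i != j -> big_cell g ->
  big_cell (spin_root (ev i) (fv j) t *m g).
Proof.
move=> ij [x xu [p Pp ->]]; have [y yu hy] := ugroup_levi t ij xu.
exists y => //; exists (spin_root (ev i) (fv j) t *m p); last by rewrite !mulmxA hy.
by apply: P0M => //; exact: P0_ef.
Qed.

Let o2 : 'I_4 := inord 2.
Let o3 : 'I_4 := inord 3.
Let o23 : o2 != o3. Proof. exact: inord_neq. Qed.

(* The open cell of the SL_2 attached to alpha_4. *)
Lemma root4_cell s t : 1 - s * t != 0 ->
  spin_root (ev o2) (ev o3) s *m spin_root (fv o2) (fv o3) t =
  spin_root (fv o2) (fv o3) (t / (1 - s * t)) *m
  (simple_coroot ord_max (1 - s * t) *m spin_root (ev o2) (ev o3) (s / (1 - s * t))).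
Proof.
move=> z0.
have eE c : spin_root (ev o2) (ev o3) c = root_elt (simple_root_vec C ord_max) c.
  by rewrite /simple_root_vec /= root_elt_we.
have eF c : spin_root (fv o2) (fv o3) c = root_elt (neg_simple_root_vec C ord_max) (- c).
  by rewrite /neg_simple_root_vec /= root_elt_cc [in RHS]spin_rootC ?bf_ff // opprK.
have R1 c (u : 'cV[C]_spinor_dim) b0 b1 b2 b3 :
    spin_coord (root_elt (simple_root_vec C ord_max) c *m u) b0 b1 b2 b3 =
    spin_coord u b0 b1 b2 b3 + if b2 && b3 then c * spin_coord u b0 b1 false false else 0.
  by rewrite coord_root_elt coord_simple_root /=; case: ifP; rewrite ?mulr0.
have R2 c (u : 'cV[C]_spinor_dim) b0 b1 b2 b3 :
    spin_coord (root_elt (neg_simple_root_vec C ord_max) c *m u) b0 b1 b2 b3 =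
    spin_coord u b0 b1 b2 b3 + if ~~ b2 && ~~ b3 then c * spin_coord u b0 b1 true true else 0.
  by rewrite coord_root_elt coord_neg_simple_root /=; case: ifP; rewrite ?mulr0.
have R3 (u : 'cV[C]_spinor_dim) b0 b1 b2 b3 :=
  coord_simple_coroot ord_max u b0 b1 b2 b3 z0.
rewrite !eE !eF; move: R1 R2 R3 {eE eF}; rewrite /coroot_weight /=.
move: (root_elt _) (root_elt _) (simple_coroot _ _) => e f h R1 R2 R3.
apply: spinor_ext => v; apply: coord_inj => b0 b1 b2 b3; rewrite -!mulmxA.
have z0' : t * s != 1 by rewrite mulrC eq_sym -subr_eq0.
rewrite R1 !R2 !R3 !R1; case: b2; case: b3 => /=; by field.
Qed.

(** All pairs but (2, 3). For (0, 1) the two root elements commute. Any other pair shares one index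
    with alpha_4 = eps_2 + eps_3, and conjugation multiplies its root element by one of the Levi
    factor. Both kinds of factors preserve the cell. *)
Lemma root4_mixed s k t g : (k < 5)%N ->
  big_cell (spin_root (ev o2) (ev o3) s *m g) ->
  big_cell (spin_root (ev o2) (ev o3) s *m (uroot k t *m g)).
Proof.
move=> k5 hg; rewrite mulmxA.
have act l : spin_root (ev o2) (ev o3) s *m gam (fv l) =
    gam (fv l + (s * (l == o3)%:R *: ev o2 - s * (l == o2)%:R *: ev o3))
    *m spin_root (ev o2) (ev o3) s.
  by rewrite (spin_root_act _ _ (null_ee C _ _)) !bf_ef scalerBr !scalerA !(eq_sym l).
have sc c v w u : spin_root (c *: v) w u = spin_root v w (u * c) :> 'M[C]_spinor_dim.
  by rewrite /spin_root gamZ -scalemxAl scalerA.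
have H0 l : l != o2 -> l != o3 ->
    spin_root (ev o2) (ev o3) s *m gam (fv l) = gam (fv l) *m spin_root (ev o2) (ev o3) s.
  by move=> l2 l3; rewrite act (negPf l2) (negPf l3) mulr0 !scale0r subr0 addr0.
have H l m c : l != o2 -> l != o3 -> (m == o2) || (m == o3) ->
    big_cell (spin_root (ev o2) (ev o3) s *m spin_root (fv l) (fv m) c *m g).
  move=> l2 l3 m23.
  (* [q] is the member of {2, 3} other than [m]; the new factor has the Levi root eps_q - eps_l. *)
  have [d [q [dq lq act']]] : exists d q, [/\ (q == o2) || (q == o3), l != q &
      spin_root (ev o2) (ev o3) s *m gam (fv m) =
      gam (fv m + d *: ev q) *m spin_root (ev o2) (ev o3) s].
    case/orP: m23 => /eqP ->.
      exists (- s), o3; split; rewrite ?eqxx ?orbT // act eqxx (negPf o23).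
      by rewrite mulr0 scale0r sub0r mulr1 scaleNr.
    exists s, o2; split; rewrite ?eqxx // act eqxx eq_sym (negPf o23).
    by rewrite mulr0 scale0r subr0 mulr1.
  rewrite (spin_root_conj _ (H0 _ l2 l3) act').
  rewrite spin_rootC; last first.
    by rewrite bfDl bfZl bf_ff bf_ef mulrC eq_sym (negPf lq) mul0r addr0.
  rewrite spin_root_split; [|exact: null_ff|by rewrite bfZr bf_fe (negPf lq) mulr0].
  rewrite sc -!mulmxA; apply: big_cell_ugroup; first exact: ugroup_ff.
  by apply: big_cell_levi; rewrite // eq_sym.
case: k k5 => [[|[|[|[|[|//]]]]] hk] _; rewrite /uroot /upair /=.
- rewrite (spin_root_conj _ (H0 _ _ _) (H0 _ _ _)) ?inord_neq //.
  by rewrite -mulmxA; apply: big_cell_ugroup => //; exact: ugroup_ff.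
- by apply: H; rewrite ?inord_neq // eqxx.
- by apply: H; rewrite ?inord_neq // eqxx orbT.
- by apply: H; rewrite ?inord_neq // eqxx orbT.
- by apply: H; rewrite ?inord_neq // eqxx.
Qed.

Lemma root4_big_cell s a p : P0 p -> 1 - s * a ord_max != 0 ->
  big_cell (spin_root (ev o2) (ev o3) s *m (uelt a *m p)).
Proof.
move=> Pp z0; rewrite /uelt !big_ord_recl big_ord0 mulmx1 -!mulmxA.
do 5 (apply: root4_mixed => //).
have -> : lift ord0 (lift ord0 (lift ord0 (lift ord0 (lift ord0 (ord0 : 'I_1))))) = ord_max :> 'I_6.
  by apply: val_inj.
rewrite mulmxA root4_cell // -mulmxA; apply: big_cell_ugroup; first exact: ugroup_ff.
exists 1%:M; first exact: ugroup1.
exists (simple_coroot ord_max (1 - s * a ord_max) *m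
  spin_root (ev o2) (ev o3) (s / (1 - s * a ord_max)) *m p); last by rewrite mul1mx.
by apply: P0M => //; apply: P0M; [exact: P0_coroot|exact: P0_ee].
Qed.

(** The density argument only restricts functions to lines [t |-> spin_root v w t *m g], so
    polynomiality along affine lines is all that it asks of them. *)
Definition line_poly (D : 'M[C]_spinor_dim -> C) :=
  forall A B, exists r : {poly C}, forall t, D (A + t *: B) = r.[t].

Lemma poly_fun0 (r : {poly C}) : (forall t, r.[t] = 0) -> r = 0.
Proof.
move=> h; apply: (@roots_geq_poly_eq0 _ _ [seq n%:R | n <- iota 0 (size r)]).
- by apply/allP => c /mapP [n _ ->]; apply/rootP.
- rewrite map_inj_uniq ?iota_uniq // => n m /eqP.
  by rewrite eqr_nat => /eqP.
- by rewrite size_map size_iota.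
Qed.

(** [K] consists of the [x] whose left translations preserve vanishing on the cell. Quantifying over
    all [D] makes it a group, although the cell itself is not stable under translation. *)
Lemma big_cell_density D : line_poly D ->
  (forall g, big_cell g -> D g = 0) -> forall g, Spin8 C g -> D g = 0.
Proof.
pose Z (D : 'M[C]_spinor_dim -> C) := forall g, big_cell g -> D g = 0.
pose K := [set x | x \in unitmx /\ forall D, line_poly D -> Z D ->
  Z (fun g => D (x *m g)) /\ Z (fun g => D (invmx x *m g))].
have line (x : 'M[C]_spinor_dim) D' : line_poly D' -> line_poly (fun g => D' (x *m g)).
  move=> h A B; have [r hr] := h (x *m A) (x *m B).
  by exists r => t; rewrite mulmxDr -scalemxAr hr.
move=> hD zD g Sg; suff [_ /(_ D hD zD) [/(_ 1%:M) + _]] : K g.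
  rewrite mulmx1; apply; exists 1%:M; first exact: ugroup1.
  by exists 1%:M; [exact: P01|rewrite mulmx1].
apply: smallest_sub (Spin_generated Sg).
  split=> [x []//||x y [xU hx] [yU hy]|x [xU hx]] /=.
  - by split=> [|D' _ ZD']; rewrite ?unitmx1 // invmx1; split=> h; rewrite mul1mx; exact: ZD'.
  - split=> [|D' lD' ZD']; first by rewrite unitmx_mul xU.
    have e : (x *m y) *m (invmx y *m invmx x) = 1%:M by rewrite mulmxA mulmxK // mulmxV.
    rewrite (mulmx_unit_cancel e).2; split=> h bh; rewrite -!mulmxA.
      exact: (hy _ (line _ _ lD') (hx _ lD' ZD').1).1.
    exact: (hx _ (line _ _ lD') (hy _ lD' ZD').2).2.
  - split=> [|D' lD' ZD']; first by rewrite unitmx_inv.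
    by rewrite invmxK; have [] := hx _ lD' ZD'.
have H (x : C -> 'M[C]_spinor_dim) : (forall t, x t \in unitmx /\ invmx (x t) = x (- t)) ->
    (forall t D, line_poly D -> Z D -> Z (fun g => D (x t *m g))) -> forall t, K (x t).
  move=> hx hZ t; split=> [|D' lD' ZD']; first exact: (hx t).1.
  by rewrite (hx t).2; split; exact: hZ.
move=> _ [[i [j [t [ij ->]]]]|[t [->|->]]].
- apply: (H (spin_root (ev i) (fv j))) => [s|s D' _ ZD' h bh].
    by have [-> ->] := spin_root_inv s (null_ef C ij).
  by apply: ZD'; exact: big_cell_levi.
- apply: (H (spin_root (ev o2) (ev o3))) => [s|s D' lD' ZD' h].
    by have [-> ->] := spin_root_inv s (null_ee C o2 o3).
  move=> [_ [a ->] [p Pp ->]].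
  have [r hr] := lD' (uelt a *m p) (gam (ev o2) *m gam (ev o3) *m (uelt a *m p)).
  have hr' s' : D' (spin_root (ev o2) (ev o3) s' *m (uelt a *m p)) = r.[s'].
    by rewrite -hr /spin_root mulmxDl mul1mx -scalemxAl.
  suff r0 : r = 0 by rewrite hr' r0 horner0.
  (* The second factor vanishes exactly where the translate may leave the cell, so the product has
     the value 0 everywhere. *)
  have : r * (1 - (a ord_max)%:P * 'X) = 0.
    apply: poly_fun0 => s'; rewrite !hornerE.
    have [z0|z0] := eqVneq (1 - a ord_max * s') 0; first by rewrite z0 mulr0.
    rewrite -hr' ZD' ?mul0r //; apply: root4_big_cell => //.
    by rewrite mulrC.
  move/eqP; rewrite mulf_eq0 => /orP[/eqP//|/eqP /(congr1 (fun q => q.[0]))].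
  by rewrite !hornerE ?mulr0 ?subr0 => /eqP; rewrite oner_eq0.
- apply: (H (spin_root (fv o2) (fv o3))) => [s|s D' _ ZD' h bh].
    by have [-> ->] := spin_root_inv s (null_ff C o2 o3).
  by apply: ZD'; apply: big_cell_ugroup => //; exact: ugroup_ff.
Qed.

End BigCell.

(** * Regular functions *)

Section Regular.
Variables (C : fieldType) (n : nat).

(** An induction principle for polynomial functions: substituting a parametrized matrix into a
    polynomial yields a function of the parameters in any class [K] closed under the ring
    operations. *)
Lemma meval_closed (T : Type) (K : (T -> C) -> Prop) k (Phi : T -> 'I_k -> C) (p : mpoly.mpoly k C) :
  (forall c, K (fun=> c)) -> (forall f g, K f -> K g -> K (fun x => f x + g x)) ->
  (forall f g, K f -> K g -> K (fun x => f x * g x)) ->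
  (forall i, K (fun x => Phi x i)) -> K (fun x => mpoly.meval (Phi x) p).
Proof.
move=> Kc Ka Km KP; rewrite (_ : (fun x => _) = (fun x => \sum_(m <- mpoly.msupp p)
   mpoly.mcoeff m p * \prod_i Phi x i ^+ mpoly.fun_of_multinom m i)); last first.
  by apply/funext => x; rewrite mpoly.mevalE.
have Ke f e : K f -> K (fun x => f x ^+ e).
  move=> Kf; elim: e => [|e IH].
    by rewrite (_ : (fun x => _) = (fun=> 1)) //; apply/funext => x; rewrite expr0.
  rewrite (_ : (fun x => f x ^+ e.+1) = (fun x => f x * f x ^+ e)); first exact: (Km).
  by apply/funext => x; rewrite exprS.
elim: (mpoly.msupp p) => [|m s IH].
  by rewrite (_ : (fun x => _) = (fun=> 0)) //; apply/funext => x; rewrite big_nil.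
rewrite (_ : (fun x => _) = (fun x => mpoly.mcoeff m p *
   (\prod_i Phi x i ^+ mpoly.fun_of_multinom m i) + \sum_(m <- s)
   mpoly.mcoeff m p * \prod_i Phi x i ^+ mpoly.fun_of_multinom m i)); last first.
  by apply/funext => x; rewrite big_cons.
apply: (Ka) => //; apply: (Km) => //; elim: (index_enum _) => [|i r IHr].
  by rewrite (_ : (fun x => _) = (fun=> 1)) //; apply/funext => x; rewrite big_nil.
rewrite (_ : (fun x => _) = (fun x => Phi x i ^+ mpoly.fun_of_multinom m i *
   \prod_(i <- r) Phi x i ^+ mpoly.fun_of_multinom m i)); first by apply: (Km) => //; apply: (Ke).
by apply/funext => x; rewrite big_cons.
Qed.

Definition det_mpoly : mpoly.mpoly (n * n) C :=
  \det (\matrix_(i < n, j < n) mpoly.mpolyX C (mpoly.mnm1 (mxvec_index i j))).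

Lemma meval_det (g : 'M[C]_n) : mpoly.meval (entries g) det_mpoly = \det g.
Proof.
rewrite /det_mpoly -det_map_mx; congr (\det _); apply/matrixP => i j.
by rewrite !mxE /= mpoly.mevalXU /entries mxvecE.
Qed.

Variable X : set 'M[C]_n.
Hypothesis XU : X `<=` [set g | g \in unitmx].

Lemma regular_cst c : regular (fun _ : X => c).
Proof. by exists (mpoly.mpolyC _ c), 0%N => g; rewrite mpoly.mevalC expr0 divr1. Qed.

Lemma regular_entry i j : regular (fun g : X => val g i j).
Proof.
exists (mpoly.mpolyX C (mpoly.mnm1 (mxvec_index i j))), 0%N => g.
by rewrite mpoly.mevalXU /entries mxvecE expr0 divr1.
Qed.

Lemma regular_detV : regular (fun g : X => (\det (val g))^-1).
Proof. by exists (mpoly.mpolyC _ 1), 1%N => g; rewrite mpoly.mevalC expr1 mul1r. Qed.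

Lemma det_val_neq0 (g : X) : \det (val g) != 0.
Proof. by rewrite -unitfE -unitmxE; apply/XU/set_valP. Qed.

Lemma regularD (f g : X -> C) : regular f -> regular g -> regular (fun x => f x + g x).
Proof.
move=> [p [a hp]] [q [b hq]].
exists (p * det_mpoly ^+ b + q * det_mpoly ^+ a), (a + b)%N => x.
rewrite mpoly.mevalD !mpoly.mevalM !rmorphXn /= meval_det hp hq exprD.
by field; rewrite !expf_neq0 ?det_val_neq0.
Qed.

Lemma regularM (f g : X -> C) : regular f -> regular g -> regular (fun x => f x * g x).
Proof.
move=> [p [a hp]] [q [b hq]]; exists (p * q), (a + b)%N => x.
by rewrite mpoly.mevalM hp hq exprD invfM mulrACA.
Qed.

Lemma regular_sum (I : Type) (r : seq I) (f : I -> X -> C) :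
  (forall i, regular (f i)) -> regular (fun x => \sum_(i <- r) f i x).
Proof.
move=> rf; elim: r => [|i r IH].
  rewrite (_ : (fun x => _) = (fun=> 0)); first exact: regular_cst.
  by apply/funext => x; rewrite big_nil.
rewrite (_ : (fun x => _) = (fun x => f i x + \sum_(i <- r) f i x)); first exact: regularD.
by apply/funext => x; rewrite big_cons.
Qed.

Lemma regular_prod (I : Type) (r : seq I) (P : pred I) (f : I -> X -> C) :
  (forall i, regular (f i)) -> regular (fun x => \prod_(i <- r | P i) f i x).
Proof.
move=> rf; elim: r => [|i r IH].
  rewrite (_ : (fun x => _) = (fun=> 1)); first exact: regular_cst.
  by apply/funext => x; rewrite big_nil.
rewrite (_ : (fun x => _) = (fun x => (if P i then f i x else 1) * \prod_(i <- r | P i) f i x)).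
  by apply: regularM => //; case: (P i) => //; exact: regular_cst.
by apply/funext => x; rewrite big_cons; case: (P i); rewrite ?mul1r.
Qed.

Lemma regular_mulmx (m p q : nat) (A : X -> 'M[C]_(m, p)) (B : X -> 'M[C]_(p, q)) :
  (forall i j, regular (fun x => A x i j)) -> (forall i j, regular (fun x => B x i j)) ->
  forall i j, regular (fun x => (A x *m B x) i j).
Proof.
move=> rA rB i j; rewrite (_ : (fun x => _) = (fun x => \sum_k A x i k * B x k j)).
  by apply: regular_sum => k; apply: regularM.
by apply/funext => x; rewrite mxE.
Qed.

End Regular.

(** * The invariant form of the spinor module *)

Section SpinForm.
Variable C : numClosedFieldType.
Implicit Types (i j k : 'I_4) (s t : C).
Implicit Types (g h x p : 'M[C]_spinor_dim) (v : 'cV[C]_spinor_dim).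
Notation gam := (@gam C).
Notation ev := (ev C).
Notation fv := (fv C).
Notation Spin := (Spin8 C).

Definition hyp k : 'M[C]_spinor_dim := wedge C k + contract C k.

(* The invariant bilinear form of the spinor module, pairing the basis spinors
   indexed by I and by its complement. *)
Definition spin_form : 'M[C]_spinor_dim :=
  locked (hyp (inord 0) *m hyp (inord 1) *m hyp (inord 2) *m hyp (inord 3)).

Lemma coord_hyp k v b0 b1 b2 b3 : spin_coord (hyp k *m v) b0 b1 b2 b3 =
  match val k with
  | 0%N => spin_coord v (~~ b0) b1 b2 b3
  | 1%N => sgn C b0 * spin_coord v b0 (~~ b1) b2 b3
  | 2%N => sgn C b0 * sgn C b1 * spin_coord v b0 b1 (~~ b2) b3
  | _ => sgn C b0 * sgn C b1 * sgn C b2 * spin_coord v b0 b1 b2 (~~ b3)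
  end.
Proof.
rewrite /hyp mulmxDl !spin_coordE.
by case: k => [[|[|[|[|//]]]] hk] /=; case: ifP => /= _; rewrite ?addr0 ?add0r.
Qed.

Lemma coord_spin_form v b0 b1 b2 b3 : spin_coord (spin_form *m v) b0 b1 b2 b3 =
  sgn C (~~ b0) * sgn C (~~ b2) * spin_coord v (~~ b0) (~~ b1) (~~ b2) (~~ b3).
Proof.
rewrite /spin_form -lock -!mulmxA !coord_hyp /= !inordK //=.
by case: b0; case: b1; case: b2; rewrite /sgn /=; ring.
Qed.

Lemma spin_form_unit : spin_form \in unitmx.
Proof.
have U k : hyp k \in unitmx.
  have h : hyp k *m hyp k = 1%:M.
    by rewrite /hyp -gam_ev -gam_fv -gamD gam_sq qf_hyp.
  by have [[]] := mulmx_unit_cancel h.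
by rewrite /spin_form -lock !unitmx_mul !U.
Qed.

Lemma spin_form_wedge i : spin_form *m wedge C i = - (contract C i *m spin_form).
Proof.
have := coord_spin_form; move: spin_form => M hM.
apply: spinor_ext => v; apply: coord_inj => b0 b1 b2 b3.
rewrite mulNmx -!mulmxA spin_coordN hM !spin_coordE !hM.
by case: i => [[|[|[|[|//]]]] hi] /=; case: b0; case: b1; case: b2; case: b3;
  rewrite /sgn /=; ring.
Qed.

Lemma spin_form_contract i : spin_form *m contract C i = - (wedge C i *m spin_form).
Proof.
have := coord_spin_form; move: spin_form => M hM.
apply: spinor_ext => v; apply: coord_inj => b0 b1 b2 b3.
rewrite mulNmx -!mulmxA spin_coordN hM !spin_coordE !hM.
by case: i => [[|[|[|[|//]]]] hi] /=; case: b0; case: b1; case: b2; case: b3;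
  rewrite /sgn /=; ring.
Qed.

Lemma spin_form_gam u : spin_form *m gam u = - ((gam u)^T *m spin_form).
Proof.
rewrite gamE mulmx_sumr raddf_sum mulmx_suml -sumrN; apply: eq_bigr => i _ /=.
have e : (contract C i)^T = wedge C i by rewrite /contract trmxK.
have D a b (A B : 'M[C]_spinor_dim) : (a *: A + b *: B)^T = a *: A^T + b *: B^T.
  by apply/matrixP => ? ?; rewrite !mxE.
rewrite D e -/(contract C i) mulmxDr mulmxDl -!scalemxAl -!scalemxAr.
by rewrite spin_form_wedge spin_form_contract !scalerN opprD.
Qed.

(** Each [gam u] is skew for the form, so a unit vector turns the form into its negative and a
    product of two preserves it. *)
Lemma Spin_form g : Spin g -> g^T *m spin_form *m g = spin_form.
Proof.
move: spin_form spin_form_gam => M hM.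
pose K := [set g | g \in unitmx /\ g^T *m M *m g = M].
move=> Sg; suff [] : K g by [].
apply: Spin_ind Sg => [|n m hn hm].
  split=> [x []//||x y [xU hx] [yU hy]|x [xU hx]] /=.
  - by split; rewrite ?unitmx1 // trmx1 mul1mx mulmx1.
  - by split; rewrite ?unitmx_mul ?xU // trmx_mul -!mulmxA (mulmxA M)
      (mulmxA x^T) (mulmxA x^T) hx mulmxA.
  - split; first by rewrite unitmx_inv.
    by rewrite -[in LHS]hx !mulmxA -trmx_mul mulmxV // trmx1 mul1mx mulmxK.
split; first by apply: Spin_unit; apply: Spin_pair.
have h (u : 'rV[C]_(4 + 4)) : qf u = 1 -> (gam u)^T *m M *m gam u = - M.
  move=> hu; rewrite -mulmxA hM mulmxN mulmxA -trmx_mul gam_sq hu.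
  by rewrite trmx1 mul1mx.
rewrite trmx_mul -!mulmxA (mulmxA M) (mulmxA (gam n)^T) (mulmxA (gam n)^T) h //.
by rewrite mulmxA mulmxN mulNmx h // opprK.
Qed.

(** This removes denominators: on Spin(8) the inverse of the determinant is the determinant, so
    regular functions are restrictions of polynomials in the entries. *)
Lemma Spin_det_sq g : Spin g -> \det g ^+ 2 = 1.
Proof.
move=> /Spin_form /(congr1 determinant); rewrite !det_mulmx det_tr mulrAC.
have M0 : \det spin_form != 0 by have := spin_form_unit; rewrite unitmxE unitfE.
by move=> e; apply: (mulIf M0); rewrite mul1r expr2.
Qed.

Lemma diag_coord x v b0 b1 b2 b3 : is_diag_mx x ->
  spin_coord (x *m v) b0 b1 b2 b3 =
  x (enum_rank (bitset b0 b1 b2 b3)) (enum_rank (bitset b0 b1 b2 b3)) * spin_coord v b0 b1 b2 b3.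
Proof.
move=> /is_diag_mxP dx; rewrite {1}/spin_coord mxE (bigD1 (enum_rank (bitset b0 b1 b2 b3))) //=.
rewrite big1 ?addr0 // => a na; rewrite dx ?mul0r //.
by rewrite (inj_eq val_inj) eq_sym.
Qed.

Definition bvec (b0 b1 b2 b3 : bool) : 'cV[C]_spinor_dim :=
  delta_mx (enum_rank (bitset b0 b1 b2 b3)) ord0.

Lemma coord_bvec c0 c1 c2 c3 b0 b1 b2 b3 : spin_coord (bvec c0 c1 c2 c3) b0 b1 b2 b3 =
  [&& b0 == c0, b1 == c1, b2 == c2 & b3 == c3]%:R.
Proof.
rewrite /spin_coord mxE eqxx andbT (inj_eq enum_rank_inj); congr (_%:R); congr nat_of_bool.
apply/eqP/and4P => [/bitset_inj [-> -> -> ->]//|[/eqP -> /eqP -> /eqP -> /eqP ->]//].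
Qed.

Definition tau x b0 b1 b2 b3 : C := spin_coord (x *m bvec b0 b1 b2 b3) b0 b1 b2 b3.

Lemma tau_coord x v b0 b1 b2 b3 : is_diag_mx x ->
  spin_coord (x *m v) b0 b1 b2 b3 = tau x b0 b1 b2 b3 * spin_coord v b0 b1 b2 b3.
Proof.
by move=> dx; rewrite /tau !diag_coord // coord_bvec !eqxx mulr1.
Qed.

Lemma coord_diag x (w : bool -> bool -> bool -> bool -> C) :
  (forall v b0 b1 b2 b3, spin_coord (x *m v) b0 b1 b2 b3 =
     w b0 b1 b2 b3 * spin_coord v b0 b1 b2 b3) -> is_diag_mx x.
Proof.
move=> h; apply/is_diag_mxP => a b ab.
have [b0 [b1 [b2 [b3 e]]]] := bitsetP (enum_val a).
have := h (delta_mx b ord0) b0 b1 b2 b3.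
rewrite /spin_coord -e enum_valK -colE !mxE; move/negPf: ab => ab.
by rewrite -(inj_eq val_inj) ab mulr0.
Qed.

(** The invariant form pairs complementary basis spinors, so the weights of complementary subsets
    are opposite. *)
Lemma tau_compl x b0 b1 b2 b3 : is_diag_mx x -> Spin x ->
  tau x b0 b1 b2 b3 * tau x (~~ b0) (~~ b1) (~~ b2) (~~ b3) = 1.
Proof.
move=> dx Sx; have := Spin_form Sx.
have -> : x^T = x by have [d ->] := diag_mxP _ dx; rewrite tr_diag_mx.
move/(congr1 (fun m : 'M[C]_spinor_dim => spin_coord (m *m bvec (~~ b0) (~~ b1) (~~ b2) (~~ b3)) b0 b1 b2 b3)).
rewrite -!mulmxA tau_coord // !coord_spin_form tau_coord // coord_bvec !eqxx !mulr1.
set c := sgn C _ * _; have c0 : c != 0.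
  by rewrite /c mulf_neq0 // /sgn; case: ifP; rewrite ?oppr_eq0 oner_eq0.
by rewrite mulrCA -[RHS]mulr1 => /(mulfI c0).
Qed.

(** The ratio of the eigenvalues at I with and without i does not depend on I: it is the coefficient
    of [ev i] in its own image under the vector representation, because [wedge C i] inserts i up to
    sign. *)
Lemma diag_Spin_step x i : is_diag_mx x -> Spin x -> exists l, forall b0 b1 b2 b3,
  match val i with
  | 0%N => tau x true b1 b2 b3 = l * tau x false b1 b2 b3
  | 1%N => tau x b0 true b2 b3 = l * tau x b0 false b2 b3
  | 2%N => tau x b0 b1 true b3 = l * tau x b0 b1 false b3
  | _ => tau x b0 b1 b2 true = l * tau x b0 b1 b2 false
  end.
Proof.
move=> dx Sx; have [A hA] := Spin_act Sx.
exists (bf (ev i *m A) (fv i)) => b0 b1 b2 b3.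
have := hA (ev i); rewrite gam_ev gamE; set u := ev i *m A.
rewrite !big_ord_recl big_ord0 addr0.
move: (tau_coord (x := x)) => T; move: (bf u) => f.
(* The coordinate identities below give the claim only up to the sign of [wedge], hence the two
   alternatives. *)
have sub0 (a b c d : C) : a = b -> (c - d = a - b) \/ (c - d = - (a - b)) -> c = d.
  by move=> ->; rewrite subrr oppr0 => h; apply/eqP; rewrite -subr_eq0; case: h => ->.
case: i {hA u} => [[|[|[|[|//]]]] hi] h;
  have {}h (w : 'cV[C]_spinor_dim) := congr1 (fun m : 'M[C]_spinor_dim => m *m w) h.
- move: (congr1 (fun s : 'cV[C]_spinor_dim => spin_coord s true b1 b2 b3) (h (bvec false b1 b2 b3))).
  rewrite (_ : Ordinal hi = ord0); last exact: val_inj.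
  rewrite !mulmxDl -!scalemxAl -!mulmxA !T // !spin_coordE /= !T // !coord_bvec !eqxx.
  move/sub0; apply; left.
  by case: b1; case: b2; case: b3; rewrite /sgn /=; ring.
- move: (congr1 (fun s : 'cV[C]_spinor_dim => spin_coord s b0 true b2 b3) (h (bvec b0 false b2 b3))).
  rewrite (_ : Ordinal hi = lift ord0 ord0); last exact: val_inj.
  rewrite !mulmxDl -!scalemxAl -!mulmxA !T // !spin_coordE /= !T // !coord_bvec !eqxx.
  move/sub0; apply.
  by case: b0; case: b2; case: b3; rewrite /sgn /=; first [by left; ring|by right; ring].
- move: (congr1 (fun s : 'cV[C]_spinor_dim => spin_coord s b0 b1 true b3) (h (bvec b0 b1 false b3))).
  rewrite (_ : Ordinal hi = lift ord0 (lift ord0 ord0)); last exact: val_inj.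
  rewrite !mulmxDl -!scalemxAl -!mulmxA !T // !spin_coordE /= !T // !coord_bvec !eqxx.
  move/sub0; apply.
  by case: b0; case: b1; case: b3; rewrite /sgn /=; first [by left; ring|by right; ring].
- move: (congr1 (fun s : 'cV[C]_spinor_dim => spin_coord s b0 b1 b2 true) (h (bvec b0 b1 b2 false))).
  rewrite (_ : Ordinal hi = lift ord0 (lift ord0 (lift ord0 ord0))); last exact: val_inj.
  rewrite !mulmxDl -!scalemxAl -!mulmxA !T // !spin_coordE /= !T // !coord_bvec !eqxx.
  move/sub0; apply.
  by case: b0; case: b1; case: b2; rewrite /sgn /=; first [by left; ring|by right; ring].
Qed.

End SpinForm.

(** * The standard torus *)

Section Torus.
Variable C : numClosedFieldType.
Implicit Types (k : 'I_4) (z : 'I_4 -> C).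
Implicit Types (g h x t : 'M[C]_spinor_dim) (v : 'cV[C]_spinor_dim).
Notation Spin := (Spin8 C).

Definition std_torus : set 'M[C]_spinor_dim := [set t | Spin t /\ is_diag_mx t].

Definition torus_elt z : 'M[C]_spinor_dim :=
  locked (simple_coroot (inord 0) (z (inord 0)) *m simple_coroot (inord 1) (z (inord 1)) *m
    simple_coroot (inord 2) (z (inord 2)) *m simple_coroot (inord 3) (z (inord 3))).

Definition torus_weight z b0 b1 b2 b3 : C :=
  coroot_weight (inord 0) b0 b1 b2 b3 (z (inord 0)) *
  coroot_weight (inord 1) b0 b1 b2 b3 (z (inord 1)) *
  coroot_weight (inord 2) b0 b1 b2 b3 (z (inord 2)) *
  coroot_weight (inord 3) b0 b1 b2 b3 (z (inord 3)).

Lemma coord_torus_elt z v b0 b1 b2 b3 : (forall k, z k != 0) ->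
  spin_coord (torus_elt z *m v) b0 b1 b2 b3 =
  torus_weight z b0 b1 b2 b3 * spin_coord v b0 b1 b2 b3.
Proof.
move=> z0; have H k w a0 a1 a2 a3 := coord_simple_coroot k w a0 a1 a2 a3 (z0 k).
rewrite /torus_elt -lock /torus_weight.
move: (H (inord 0)) (H (inord 1)) (H (inord 2)) (H (inord 3)).
move: (simple_coroot _ _) (simple_coroot _ _) (simple_coroot _ _) (simple_coroot _ _).
by move=> c0 c1 c2 c3 H0 H1 H2 H3; rewrite -!mulmxA H0 H1 H2 H3 !mulrA.
Qed.

Lemma std_torus_torus_elt z : (forall k, z k != 0) -> std_torus (torus_elt z).
Proof.
move=> z0; split; first by rewrite /torus_elt -lock; do 3! [apply: SpinM; last exact: simple_coroot_Spin]; exact: simple_coroot_Spin.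
exact: (coord_diag (fun v b0 b1 b2 b3 => coord_torus_elt v b0 b1 b2 b3 z0)).
Qed.

(** The fundamental weights, which are dual to the simple coroots. The first two, eps_0 and eps_0 +
    eps_1, are sums of two half-spin weights; the last two are half-spin weights themselves. *)
Definition torus_coord t k : C :=
  match val k with
  | 0%N => tau t true true true true * tau t true false false false
  | 1%N => tau t true true true true * tau t true true false false
  | 2%N => tau t true true true false
  | _ => tau t true true true true
  end.

Lemma tau_neq0 t b0 b1 b2 b3 : std_torus t -> tau t b0 b1 b2 b3 != 0.
Proof.
move=> [St dt]; apply/eqP => t0; have := tau_compl b0 b1 b2 b3 dt St.
by rewrite t0 mul0r => /eqP; rewrite eq_sym oner_eq0.
Qed.

Lemma torus_coord_neq0 t k : std_torus t -> torus_coord t k != 0.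
Proof.
move=> Tt; rewrite /torus_coord; case: (val k) => [|[|[|?]]];
by rewrite ?mulf_neq0 ?tau_neq0.
Qed.

(** By [diag_Spin_step] all sixteen eigenvalues are determined by the ratios l0, l1, l2, l3 and the
    eigenvalue at the empty set, so it suffices to compare rational expressions in these. *)
Lemma torus_eltK t : std_torus t -> torus_elt (torus_coord t) = t.
Proof.
move=> Tt; have [St dt] := Tt.
apply: spinor_ext => v; apply: coord_inj => b0 b1 b2 b3.
rewrite coord_torus_elt => [|k]; last exact: torus_coord_neq0.
rewrite tau_coord //; congr (_ * _).
rewrite /torus_weight /coroot_weight /torus_coord /= !inordK //=.
have [l0 h0] := diag_Spin_step (@Ordinal 4 0 isT) dt St.
have [l1 h1] := diag_Spin_step (@Ordinal 4 1 isT) dt St.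
have [l2 h2] := diag_Spin_step (@Ordinal 4 2 isT) dt St.
have [l3 h3] := diag_Spin_step (@Ordinal 4 3 isT) dt St.
move: (fun b1 b2 b3 => h0 true b1 b2 b3) (fun b0 b2 b3 => h1 b0 true b2 b3)
  (fun b0 b1 b3 => h2 b0 b1 true b3) (fun b0 b1 b2 => h3 b0 b1 b2 true).
move=> {}h0 {}h1 {}h2 {}h3; rewrite /= in h0 h1 h2 h3.
have := tau_compl true true true true dt St.
have := tau_neq0 true true true true Tt.
have c0 := tau_neq0 false false false false Tt.
have -> : tau t true true true true = l0 * (l1 * (l2 * (l3 * tau t false false false false))).
  by rewrite h0 h1 h2 h3.
rewrite /= !mulf_eq0 !negb_or => /and5P [n0 n1 n2 n3 _] hc.
(* The eigenvalues at the full and at the empty set are inverse to each other; this eliminates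
   l3. *)
have hl3 : l3 = (l0 * l1 * l2 * tau t false false false false ^+ 2)^-1.
  apply: (mulIf (_ : l0 * l1 * l2 * tau t false false false false ^+ 2 != 0)).
    by rewrite !mulf_neq0 ?expf_neq0.
  rewrite mulVf ?mulf_neq0 ?expf_neq0 // -hc; ring.
by case: b0; case: b1; case: b2; case: b3;
  rewrite ?(h0, h1, h2, h3) /= ?hl3; field; rewrite ?n0 ?n1 ?n2 ?c0.
Qed.

Lemma torus_coordK z k : (forall k, z k != 0) -> torus_coord (torus_elt z) k = z k.
Proof.
move=> z0; have T b0 b1 b2 b3 : tau (torus_elt z) b0 b1 b2 b3 = torus_weight z b0 b1 b2 b3.
  by rewrite /tau coord_torus_elt // coord_bvec !eqxx mulr1.
have zk (n : nat) : z (inord n) != 0 by [].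
rewrite /torus_coord !T /torus_weight /coroot_weight /= !inordK //=.
rewrite -[in RHS](inord_val k); case: k => [[|[|[|[|//]]]] hk] /=; field; rewrite ?zk //.
Qed.

Lemma torus_eltM z z' : (forall k, z k != 0) -> (forall k, z' k != 0) ->
  torus_elt (fun k => z k * z' k) = torus_elt z *m torus_elt z'.
Proof.
move=> z0 z0'; apply: spinor_ext => v; apply: coord_inj => b0 b1 b2 b3.
rewrite -mulmxA !coord_torus_elt // => [|k]; last by rewrite mulf_neq0.
rewrite mulrA; congr (_ * _); rewrite /torus_weight /coroot_weight /= !inordK //=.
have zk (n : nat) : z (inord n) != 0 by []. have zk' (n : nat) : z' (inord n) != 0 by [].
by case: b0; case: b1; case: b2; case: b3 => /=; field; rewrite ?zk ?zk'.
Qed.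

Lemma std_torus_subgroup : is_subgroup std_torus.
Proof.
have dP t : std_torus t -> forall v b0 b1 b2 b3, spin_coord (t *m v) b0 b1 b2 b3 =
    tau t b0 b1 b2 b3 * spin_coord v b0 b1 b2 b3.
  by move=> [_ dt] v b0 b1 b2 b3; exact: tau_coord.
split=> [t [/Spin_unit]//||g h Tg Th|t Tt].
- by split; [exact: Spin1|exact: scalar_mx_is_diag].
- split; first by apply: SpinM; [case: Tg|case: Th].
  apply: (@coord_diag _ _ (fun b0 b1 b2 b3 => tau g b0 b1 b2 b3 * tau h b0 b1 b2 b3)).
  by move=> v b0 b1 b2 b3; rewrite -mulmxA !dP // mulrA.
- split; first by apply: SpinV; case: Tt.
  have tU : t \in unitmx by case: Tt => /Spin_unit.
  apply: (@coord_diag _ _ (fun b0 b1 b2 b3 => (tau t b0 b1 b2 b3)^-1)) => v b0 b1 b2 b3.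
  by rewrite -{2}(mulKVmx tU v) (dP t) // mulKf // tau_neq0.
Qed.

Lemma conj_subgroup n (H : set 'M[C]_n) (y : 'M[C]_n) : y \in unitmx -> is_subgroup H ->
  is_subgroup (conj_set y H).
Proof.
move=> yU [HU H1 HM HV]; split=> [_ [t Ht <-]||_ _ [g Hg <-] [h Hh <-]|_ [t Ht <-]].
- by rewrite /= !unitmx_mul yU (HU _ Ht) unitmx_inv yU.
- by exists 1%:M => //; rewrite mulmx1 mulmxV.
- by exists (g *m h); [exact: HM|rewrite !mulmxA mulmxKV].
- exists (invmx t); first exact: HV.
  have e : (y *m t *m invmx y) *m (y *m invmx t *m invmx y) = 1%:M.
    by rewrite !mulmxA mulmxKV // mulmxK ?mulmxV // HU.
  by rewrite (mulmx_unit_cancel e).2.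
Qed.

Lemma diagonal_group_unit n : diagonal_group C n `<=` [set g | g \in unitmx].
Proof. by move=> g /andP[]. Qed.

Lemma diagonal_entry_neq0 n (D : 'M[C]_n) (k : 'I_n) : diagonal_group C n D -> D k k != 0.
Proof.
move=> /andP[/diag_mxP [d ->]]; rewrite unitmxE det_diag unitfE mxE eqxx mulr1n.
by move/prodf_neq0/(_ k); apply.
Qed.

(** Only the inverse of the determinant is regular by definition; multiplying it by the other
    diagonal entries leaves the inverse of one entry. *)
Lemma regular_diagV n (k : 'I_n) : regular (fun D : diagonal_group C n => (val D k k)^-1).
Proof.
have U := @diagonal_group_unit n.
have -> : (fun D : diagonal_group C n => (val D k k)^-1) =
    (fun D => (\prod_(j < n | j != k) val D j j) * (\det (val D))^-1).
  apply/funext => D; have DD := set_valP D; have Dk := diagonal_entry_neq0 k DD.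
  have /andP[/diag_mxP [d e] _] := DD.
  have -> : \det (val D) = \prod_j val D j j.
    by rewrite {1}e det_diag; apply: eq_bigr => j _; rewrite e mxE eqxx mulr1n.
  rewrite [X in _ / X](bigD1 k) //= invfM mulrCA divff ?mulr1 //.
  by apply/prodf_neq0 => j _; exact: diagonal_entry_neq0.
apply: regularM; last exact: regular_detV.
by apply: regular_prod => // j; exact: regular_entry.
Qed.

Lemma conj_std_torus x : Spin x -> is_torus (conj_set x std_torus).
Proof.
move=> /Spin_unit xU; split; first exact/conj_subgroup/std_torus_subgroup.
exists 4%N, (fun D => x *m torus_elt (fun k => D k k) *m invmx x),
  (fun t => diag_mx (\row_k torus_coord (invmx x *m t *m x) k)).
have cK t : invmx x *m (x *m t *m invmx x) *m x = t.
  by rewrite !mulmxA mulVmx // mul1mx mulmxKV.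
have U := @diagonal_group_unit 4.
have U' : conj_set x std_torus `<=` [set g | g \in unitmx].
  by case: (conj_subgroup xU std_torus_subgroup).
split.
- split=> [D DD|D E DD DE|i j].
  + exists (torus_elt (fun k => D k k)) => //; apply: std_torus_torus_elt => k.
    exact: diagonal_entry_neq0.
  + have -> : torus_elt (fun k => (D *m E) k k) =
        torus_elt (fun k => D k k) *m torus_elt (fun k => E k k).
      rewrite -torus_eltM => [|k|k]; try exact: diagonal_entry_neq0.
      congr torus_elt; apply/funext => k.
      have /andP[/diag_mxP [d ->] _] := DD; have /andP[/diag_mxP [e ->] _] := DE.
      by rewrite mulmx_diag !mxE eqxx !mulr1n.
    by rewrite -!mulmxA mulKmx.
  + apply: regular_mulmx => // [i' j'|i' j']; last exact: regular_cst.
    apply: regular_mulmx => // [i'' j''|a b]; first exact: regular_cst.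
    have [b0 [b1 [b2 [b3 e]]]] := bitsetP (enum_val a).
    rewrite (_ : (fun D => _) = (fun D : diagonal_group C 4 =>
       if a == b then torus_weight (fun k => val D k k) b0 b1 b2 b3 else 0)); last first.
      apply/funext => D; have DD := set_valP D.
      have z0 k : val D k k != 0 by exact: diagonal_entry_neq0.
      have := coord_torus_elt (delta_mx b ord0) b0 b1 b2 b3 z0.
      rewrite -colE /spin_coord -e enum_valK !mxE eqxx andbT => ->.
      by case: eqP; rewrite ?mulr1 ?mulr0.
    case: eqP => _; last exact: regular_cst.
    have W k : regular (fun D : diagonal_group C 4 => coroot_weight k b0 b1 b2 b3 (val D k k)).
      (* The pairings with the coroots are -1, 0 or 1, so these three functions cover every
         weight. *)
      have H (f : C -> C) : f = (fun=> 1) \/ f = id \/ f = GRing.inv ->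
          regular (fun D : diagonal_group C 4 => f (val D k k)).
        move=> [->|[->|->]]; [exact: regular_cst|exact: regular_entry|exact: regular_diagV].
      apply: H; rewrite /coroot_weight.
      case: (val k) => [|[|[|m]]]; case: b0 {e}; case: b1; case: b2; case: b3 => /=; auto.
    by do 3! [apply: regularM => //].
- split=> [_ [t Tt <-]|_ _ [g Tg <-] [h Th <-]|i j].
  + rewrite cK; apply/andP; split; first exact: diag_mx_is_diag.
    rewrite unitmxE det_diag unitfE; apply/prodf_neq0 => k _.
    by rewrite mxE; exact: torus_coord_neq0.
  + have -> : invmx x *m (x *m g *m invmx x *m (x *m h *m invmx x)) *m x = g *m h.
      by rewrite -!mulmxA mulKmx // mulKmx // mulVmx // mulmx1.
    rewrite !cK mulmx_diag; congr diag_mx; apply/rowP => k; rewrite !mxE.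
    have [Sg dg] := Tg; have [Sh dh] := Th.
    have T b0 b1 b2 b3 : tau (g *m h) b0 b1 b2 b3 = tau g b0 b1 b2 b3 * tau h b0 b1 b2 b3.
      by rewrite /tau -mulmxA (tau_coord _ _ _ _ _ dg) (tau_coord _ _ _ _ _ dh) coord_bvec !eqxx mulr1.
    by rewrite /torus_coord !T; case: (val k) => [|[|[|?]]]; ring.
  + rewrite (_ : (fun D => _) = (fun t : conj_set x std_torus =>
       if i == j then torus_coord (invmx x *m val t *m x) j else 0)); last first.
      by apply/funext => t; rewrite !mxE; case: eqP => [->|_]; rewrite ?mulr1n ?mulr0n.
    case: eqP => _; last exact: regular_cst.
    have W b0 b1 b2 b3 : regular (fun t : conj_set x std_torus => tau (invmx x *m val t *m x) b0 b1 b2 b3).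
      rewrite /tau /spin_coord; apply: regular_mulmx => // a b; last exact: regular_cst.
      apply: regular_mulmx => // a' b'; last exact: regular_cst.
      by apply: regular_mulmx => // a'' b''; [exact: regular_cst|exact: regular_entry].
    by rewrite /torus_coord; case: (val j) => [|[|[|?]]] //; exact: regularM.
- move=> D DD; rewrite cK; have /andP[/diag_mxP [d e] _] := DD.
  rewrite [RHS]e; congr diag_mx; apply/rowP => k; rewrite mxE torus_coordK => [|l].
    by rewrite e mxE eqxx mulr1n.
  exact: diagonal_entry_neq0.
- move=> _ [t Tt <-]; rewrite cK; congr (_ *m _ *m _); rewrite -[RHS]torus_eltK //.
  by congr torus_elt; apply/funext => k; rewrite !mxE eqxx mulr1n.
Qed.

End Torus.

(** * Reflections *)

Section Reflections.
Variable C : numClosedFieldType.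
Notation gam := (@gam C).
Implicit Types (u v w n x y : 'rV[C]_(4 + 4)) (ns : seq 'rV[C]_(4 + 4)).

Definition reflection n v := v - bf n v *: n.
Definition reflections ns v := foldr reflection v ns.
Definition gam_prod ns : 'M[C]_spinor_dim := foldr (fun n g => gam n *m g) 1%:M ns.
Definition unit_vecs ns := all (fun n => qf n == 1) ns.

Lemma reflection_linear n : linear (reflection n).
Proof.
move=> t u v; rewrite /reflection bfDr bfZr scalerDl scalerBr scalerA opprD.
by rewrite addrACA.
Qed.

Lemma reflectionsP ns t u v : reflections ns (t *: u + v) = t *: reflections ns u + reflections ns v.
Proof. by elim: ns => //= n ns ->; rewrite reflection_linear. Qed.

Lemma reflection_bf n u v : qf n = 1 -> bf (reflection n u) (reflection n v) = bf u v.
Proof.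
move=> hn; rewrite /reflection !bfDl !bfNl !bfDr !bfNr !bfZl !bfZr bfvv hn (bfC u n).
by ring.
Qed.

Lemma reflections_bf ns u v : unit_vecs ns ->
  bf (reflections ns u) (reflections ns v) = bf u v.
Proof.
by elim: ns => //= n ns IH /andP[/eqP hn hns]; rewrite reflection_bf // IH.
Qed.

Lemma gam_prod_act ns v : unit_vecs ns ->
  gam_prod ns *m gam v = (-1) ^+ size ns *: (gam (reflections ns v) *m gam_prod ns).
Proof.
elim: ns => [_|n ns IH /= /andP[/eqP hn hns]]; first by rewrite expr0 scale1r mul1mx mulmx1.
rewrite -mulmxA IH // -scalemxAr exprS mulN1r scaleNr -scalerN; congr (_ *: _).
rewrite !mulmxA /reflection; set w := reflections ns v.
have -> : gam n *m gam w = - (gam (w - bf n w *: n) *m gam n).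
  rewrite -mulNmx -gamN opprB -gam_reflect // -!mulmxA gam_sq hn mulmx1 //.
by rewrite mulNmx.
Qed.

Lemma gam_prod_Spin ns : unit_vecs ns -> ~~ odd (size ns) -> Spin8 C (gam_prod ns).
Proof.
have [m] := ubnP (size ns); elim: m ns => // m IH [|n1 [|n2 ns]] //=; first by move=> *; exact: Spin1.
rewrite !ltnS negbK => hm /and3P [/eqP h1 /eqP h2 h] o; rewrite mulmxA.
by apply: SpinM; [exact: Spin_pair|apply: IH => //; exact: ltnW].
Qed.

Lemma reflection_to w : qf w != 0 -> exists n,
  qf n = 1 /\ forall v, reflection n v = v - (bf w v / qf w) *: w.
Proof.
move=> w0; have s0 : sqrtC (qf w) != 0 by rewrite sqrtC_eq0.
exists ((sqrtC (qf w))^-1 *: w); split.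
  by rewrite qfZ exprVn sqrtCK mulVf.
move=> v; rewrite /reflection bfZl scalerA; congr (_ - _ *: _).
by rewrite mulrAC -expr2 exprVn sqrtCK mulrC.
Qed.

(** As in the Cartan-Dieudonné theorem, [x] is sent to [y] by the reflection in x - y or, if that
    vector is isotropic, by the one in x + y followed by the one in y. These vectors are orthogonal
    to the earlier [c' j], which therefore stay fixed. The factor 2 comes from
    [bf v v = 2 * qf v]. *)
Lemma reflections_transitive (c c' : nat -> 'rV[C]_(4 + 4)) m :
  (forall i j, (i < m)%N -> (j < m)%N -> bf (c i) (c j) = (i == j)%:R * 2) ->
  (forall i j, (i < m)%N -> (j < m)%N -> bf (c' i) (c' j) = (i == j)%:R * 2) ->
  exists2 ns, unit_vecs ns & forall i, (i < m)%N -> reflections ns (c i) = c' i.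
Proof.
elim: m => [_ _|m IH hc hc']; first by exists [::].
have [i j hi hj|i j hi hj|ns hns hr] := IH.
- by apply: hc; exact: ltnW.
- by apply: hc'; exact: ltnW.
have two0 : 2%:R != 0 :> C by rewrite pnatr_eq0.
pose x := reflections ns (c m); pose y := c' m.
have qx : qf x = 1.
  by apply: (mulfI two0); rewrite -bfvv /x reflections_bf // hc // eqxx mul1r mulr1.
have qy : qf y = 1.
  by apply: (mulfI two0); rewrite -bfvv /y hc' // eqxx mul1r mulr1.
have xj j : (j < m)%N -> bf x (c' j) = 0.
  move=> jm; rewrite -hr // /x reflections_bf // hc // 1?ltnW // gtn_eqF // ?mul0r //.
have yj j : (j < m)%N -> bf y (c' j) = 0.
  by move=> jm; rewrite /y hc' ?gtn_eqF ?mul0r // ltnW.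
have fixj n j : (j < m)%N -> bf n (c' j) = 0 -> reflection n (c' j) = c' j.
  by move=> _ h; rewrite /reflection h scale0r subr0.
have conclude ms : unit_vecs ms -> reflections ms x = y ->
    (forall j, (j < m)%N -> reflections ms (c' j) = c' j) ->
    exists2 ns, unit_vecs ns & forall i, (i < m.+1)%N -> reflections ns (c i) = c' i.
  move=> hms h1 h2; exists (ms ++ ns); first by rewrite /unit_vecs all_cat; apply/andP.
  move=> i; rewrite ltnS leq_eqVlt /reflections foldr_cat => /orP[/eqP->|im].
    by rewrite -/(reflections ns _) -/x.
  by rewrite -/(reflections ns _) hr // -/(reflections ms _) h2.
have [q0|q0] := eqVneq (qf (x - y)) 0; last first.
  have [n [hn rn]] := reflection_to q0.
  apply: (conclude [:: n]); rewrite /= ?hn ?eqxx // ?rn.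
    have -> : bf (x - y) x = qf (x - y).
      by rewrite bfDl bfNl qfD qfN bfNr bfvv qx qy (bfC y); ring.
    by rewrite divff // scale1r opprB addrC subrK.
  by move=> j jm; rewrite rn bfDl bfNl xj // yj // subrr mul0r scale0r subr0.
have q4 : qf (x + y) != 0.
  have -> : qf (x + y) = 4.
    transitivity (qf (x + y) + qf (x - y)); first by rewrite q0 addr0.
    by rewrite !qfD qfN bfNr qx qy; ring.
  by rewrite pnatr_eq0.
have [n [hn rn]] := reflection_to q4.
apply: (conclude [:: y; n]); rewrite /= ?hn ?qy ?eqxx //.
  have -> : reflection n x = - y.
    rewrite rn; have -> : bf (x + y) x = qf (x + y).
      by rewrite bfDl qfD bfvv qx qy (bfC y); ring.
    by rewrite divff // scale1r opprD addrA subrr sub0r.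
  by rewrite /reflection bfNr bfvv qy mulr1 scaleNr opprK scaler_nat mulr2n addrA addNr add0r.
move=> j jm; have -> : reflection n (c' j) = c' j.
  by rewrite rn bfDl xj // yj // addr0 mul0r scale0r subr0.
by apply: fixj => //; exact: yj.
Qed.

End Reflections.

(** * Simultaneous diagonalization *)

Section Codiagonalization.
Variable C : numClosedFieldType.

Lemma unity_roots n : (0 < n)%N ->
  exists2 rs : seq C, uniq rs & 'X^n - 1 = \prod_(z <- rs) ('X - z%:P).
Proof.
move=> n0; have [rs e] := closed_field_poly_normal ('X^n - 1 : {poly C}).
have mon : lead_coef ('X^n - 1 : {poly C}) = 1 by apply/eqP; rewrite -monicE monicXnsubC.
rewrite mon scale1r in e; exists rs => //.
have n0' : n%:R != 0 :> C by rewrite pnatr_eq0 -lt0n.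
by have := separable_Xn_sub_1 n0'; rewrite e separable_prod_XsubC.
Qed.

Lemma finite_order_diagonalizable m (A : 'M[C]_m.+1) n : (0 < n)%N -> A ^+ n = 1 ->
  mxpoly.diagonalizable A.
Proof.
move=> n0 hA; apply/mxpoly.diagonalizableP; have [rs urs e] := unity_roots n0.
exists rs => //; rewrite -e; apply: mxminpoly_min.
by rewrite rmorphB rmorphXn rmorph1 /= horner_mx_X hA subrr.
Qed.

(* Reduction to a finite family: a finite subset of S of maximal rank spans S. *)
Lemma codiagonalizable_set m (S : set 'M[C]_m) :
  (forall A B, S A -> S B -> A *m B = B *m A) ->
  (forall A, S A -> mxpoly.diagonalizable A) ->
  exists2 P, P \in unitmx & forall A, S A -> is_diag_mx (P *m A *m invmx P).
Proof.
move=> Scomm Sdiag.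
pose Q k := `[< exists As : seq 'M[C]_m, (forall A, A \in As -> S A) /\ \dim <<As>>%VS = k >].
have Q0 : exists k, Q k by exists 0%N; apply/asboolP; exists [::]; split=> //; rewrite span_nil dimv0.
have Qb k : Q k -> (k <= \dim {: 'M[C]_m})%N.
  by move=> /asboolP [As [_ <-]]; apply: dimvS; exact: subvf.
case: (ex_maxnP Q0 Qb) => k /asboolP [As [SAs dAs]] kmax.
have AsS A : S A -> A \in <<As>>%VS.
  move=> SA; have : Q (\dim <<A :: As>>%VS).
    by apply/asboolP; exists (A :: As); split=> // B; rewrite inE => /orP[/eqP->//|]; exact: SAs.
  move/kmax; rewrite -dAs => h.
  have sub : (<<As>> <= <<A :: As>>)%VS by rewrite span_cons addvSr.
  have /eqP -> : <<As>>%VS == <<A :: As>>%VS by rewrite eqEdim sub.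
  by apply: memv_span; rewrite mem_head.
have [P PU /allP hP] : mxpoly.codiagonalizable As.
  apply/mxpoly.codiagonalizableP; split=> [A B hA hB|A hA].
    by apply: Scomm; exact: SAs.
  by apply: Sdiag; exact: SAs.
exists P => // A /AsS /(@coord_span _ _ _ (in_tuple As)) ->.
rewrite mulmx_sumr mulmx_suml; apply/is_diag_mxP => i j ij; rewrite summxE big1 // => l _.
rewrite -scalemxAr -scalemxAl mxE.
have := hP _ (mem_nth 0 (ltn_ord l)); rewrite /= => /(mxpoly.diagonalizable_forP _ PU) /(_ i j ij).
by move=> /= ->; rewrite mulr0.
Qed.

End Codiagonalization.

(** * Hyperbolic bases of eigenvectors *)

Section Eigenvectors.
Variable C : numClosedFieldType.
Notation gam := (@gam C).
Implicit Types (hs : seq ('rV[C]_(4 + 4) * 'rV[C]_(4 + 4))) (u v w a b : 'rV[C]_(4 + 4)) (s : 'M[C]_spinor_dim) (l m : C).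

(** [v] is an eigenvector of [s] in the vector representation, stated without inverting [s]. *)
Definition eigv s v l := s *m gam v = l *: (gam v *m s).

Lemma eigvD s v w l : eigv s v l -> eigv s w l -> eigv s (v + w) l.
Proof. by rewrite /eigv gamD mulmxDr => -> ->; rewrite mulmxDl scalerDr. Qed.

Lemma eigvZ s v c l : eigv s v l -> eigv s (c *: v) l.
Proof. by rewrite /eigv gamZ -scalemxAr -scalemxAl => ->; rewrite !scalerA mulrC. Qed.

Lemma eigv0 s l : eigv s 0 l.
Proof. by rewrite /eigv gam0 mulmx0 mul0mx scaler0. Qed.

Lemma eigv_bf s v w l m : s \in unitmx -> eigv s v l -> eigv s w m ->
  bf v w != 0 -> l * m = 1.
Proof.
move=> sU hv hw n0.
have e : s *m (gam v *m gam w + gam w *m gam v) =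
    (l * m) *: ((gam v *m gam w + gam w *m gam v) *m s).
  rewrite mulmxDr !mulmxA hv hw -!scalemxAl -!mulmxA hv hw -!scalemxAr !scalerA.
  by rewrite (mulrC m) -scalerDr mulmxDl !mulmxA.
move: e; rewrite gam_clifford scalar_mxC => e.
have : (bf v w)%:M = (l * m) *: (bf v w)%:M :> 'M[C]_spinor_dim.
  by apply: (can_inj (mulmxK sU)); rewrite e -scalemxAl.
have x : 'I_spinor_dim by exact: (enum_rank (finset.set0 : {set 'I_4})).
move/matrixP => /(_ x x); rewrite !mxE eqxx mulr1n => h.
by apply: (mulIf n0); rewrite mul1r -h.
Qed.

Lemma eigv_uniq s v l m : s \in unitmx -> v != 0 -> eigv s v l -> eigv s v m -> l = m.
Proof.
rewrite /eigv => sU v0 -> /eqP; rewrite -subr_eq0 -scalerBl scaler_eq0 subr_eq0 => /orP[/eqP//|].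
move/eqP => h; case/eqP: v0; apply: gam_inj.
by apply: (can_inj (mulmxK sU)); rewrite h mul0mx.
Qed.

Lemma eigv_mul s v l : eigv s v l -> eigv (s *m s) v (l ^+ 2).
Proof.
by rewrite /eigv => h; rewrite -mulmxA h -scalemxAr [s *m (_ *m _)]mulmxA h -scalemxAl scalerA mulmxA.
Qed.

Variable S : set 'M[C]_spinor_dim.
Hypothesis S_Spin : S `<=` Spin8 C.
Hypothesis S_comm : forall s s', S s -> S s' -> s *m s' = s' *m s.
Hypothesis S_order : forall s, S s -> exists2 n, (0 < n)%N & iter n (mulmx s) 1%:M = 1%:M.
Hypothesis S_square : forall s, S s -> exists2 s', S s' & s = s' *m s'.

Definition eig v := forall s, S s -> exists l, eigv s v l.

Let SU s : S s -> s \in unitmx.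
Proof. by move=> /S_Spin /Spin_unit. Qed.

(** The vector representation sends [S] to commuting matrices of finite order; uniqueness of the
    matrix ([spin_act_uniq]) transfers both properties. *)
Lemma eigenbasis : exists2 P : 'M[C]_(4 + 4), P \in unitmx & forall i, eig (row i P).
Proof.
pose Q := [set A : 'M[C]_(4 + 4) | exists2 s, S s & spin_act s A].
have [A B [s Ss sA] [s' Ss' sB]|A [s Ss sA]|P PU hP] := @codiagonalizable_set C (4 + 4) Q.
- apply: (@spin_act_uniq _ (s *m s')); first by rewrite unitmx_mul !SU.
    by rewrite S_comm //; exact: spin_actM.
  exact: spin_actM.
- have [n n0 hn] := S_order Ss.
  apply: (@finite_order_diagonalizable C 7 A n n0).
  have H : forall m : nat, spin_act (iter m (mulmx s) 1%:M) (A ^+ m).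
    elim=> [|m IH]; first by rewrite expr0; exact: spin_act1.
    by rewrite exprSr iterS; exact: spin_actM.
  have := H n; rewrite hn => h; apply: (spin_act_uniq (unitmx1 _ _) h).
  exact: spin_act1.
exists P => // i s Ss; have [A sA] := Spin_act (S_Spin Ss).
have /diag_mxP [d e] := hP A (ex_intro2 _ _ s Ss sA).
exists (d ord0 i); rewrite /eigv sA -row_mul.
have -> : P *m A = diag_mx d *m P by rewrite -e mulmxKV.
have -> : row i (diag_mx d *m P) = d ord0 i *: row i P.
  by rewrite mul_diag_mx; apply/rowP => j; rewrite !mxE.
by rewrite gamZ -scalemxAl.
Qed.

Definition hyperbolic hs := forall i j : nat,
  (i < size hs)%N -> (j < size hs)%N ->
  let p := nth (0, 0) hs i in let q := nth (0, 0) hs j in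
  [/\ bf p.1 q.1 = 0, bf p.2 q.2 = 0 & bf p.1 q.2 = (i == j)%:R].

Definition ortho hs v := forall p, p \in hs -> bf v p.1 = 0 /\ bf v p.2 = 0.

Lemma hyperbolic_cons hs a b : hyperbolic hs -> ortho hs a -> ortho hs b ->
  bf a a = 0 -> bf b b = 0 -> bf a b = 1 -> hyperbolic ((a, b) :: hs).
Proof.
move=> hh oa ob aa bb ab [|i] [|j] //=; rewrite ?ltnS => hi hj.
- by have [-> ->] := oa _ (mem_nth (0, 0) hj); have [_ ->] := ob _ (mem_nth (0, 0) hj).
- have [h1 _] := oa _ (mem_nth (0, 0) hi); have [h2 h3] := ob _ (mem_nth (0, 0) hi).
  by rewrite ![bf _ a]bfC ![bf _ b]bfC h1 h2 h3.
- exact: hh.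
Qed.

(** The orthogonal projection onto the complement of the hyperbolic planes of [hs]. *)
Definition proj hs v :=
  v - \sum_(p <- hs) (bf v p.2 *: p.1 + bf v p.1 *: p.2).

Lemma bf_suml (I : Type) (r : seq I) (f : I -> 'rV[C]_(4 + 4)) w :
  bf (\sum_(i <- r) f i) w = \sum_(i <- r) bf (f i) w.
Proof. by elim/big_rec2: _ => [|i x y _ <-]; rewrite ?bf0l ?bfDl. Qed.

Lemma proj_ortho hs v : hyperbolic hs -> ortho hs (proj hs v).
Proof.
move=> hh p /(nthP (0, 0)) [j hj <-]; rewrite /proj !bfDl !bfNl !bf_suml.
rewrite !(big_nth (0, 0)) !big_mkord.
split; rewrite (bigD1 (Ordinal hj)) //= big1 ?addr0 => [|i ij].
- have [h1 h2 h3] := hh _ _ hj hj; rewrite bfDl !bfZl h1 (bfC _.2) h3 eqxx.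
  by rewrite mulr0 add0r mulr1 subrr.
- have [h1 h2 h3] := hh _ _ (ltn_ord i) hj; have [_ _ h4] := hh _ _ hj (ltn_ord i).
  rewrite bfDl !bfZl h1 (bfC _.2) h4 eq_sym.
  by move: ij; rewrite -(inj_eq val_inj) /= => /negPf ->; rewrite !mulr0 addr0.
- have [h1 h2 h3] := hh _ _ hj hj; rewrite bfDl !bfZl h2 h3 eqxx.
  by rewrite mulr0 addr0 mulr1 subrr.
- have [h1 h2 h3] := hh _ _ (ltn_ord i) hj; rewrite bfDl !bfZl h2 h3.
  by move: ij; rewrite -(inj_eq val_inj) /= => /negPf ->; rewrite !mulr0 addr0.
Qed.

Lemma bf_proj hs a v : ortho hs a -> bf a (proj hs v) = bf a v.
Proof.
move=> oa; rewrite /proj bfDr bfNr bfC [X in _ - X](bfC a) bf_suml big_seq big1.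
  by rewrite subr0 bfC.
by move=> p /oa [h1 h2]; rewrite bfDl !bfZl !(bfC _ a) h1 h2 !mulr0 addr0.
Qed.

(** If [v] has a nonzero component along [p.1], then it pairs nontrivially with [p.2], so its
    eigenvalue is inverse to that of [p.2], as is the eigenvalue of [p.1]: subtracting the component
    stays in one eigenspace. The same holds with [p.1] and [p.2] exchanged. *)
Lemma proj_eig hs v s l : S s -> hyperbolic hs -> (forall p, p \in hs -> eig p.1 /\ eig p.2) ->
  eigv s v l -> eigv s (proj hs v) l.
Proof.
move=> Ss hh he hv; apply: eigvD => //; rewrite -scaleN1r; apply: eigvZ.
rewrite big_seq; elim/big_ind: _ => [||p ph]; [exact: eigv0|by move=> *; exact: eigvD|].
have [/(_ _ Ss) [m1 h1] /(_ _ Ss) [m2 h2]] := he _ ph.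
have m12 : m1 * m2 = 1.
  apply: eigv_bf h1 h2 _; first exact: SU.
  case/(nthP (0, 0)): ph => j hj <-; have [_ _ ->] := hh _ _ hj hj.
  by rewrite eqxx oner_eq0.
apply: eigvD.
- have [->|n0] := eqVneq (bf v p.2) 0; first by rewrite scale0r; exact: eigv0.
  have lm := eigv_bf (SU Ss) hv h2 n0.
  suff -> : l = m1 by apply: eigvZ.
  have n2 : m2 != 0 by apply/eqP => e; move: lm; rewrite e mulr0 => /eqP; rewrite eq_sym oner_eq0.
  by apply: (mulIf n2); rewrite lm m12.
- have [->|n0] := eqVneq (bf v p.1) 0; first by rewrite scale0r; exact: eigv0.
  have lm := eigv_bf (SU Ss) hv h1 n0.
  suff -> : l = m2 by apply: eigvZ.
  have n2 : m1 != 0 by apply/eqP => e; move: lm; rewrite e mulr0 => /eqP; rewrite eq_sym oner_eq0.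
  by apply: (mulIf n2); rewrite lm mulrC.
Qed.

(* [S] consists of squares, so an anisotropic eigenvector, whose eigenvalues are
   signs, is fixed by [S]. *)
Lemma eig_anisotropic v s : eig v -> qf v != 0 -> S s -> eigv s v 1.
Proof.
move=> ev q0 Ss; have [s' Ss' e] := S_square Ss; have [l hl] := ev _ Ss'.
have -> : 1 = l ^+ 2; last by rewrite e; exact: eigv_mul.
by rewrite expr2; apply/esym; apply: (eigv_bf (SU Ss') hl hl); rewrite bfvv mulf_neq0 ?pnatr_eq0.
Qed.

(** The projected eigenvectors [w i] span the complement of [hs]. It contains an isotropic
    eigenvector [a], which some [w k] pairs with nontrivially; a multiple of [a] then makes that
    partner isotropic. *)
Lemma hyperbolic_extend hs : (size hs < 4)%N -> hyperbolic hs ->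
  (forall p, p \in hs -> eig p.1 /\ eig p.2) ->
  exists a b, hyperbolic ((a, b) :: hs) /\ eig a /\ eig b.
Proof.
move=> h4 hh he; have [P PU hP] := eigenbasis.
pose w i := proj hs (row i P).
have wo i : ortho hs (w i) by exact: proj_ortho.
have we i : eig (w i).
  by move=> s Ss; have [l hl] := hP i _ Ss; exists l; exact: proj_eig.
(* A dimension count: [z] and the at most six vectors of [hs] cannot span a space of dimension 8. *)
have far z : exists i, forall c, w i != c *: z.
  apply/not_existsP => h; pose X := z :: [seq p.1 | p <- hs] ++ [seq p.2 | p <- hs].
  have full : (fullv <= <<X>>)%VS.
    apply/subvP => v _; rewrite -[v](mulmxKV PU) mulmx_sum_row; apply: memv_suml => i _.
    apply: memvZ; have /existsNP [c /negP] := h i; rewrite negbK => /eqP hc.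
    have -> : row i P = c *: z + \sum_(p <- hs) (bf (row i P) p.2 *: p.1 + bf (row i P) p.1 *: p.2).
      by rewrite -hc /w /proj subrK.
    apply: memvD; first by apply: memvZ; apply: memv_span; rewrite mem_head.
    rewrite big_seq; apply: memv_suml => p ph; apply: memvD; apply: memvZ; apply: memv_span;
      rewrite inE mem_cat; apply/orP; right; apply/orP; [left|right]; exact: map_f.
  have := leq_trans (dimvS full) (dim_span X).
  rewrite dimvf /dim /= size_cat !size_map.
  by move: (size hs) h4 => [|[|[|[|?]]]].
have wb a k : ortho hs a -> bf a (w k) = bf a (row k P) by exact: bf_proj.
clearbody w; have aniso1 u s : eig u -> qf u != 0 -> S s -> eigv s u 1 by exact: eig_anisotropic.
have [a [a0 oa qa ea]] : exists a, [/\ a != 0, ortho hs a, qf a = 0 & eig a].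
  have [[i /andP[w0 /eqP q0]]|noiso] := pselect (exists i, (w i != 0) && (qf (w i) == 0)).
    by exists (w i).
  (* No nonzero [w i] is isotropic, so [S] fixes them all, and hence every combination of them. Two
     independent ones, orthogonalized, have an isotropic combination. *)
  have aniso i : w i != 0 -> qf (w i) != 0.
    by move=> w0; apply/negP => q0; apply: noiso; exists i; rewrite w0.
  have [i hi] := far 0; have wi0 : w i != 0 by have := hi 0; rewrite scaler0.
  have [j hj] := far (w i); have wj0 : w j != 0 by have := hj 0; rewrite scale0r.
  have qi := aniso _ wi0; have qj := aniso _ wj0.
  have bi : bf (w i) (w i) != 0 by rewrite bfvv mulf_neq0 ?pnatr_eq0.
  pose c := bf (w j) (w i) / bf (w i) (w i).
  pose u := w j - c *: w i.
  have u0 : u != 0 by rewrite subr_eq0.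
  have ou : ortho hs u.
    by move=> p ph; have [h1 h2] := wo i p ph; have [h3 h4'] := wo j p ph;
      rewrite !bfDl !bfNl !bfZl h1 h2 h3 h4' !mulr0 subrr.
  have eu s : S s -> eigv s u 1.
    move=> Ss; apply: eigvD; first exact: aniso1.
    by rewrite -scaleNr; apply: eigvZ; exact: aniso1.
  have bu : bf u (w i) = 0 by rewrite bfDl bfNl bfZl divfK // subrr.
  have [qu|qu] := eqVneq (qf u) 0.
    by exists u; split=> // s Ss; exists 1; exact: eu.
  (* Solves q(w i) + d^2 q(u) = 0. *)
  pose d := sqrtC (- qf (w i) / qf u).
  exists (w i + d *: u); split.
  - apply/eqP => e; have := congr1 (fun v => bf v (w i)) e.
    by rewrite bfDl bfZl bu mulr0 addr0 bf0l => /eqP; rewrite (negPf bi).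
  - by move=> p ph; have [h1 h2] := wo i p ph; have [h3 h4'] := ou p ph;
      rewrite !bfDl !bfZl h1 h2 h3 h4' mulr0 addr0.
  - by rewrite qfD qfZ sqrtCK divfK // bfZr bfC bu mulr0 addr0 subrr.
  - move=> s Ss; exists 1; apply: eigvD; first exact: aniso1.
    by apply: eigvZ; exact: eu.
have [k hk] : exists k, bf a (w k) != 0.
  apply/not_existsP => h; case/eqP: a0; apply: bf_nondeg => v.
  rewrite -[v](mulmxKV PU) mulmx_sum_row bfC bf_suml big1 // => i _.
  rewrite bfZl bfC -wb //; have /negP := h i; rewrite negbK => /eqP ->.
  by rewrite mulr0.
pose b0 := (bf a (w k))^-1 *: w k.
have ab0 : bf a b0 = 1 by rewrite bfZr mulVf.
have ob0 : ortho hs b0.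
  by move=> p ph; have [h1 h2] := wo k p ph; rewrite !bfZl h1 h2 mulr0.
have eb0 : eig b0 by move=> s Ss; have [l hl] := we k _ Ss; exists l; exact: eigvZ.
clearbody b0; have aa : bf a a = 0 by rewrite bfvv qa mulr0.
exists a, (b0 - qf b0 *: a); split; last split=> //.
  apply: hyperbolic_cons => //.
  - move=> p ph; have [h1 h2] := ob0 p ph; have [h3 h4'] := oa p ph.
    by rewrite !bfDl !bfNl !bfZl h1 h2 h3 h4' mulr0 subrr.
  - rewrite bfvv qfD qfN qfZ qa bfNr bfZr bfC ab0 mulr0 addr0 mulr1 subrr mulr0 //.
  - by rewrite bfDr bfNr bfZr aa mulr0 subr0.
move=> s Ss; have [l hl] := eb0 _ Ss; exists l; apply: eigvD => //.
(* A correction occurs only if [b0] is anisotropic. Then [S] fixes [b0], and also [a], since the two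
   pair to 1; so the combination is still an eigenvector. *)
rewrite -scaleNr; have [q0|q0] := eqVneq (qf b0) 0.
  by rewrite q0 oppr0 scale0r; exact: eigv0.
apply: eigvZ; have [m hm] := ea _ Ss.
have l1 : l = 1.
  have b00 : b0 != 0 by apply/eqP => e; move: ab0; rewrite e bf0r => /eqP; rewrite eq_sym oner_eq0.
  exact: (eigv_uniq (SU Ss) b00 hl (aniso1 _ _ eb0 q0 Ss)).
have : m * l = 1 by apply: (eigv_bf (SU Ss) hm hl); rewrite ab0 oner_eq0.
by rewrite l1 mulr1 => <-.
Qed.

Lemma hyperbolic_eigenbasis : exists hs, [/\ size hs = 4%N, hyperbolic hs &
  forall p, p \in hs -> eig p.1 /\ eig p.2].
Proof.
suff H n : (n <= 4)%N -> exists hs, [/\ size hs = n, hyperbolic hs &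
  forall p, p \in hs -> eig p.1 /\ eig p.2] by exact: H.
elim: n => [_|n IH n4]; first by exists [::].
have [hs [hn hh he]] := IH (ltnW n4).
have h4 : (size hs < 4)%N by rewrite hn.
have [a [b [hab [ea eb]]]] := hyperbolic_extend h4 hh he.
exists ((a, b) :: hs); split=> //=; first by rewrite hn.
by move=> p; rewrite inE => /orP[/eqP->//|]; exact: he.
Qed.

End Eigenvectors.

(** * Conjugation of commuting elements of finite order into the standard torus *)

Section Conjugacy.
Variable C : numClosedFieldType.
Notation gam := (@gam C).
Notation V := 'rV[C]_(4 + 4).
Implicit Types (hs : seq (V * V)) (u v w a b : V) (s x y : 'M[C]_spinor_dim).

(** Reflections act on anisotropic vectors, so each hyperbolic pair is traded for two orthogonal
    unit vectors. As q(p.1 - p.2) = -1, the factor ['i] is what makes the second one a unit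
    vector. *)
Definition frame hs (j : nat) : V :=
  let p := nth (0, 0) hs j./2 in if odd j then 'i *: (p.1 - p.2) else p.1 + p.2.

Lemma frame_bf hs i j : size hs = 4%N -> hyperbolic hs -> (i < 8)%N -> (j < 8)%N ->
  bf (frame hs i) (frame hs j) = (i == j)%:R * 2.
Proof.
move=> h4 hh hi hj; rewrite /frame.
have [||h1 h2 h3] := hh i./2 j./2; [by rewrite h4 ltn_half_double|by rewrite h4 ltn_half_double|].
have [||_ _ h5] := hh j./2 i./2; [by rewrite h4 ltn_half_double|by rewrite h4 ltn_half_double|].
move: h1 h2 h3 h5; move: (nth (0, 0) hs i./2) (nth (0, 0) hs j./2) => p q h1 h2 h3 h5.
have e : (i == j) = (odd i == odd j) && (i./2 == j./2).
  apply/eqP/andP => [->//|[/eqP o /eqP h]].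
  by rewrite -(odd_double_half i) -(odd_double_half j) o h.
rewrite eq_sym in h5; rewrite e.
have ii : 'i * 'i = -1 :> C by rewrite -expr2 sqrCi.
case: (odd i); case: (odd j) => /=;
  rewrite ?bfZl ?bfZr !bfDl !bfDr ?bfNl ?bfNr h1 h2 h3 (bfC p.2) h5.
- by rewrite mulrA ii; ring.
- by ring.
- by ring.
- by ring.
Qed.

Lemma frame_fst hs i : (nth (0, 0) hs i).1 =
  2^-1 *: ((- 'i) *: frame hs i.*2.+1 + frame hs i.*2).
Proof.
rewrite /frame /= odd_double /= uphalf_double doubleK; move: (nth _ _ _) => p.
rewrite scalerA mulNr -expr2 sqrCi opprK scale1r addrACA addNr addr0 -mulr2n.
by rewrite -scaler_nat scalerA mulVf ?scale1r // pnatr_eq0.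
Qed.

Lemma frame_snd hs i : (nth (0, 0) hs i).2 =
  2^-1 *: ('i *: frame hs i.*2.+1 + frame hs i.*2).
Proof.
rewrite /frame /= odd_double /= uphalf_double doubleK; move: (nth _ _ _) => p.
rewrite scalerA -expr2 sqrCi scaleN1r opprB addrA subrK -mulr2n.
by rewrite -scaler_nat scalerA mulVf ?scale1r // pnatr_eq0.
Qed.

Definition std_pairs : seq (V * V) := [seq (ev C i, fv C i) | i <- enum 'I_4].

Lemma nth_std_pairs (i : 'I_4) : nth (0, 0) std_pairs i = (ev C i, fv C i).
Proof. by rewrite (nth_map i) ?size_enum_ord // nth_ord_enum. Qed.

Lemma std_pairs_hyperbolic : hyperbolic std_pairs.
Proof.
have sz : size std_pairs = 4%N by rewrite size_map size_enum_ord.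
move=> i j; rewrite sz => hi hj.
have := nth_std_pairs (Ordinal hi); have := nth_std_pairs (Ordinal hj) => /= -> ->.
by rewrite /= bf_ee bf_ff bf_ef.
Qed.

(* If the isometry mapping the standard frame to the given one is improper, the
   two vectors of the last hyperbolic pair are exchanged. *)
Lemma hyperbolic_transitive hs : size hs = 4%N -> hyperbolic hs ->
  exists2 x, Spin8 C x & forall i, exists v w p, [/\ p \in hs,
    x *m gam (ev C i) = gam v *m x, x *m gam (fv C i) = gam w *m x &
    (v = p.1 /\ w = p.2) \/ (v = p.2 /\ w = p.1)].
Proof.
move=> h4 hh.
have sz : size std_pairs = 4%N by rewrite size_map size_enum_ord.
have [i j hi hj|i j hi hj|ns uns hns] := @reflections_transitive C (frame std_pairs) (frame hs) 8.
- exact: (frame_bf sz std_pairs_hyperbolic).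
- exact: frame_bf.
have r0 ms : reflections ms 0 = 0 :> V.
  by have := reflectionsP ms (-1) 0 0; rewrite scaler0 addr0 scaleN1r addNr.
have refl_ev ms i : reflections ms (ev C i) =
    2^-1 *: ((- 'i) *: reflections ms (frame std_pairs i.*2.+1) + reflections ms (frame std_pairs i.*2)).
  have -> : ev C i = (nth (0, 0) std_pairs i).1 by rewrite nth_std_pairs.
  rewrite frame_fst -[X in reflections ms X]addr0 !reflectionsP.
  by rewrite r0 addr0.
have refl_fv ms i : reflections ms (fv C i) =
    2^-1 *: ('i *: reflections ms (frame std_pairs i.*2.+1) + reflections ms (frame std_pairs i.*2)).
  have -> : fv C i = (nth (0, 0) std_pairs i).2 by rewrite nth_std_pairs.
  rewrite frame_snd -[X in reflections ms X]addr0 !reflectionsP.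
  by rewrite r0 addr0.
have i8 (i : 'I_4) : (i.*2.+1 < 8)%N /\ (i.*2 < 8)%N.
  by case: i => [[|[|[|[|]]]]].
have mem i : (i < 4)%N -> nth (0, 0) hs i \in hs by move=> hi; rewrite mem_nth // h4.
have act ms v : unit_vecs ms -> ~~ odd (size ms) ->
    gam_prod ms *m gam v = gam (reflections ms v) *m gam_prod ms.
  by move=> um om; rewrite gam_prod_act // -signr_odd (negPf om) expr0 scale1r.
have [o|o] := boolP (odd (size ns)); last first.
  exists (gam_prod ns); first exact: gam_prod_Spin.
  move=> i; have [i1 i2] := i8 i.
  exists (nth (0, 0) hs i).1, (nth (0, 0) hs i).2, (nth (0, 0) hs i); split; first exact: mem.
  - by rewrite act // refl_ev !hns // -frame_fst.
  - by rewrite act // refl_fv !hns // -frame_snd.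
  - by left.
pose n := frame hs 7.
have qn : qf n = 1.
  apply: (mulfI (_ : 2%:R != 0 :> C)); first by rewrite pnatr_eq0.
  by rewrite -bfvv frame_bf // eqxx mulrC.
have um : unit_vecs (n :: ns) by rewrite /= qn eqxx.
have om : ~~ odd (size (n :: ns)) by rewrite /= o.
have hms j : (j < 8)%N -> reflections (n :: ns) (frame std_pairs j) =
    if j == 7 then - frame hs j else frame hs j.
  move=> j8; rewrite /= hns // /reflection frame_bf // eq_sym.
  case: eqP => [->|_]; last by rewrite mul0r scale0r subr0.
  by rewrite mul1r scaler_nat mulr2n opprD addrA subrr sub0r.
exists (gam_prod (n :: ns)); first exact: gam_prod_Spin.
move=> i; have [i1 i2] := i8 i.
have ne7 : (i.*2 == 7) = false by case: i {i1 i2} => [[|[|[|[|]]]]].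
have [i3|i3] := boolP (i.*2.+1 == 7).
  exists (nth (0, 0) hs i).2, (nth (0, 0) hs i).1, (nth (0, 0) hs i); split; first exact: mem.
  - by rewrite act // refl_ev !hms // ne7 i3 scalerN scaleNr opprK -frame_snd.
  - by rewrite act // refl_fv !hms // ne7 i3 scalerN -scaleNr -frame_fst.
  - by right.
exists (nth (0, 0) hs i).1, (nth (0, 0) hs i).2, (nth (0, 0) hs i); split; first exact: mem.
- by rewrite act // refl_ev !hms // ne7 (negPf i3) -frame_fst.
- by rewrite act // refl_fv !hms // ne7 (negPf i3) -frame_snd.
- by left.
Qed.

(** [wedge C i *m contract C i] projects onto the spinors whose index contains i. It commutes with
    [y] because the eigenvalues at [ev i] and [fv i] are inverse, and these four projections
    together separate the basis spinors. *)
Lemma eigv_diag y : y \in unitmx ->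
  (forall i, (exists l, eigv y (ev C i) l) /\ (exists m, eigv y (fv C i) m)) -> is_diag_mx y.
Proof.
move=> yU hy.
have comm i : y *m (wedge C i *m contract C i) = (wedge C i *m contract C i) *m y.
  have [[l hl] [m hm]] := hy i.
  have lm : l * m = 1 by apply: (eigv_bf yU hl hm); rewrite bf_ef eqxx oner_eq0.
  rewrite -gam_ev -gam_fv mulmxA hl -scalemxAl -mulmxA hm -scalemxAr scalerA lm scale1r.
  by rewrite mulmxA.
have cN i (u : 'cV[C]_spinor_dim) (b0 b1 b2 b3 : bool) : spin_coord ((wedge C i *m contract C i) *m u) b0 b1 b2 b3 =
    (nth false [:: b0; b1; b2; b3] i)%:R * spin_coord u b0 b1 b2 b3.
  rewrite -mulmxA !spin_coordE.
  by case: i => [[|[|[|[|//]]]] hi] /=; case: b0; case: b1; case: b2; case: b3;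
    rewrite /sgn /=; ring.
have zero (c0 c1 c2 c3 b0 b1 b2 b3 : bool) (i : 'I_4) :
    nth false [:: b0; b1; b2; b3] i != nth false [:: c0; c1; c2; c3] (i : 'I_4) ->
    spin_coord (y *m bvec C c0 c1 c2 c3) b0 b1 b2 b3 = 0.
  move=> ne; set t := spin_coord _ _ _ _ _.
  have NB : (wedge C i *m contract C i) *m bvec C c0 c1 c2 c3 =
      (nth false [:: c0; c1; c2; c3] i)%:R *: bvec C c0 c1 c2 c3.
    apply: coord_inj => d0 d1 d2 d3; rewrite cN spin_coordZ coord_bvec.
    by case: and4P => [[/eqP -> /eqP -> /eqP -> /eqP ->]//|_]; rewrite !mulr0.
  move: (wedge C i *m contract C i) (comm i) (cN i) NB => N NC cNi NB.
  have := congr1 (fun m : 'M[C]_spinor_dim => spin_coord (m *m bvec C c0 c1 c2 c3) b0 b1 b2 b3) NC.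
  rewrite -!mulmxA NB -scalemxAr spin_coordZ cNi -/t.
  move: ne; case: (nth _ _ _); case: (nth _ _ _) => //= _; rewrite ?mul1r ?mul0r //.
apply/is_diag_mxP => p q pq.
have [b0 [b1 [b2 [b3 eb]]]] := bitsetP (enum_val p).
have [c0 [c1 [c2 [c3 ec]]]] := bitsetP (enum_val q).
have -> : y p q = spin_coord (y *m bvec C c0 c1 c2 c3) b0 b1 b2 b3.
  by rewrite /spin_coord /bvec -eb -ec !enum_valK -colE mxE.
have [i hi] : exists i : 'I_4, nth false [:: b0; b1; b2; b3] i != nth false [:: c0; c1; c2; c3] i.
  apply/not_existsP => h; case/eqP: pq; congr nat_of_ord; apply: enum_val_inj.
  rewrite eb ec; apply/setP => i; rewrite !inE.
  by have /negP := h i; rewrite negbK => /eqP.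
exact: zero hi.
Qed.

Lemma conj_diag (S : set 'M[C]_spinor_dim) :
  S `<=` Spin8 C -> (forall s s', S s -> S s' -> s *m s' = s' *m s) ->
  (forall s, S s -> exists2 n, (0 < n)%N & iter n (mulmx s) 1%:M = 1%:M) ->
  (forall s, S s -> exists2 s', S s' & s = s' *m s') ->
  exists2 x, Spin8 C x & forall s, S s -> is_diag_mx (invmx x *m s *m x).
Proof.
move=> h1 h2 h3 h4; have [hs [sz hh he]] := hyperbolic_eigenbasis h1 h2 h3 h4.
have [x Sx hx] := hyperbolic_transitive sz hh; exists x => // s Ss.
have xU := Spin_unit Sx.
have K u v : eig S v -> x *m gam u = gam v *m x -> exists l, eigv (invmx x *m s *m x) u l.
  move=> /(_ _ Ss) [l hl] e; exists l; rewrite /eigv -!mulmxA e (mulmxA s) hl.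
  rewrite -scalemxAl -scalemxAr; congr (_ *: _); rewrite -!mulmxA.
  by apply: (can_inj (mulKmx xU)); rewrite mulKVmx // !mulmxA e mulmxK.
apply: eigv_diag; first by rewrite !unitmx_mul unitmx_inv xU (Spin_unit (h1 _ Ss)).
move=> i; have [v [w [p [ph ev' fw vw]]]] := hx i; have [e1 e2] := he _ ph.
by case: vw => -[ve we]; split; [apply: K ev'|apply: K fw|apply: K ev'|apply: K fw];
  rewrite ?ve ?we.
Qed.

End Conjugacy.

(** * Conjugacy of maximal tori *)

Section OneParameter.
Variable C : numClosedFieldType.

Definition laurent (f : C -> C) :=
  exists (q : {poly C}) (m : nat), forall z, z != 0 -> f z = q.[z] / z ^+ m.

Lemma laurentD f g : laurent f -> laurent g -> laurent (fun z => f z + g z).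
Proof.
move=> [p [m hp]] [q [n hq]]; exists (p * 'X^n + q * 'X^m), (m + n)%N => z z0.
by rewrite hp // hq // !hornerE ?hornerXn exprD; field; rewrite ?expf_neq0.
Qed.

Lemma laurentZ c f : laurent f -> laurent (fun z => c * f z).
Proof.
by move=> [p [m hp]]; exists (c *: p), m => z z0; rewrite hp // hornerZ mulrA.
Qed.

Lemma laurent_sum (I : Type) (r : seq I) (f : I -> C -> C) : (forall i, laurent (f i)) ->
  laurent (fun z => \sum_(i <- r) f i z).
Proof.
move=> hf; elim: r => [|i r IH].
  by exists 0, 0%N => z _; rewrite big_nil horner0 mul0r.
rewrite (_ : (fun z => _) = (fun z => f i z + \sum_(i <- r) f i z)); first exact: laurentD.
by apply/funext => z; rewrite big_cons.
Qed.

Lemma laurent_unity0 f : laurent f ->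
  (forall z n, (0 < n)%N -> z ^+ n = 1 -> f z = 0) -> forall z, z != 0 -> f z = 0.
Proof.
move=> [q [m hq]] h z z0; suff q0 : q = 0 by rewrite hq // q0 horner0 mul0r.
(* Enough roots of unity to exceed the degree of [q]; the successor keeps [N] positive when [q] is
   0. *)
pose N := (size q).+1; have [rs urs e] := @unity_roots C N isT.
have rsP w : w \in rs -> w ^+ N = 1.
  move=> wrs; have : ('X^N - 1 : {poly C}).[w] = 0.
    by rewrite e; apply/rootP; rewrite root_prod_XsubC.
  by rewrite !hornerE ?hornerXn => /eqP; rewrite subr_eq0 => /eqP.
apply: (@roots_geq_poly_eq0 _ q rs) => //.
  apply/allP => w wrs; apply/rootP; have w1 := rsP _ wrs.
  have w0 : w != 0.
    by apply/eqP => w0; move: w1; rewrite w0 expr0n => /eqP; rewrite eq_sym oner_eq0.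
  have := hq w w0; rewrite (h w N) // => /esym/eqP.
  by rewrite mulf_eq0 invr_eq0 expf_eq0 (negPf w0) andbF orbF => /eqP.
have : size ('X^N - 1 : {poly C}) = (size rs).+1 by rewrite e size_prod_XsubC.
by rewrite size_XnsubC // => -[<-]; exact: leqW.
Qed.

Variable r : nat.
Implicit Types (i : 'I_r) (z w : C).

Definition one_param i z : 'M[C]_r := diag_mx (\row_k (if k == i then z else 1)).

Lemma one_param_det i z : \det (one_param i z) = z.
Proof.
rewrite det_diag (bigD1 i) //= mxE eqxx big1 ?mulr1 // => k /negPf ki.
by rewrite mxE ki.
Qed.

Lemma one_param_diagonal i z : z != 0 -> diagonal_group C r (one_param i z).
Proof.
by move=> z0; rewrite /diagonal_group /= diag_mx_is_diag unitmxE one_param_det unitfE.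
Qed.

Lemma one_paramM i z w : one_param i z *m one_param i w = one_param i (z * w).
Proof.
rewrite mulmx_diag; congr diag_mx; apply/rowP => k; rewrite !mxE.
by case: ifP; rewrite ?mulr1.
Qed.

Lemma one_param1 i : one_param i 1 = 1%:M.
Proof.
rewrite /one_param -diag_const_mx; congr diag_mx; apply/rowP => k.
by rewrite !mxE if_same.
Qed.

(** The determinant of [one_param i z] is [z], so the denominator of a regular function becomes a
    power of [z]. *)
Lemma regular_laurent (f : diagonal_group C r -> C) (F : 'M[C]_r -> C) i :
  regular f -> (forall g : diagonal_group C r, f g = F (val g)) ->
  laurent (fun z => F (one_param i z)).
Proof.
move=> [p [m hp]] fF.
pose K (u : C -> C) := exists q : {poly C}, forall z, u z = q.[z].
have [q hq] : K (fun z => mpoly.meval (entries (one_param i z)) p).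
  apply: (@meval_closed C C K) => [c|u v [a ha] [b hb]|u v [a ha] [b hb]|k].
  - by exists c%:P => z; rewrite hornerC.
  - by exists (a + b) => z; rewrite hornerD ha hb.
  - by exists (a * b) => z; rewrite hornerM ha hb.
  - case/mxvec_indexP: k => a b; exists (if a == b then (if a == i then 'X else 1) else 0) => z.
    rewrite /entries mxvecE !mxE; case: (a == b); last by rewrite mulr0n horner0.
    by rewrite mulr1n; case: ifP => _; rewrite ?hornerX ?hornerC.
exists q, m => z z0.
have /mem_set dz := one_param_diagonal i z0.
by have := fF (exist (fun g => g \in diagonal_group C r) _ dz); rewrite hp /= => <-; rewrite one_param_det hq.
Qed.

End OneParameter.

Section ConjugateTori.
Variable C : numClosedFieldType.
Implicit Types (s t x y : 'M[C]_spinor_dim) (T : set 'M[C]_spinor_dim).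

Lemma torus_sub_conj T : is_torus T -> T `<=` Spin8 C ->
  exists2 x, Spin8 C x & T `<=` conj_set x (@std_torus C).
Proof.
move=> [[TU T1 TM TV] [r [phi [psi [[phiT phiM phi_reg] [psiD _ _] _ phiK]]]]] TS.
have D1 : diagonal_group C r 1%:M by rewrite /diagonal_group /= scalar_mx_is_diag unitmx1.
have phi1 : phi 1%:M = 1%:M.
  have := phiM _ _ D1 D1; rewrite mulmx1 => e.
  have U : phi 1%:M \in unitmx by apply: (TU); apply: (phiT).
  by apply: (can_inj (mulKmx U)); rewrite -e mulmx1.
pose S := [set s | exists i z n, [/\ (0 < n)%N, z ^+ n = 1 & s = phi (one_param i z)]].
have unity_neq0 z n : (0 < n)%N -> z ^+ n = 1 -> z != 0 :> C.
  case: n => // n _ zn; apply/eqP => z0; move: zn; rewrite z0 expr0n => /eqP.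
  by rewrite eq_sym oner_eq0.
have Dz i z n : (0 < n)%N -> z ^+ n = 1 -> diagonal_group C r (one_param i z).
  by move=> n0 zn; apply: one_param_diagonal; exact: (unity_neq0 _ _ n0 zn).
have [x Sx hx] : exists2 x, Spin8 C x & forall s, S s -> is_diag_mx (invmx x *m s *m x).
  apply: conj_diag => [s [i [z [n [n0 zn ->]]]]|s s' [i [z [n [n0 zn ->]]]] [j [w [m [m0 wm ->]]]]
    |s [i [z [n [n0 zn ->]]]]|s [i [z [n [n0 zn ->]]]]].
  - by apply: (TS); apply: (phiT); exact: (Dz _ _ _ n0 zn).
  - have Di := Dz i _ _ n0 zn; have Dj := Dz j _ _ m0 wm.
    by rewrite -(phiM _ _ Di Dj) -(phiM _ _ Dj Di) diag_mxC.
  - exists n => //; have H k : iter k (mulmx (phi (one_param i z))) 1%:M = phi (one_param i (z ^+ k)).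
      elim: k => [|k IH]; first by rewrite expr0 one_param1 phi1.
      rewrite iterS IH exprS -one_paramM phiM //; first exact: (Dz _ _ _ n0 zn).
      by apply: one_param_diagonal; rewrite expf_neq0 // (unity_neq0 _ _ n0 zn).
    by rewrite H zn one_param1.
  - have sz : sqrtC z ^+ n.*2 = 1 by rewrite -mul2n exprM sqrtCK.
    have n20 : (0 < n.*2)%N by rewrite double_gt0.
    exists (phi (one_param i (sqrtC z))); first by exists i, (sqrtC z), n.*2.
    by rewrite -phiM ?one_paramM -?expr2 ?sqrtCK //; exact: (Dz _ _ _ n20 sz).
have xU := Spin_unit Sx.
have D_one i z : z != 0 -> is_diag_mx (invmx x *m phi (one_param i z) *m x).
  move=> z0; apply/is_diag_mxP => a b ab.
  pose f (w : C) := (invmx x *m phi (one_param i w) *m x) a b.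
  apply: (@laurent_unity0 C f) z0 => [|w n n0 wn]; last first.
    have Sw : S (phi (one_param i w)) by exists i, w, n.
    by have /is_diag_mxP := hx _ Sw; apply.
  rewrite (_ : f = fun w => \sum_l \sum_m (invmx x a m * x l b) * phi (one_param i w) m l).
    apply: laurent_sum => l; apply: laurent_sum => m; apply: laurentZ.
    exact: (regular_laurent (F := fun g => phi g m l) i (phi_reg m l)).
  apply/funext => w; rewrite /f mxE; apply: eq_bigr => l _.
  by rewrite mxE mulr_suml; apply: eq_bigr => m _; rewrite mulrAC.
have D_all D : diagonal_group C r D -> is_diag_mx (invmx x *m phi D *m x).
  move=> DD; have Dk k := diagonal_entry_neq0 k DD.
  (* Keeps the entries of [D] at the positions in [l], so that the coordinate directions are added
     one at a time. *)
  pose Ds (l : seq 'I_r) := diag_mx (\row_k (if k \in l then D k k else 1)).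
  have Dsd l : diagonal_group C r (Ds l).
    rewrite /diagonal_group /= diag_mx_is_diag unitmxE det_diag unitfE.
    by apply/prodf_neq0 => k _; rewrite mxE; case: ifP; rewrite ?oner_eq0.
  suff H (l : seq 'I_r) : uniq l -> is_diag_mx (invmx x *m phi (Ds l) *m x).
    have := H (enum 'I_r) (enum_uniq _); congr is_diag_mx; congr (_ *m phi _ *m _).
    have /andP[/diag_mxP [d e] _] := DD; rewrite [RHS]e; congr diag_mx; apply/rowP => k.
    by rewrite mxE mem_enum e mxE eqxx mulr1n.
  elim: l => [_|i l IH /= /andP[il ul]].
    have -> : Ds [::] = 1%:M.
      by rewrite -diag_const_mx; congr diag_mx; apply/rowP => k; rewrite !mxE.
    by rewrite phi1 mulmx1 mulVmx // scalar_mx_is_diag.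
  have -> : Ds (i :: l) = one_param i (D i i) *m Ds l.
    rewrite mulmx_diag; congr diag_mx; apply/rowP => k; rewrite !mxE inE.
    case: eqP => [->|_] /=; first by rewrite (negPf il) mulr1.
    by rewrite mul1r.
  rewrite phiM //; last exact: one_param_diagonal.
  have -> : invmx x *m (phi (one_param i (D i i)) *m phi (Ds l)) *m x =
      (invmx x *m phi (one_param i (D i i)) *m x) *m (invmx x *m phi (Ds l) *m x).
    by rewrite -!mulmxA mulKVmx.
  have /diag_mxP [d1 ->] := D_one i _ (Dk i); have /diag_mxP [d2 ->] := IH ul.
  by rewrite mulmx_diag diag_mx_is_diag.
exists x => // t Tt; exists (invmx x *m t *m x).
  split; first by do 2! [apply: SpinM => //]; [exact: SpinV|exact: TS].
  by rewrite -(phiK t Tt); apply: D_all; exact: psiD.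
by rewrite !mulmxA mulmxV // mul1mx mulmxK.
Qed.

Lemma maximal_torus_conj T : maximal_torus (Spin8 C) T ->
  exists2 x, Spin8 C x & T = conj_set x (@std_torus C).
Proof.
move=> [tT TS Tmax]; have [x Sx Tx] := torus_sub_conj tT TS.
exists x => //; apply/esym/Tmax => //; first exact: conj_std_torus.
by move=> _ [t [St _] <-]; apply: SpinM; [exact: SpinM|exact: SpinV].
Qed.

End ConjugateTori.

(** * Weights *)

Section Weights.
Variable C : numClosedFieldType.
Notation gam := (@gam C).
Notation ev := (ev C).
Notation fv := (fv C).
Notation V := 'rV[C]_(4 + 4).
Notation P0 := (std_parabolic4 C).
Implicit Types (i j : 'I_4) (v w : V) (c t l m : C) (g h p x y : 'M[C]_spinor_dim).

Lemma std_torus_P0 x : @std_torus C x -> P0 x.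
Proof.
move=> Tx; rewrite -(torus_eltK Tx) /torus_elt -lock.
have H k : P0 (simple_coroot k (torus_coord x k)) by apply: P0_coroot; exact: torus_coord_neq0.
by apply: P0M => //; apply: P0M => //; apply: P0M.
Qed.

(** The cocharacter twice the dual of eps_i: it scales [ev i] by c^2, [fv i] by c^-2, and [vac] by
    c. The dual of eps_i itself does not lift to Spin(8). *)
Definition tor i c := gam (ev i + fv i) *m gam (c^-1 *: ev i + c *: fv i).

Lemma qf_tor i c : c != 0 -> qf (c^-1 *: ev i + c *: fv i) = 1.
Proof.
by move=> c0; rewrite qfD !qfZ qf_ev qf_fv bfZl bfZr bf_ef eqxx !mulr0 !add0r mulr1 mulVf.
Qed.

Lemma tor_Spin i c : c != 0 -> Spin8 C (tor i c).
Proof. by move=> c0; apply: Spin_pair; rewrite ?qf_hyp ?qf_tor. Qed.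

(** [w] is the image of [v] under the inner factor of [tor i c]. *)
Lemma tor_act i c v w l : c != 0 ->
  bf (ev i + fv i) w *: (ev i + fv i) - w = l *: v ->
  bf (c^-1 *: ev i + c *: fv i) v *: (c^-1 *: ev i + c *: fv i) - v = w -> eigv (tor i c) v l.
Proof.
move=> c0 h1 h2; rewrite /eigv /tor.
have e n u : qf n = 1 -> gam n *m gam u = gam (bf n u *: n - u) *m gam n.
  by move=> hn; rewrite -gam_reflect // -!mulmxA gam_sq hn mulmx1.
rewrite -mulmxA (e _ v) ?qf_tor // h2 mulmxA e ?qf_hyp // h1 gamZ -!scalemxAl.
by rewrite mulmxA.
Qed.

Lemma tor_ev i j c : c != 0 -> eigv (tor i c) (ev j) (if i == j then c ^+ 2 else 1).
Proof.
move=> c0; have [<-|ij] := eqVneq i j.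
  apply: (tor_act (w := c ^+ 2 *: fv i)) => //.
    rewrite bfZr bfDl bf_ef bf_ff eqxx addr0 mulr1 -scalerBr addrK //.
  rewrite bfDl !bfZl bf_ee bf_fe eqxx mulr0 add0r mulr1 scalerDr !scalerA mulfV // scale1r -expr2.
  by rewrite addrAC subrr add0r.
apply: (tor_act (w := - ev j)) => //.
  by rewrite bfNr bfDl bf_ee bf_fe (negPf ij) addr0 oppr0 scale0r sub0r opprK scale1r.
by rewrite bfDl !bfZl bf_ee bf_fe (negPf ij) !mulr0 addr0 scale0r sub0r.
Qed.

Lemma tor_fv i j c : c != 0 -> eigv (tor i c) (fv j) (if i == j then c^-2 else 1).
Proof.
move=> c0; have [<-|ij] := eqVneq i j.
  apply: (tor_act (w := c^-2 *: ev i)) => //.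
    by rewrite bfZr bfDl bf_ee bf_fe eqxx add0r mulr1 -scalerBr addrAC subrr add0r.
  rewrite bfDl !bfZl bf_ef bf_ff eqxx mulr0 addr0 mulr1 scalerDr !scalerA mulVf // scale1r.
  by rewrite addrK -expr2 exprVn.
apply: (tor_act (w := - fv j)) => //.
  by rewrite bfNr bfDl bf_ef bf_ff (negPf ij) addr0 oppr0 scale0r sub0r opprK scale1r.
by rewrite bfDl !bfZl bf_ef bf_ff (negPf ij) !mulr0 addr0 scale0r sub0r.
Qed.

Lemma tor_std_torus i c : c != 0 -> @std_torus C (tor i c).
Proof.
move=> c0; split; first exact: tor_Spin.
apply: eigv_diag; first exact: Spin_unit (tor_Spin i c0).
by move=> j; split; [exists (if i == j then c ^+ 2 else 1); exact: tor_ev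
  |exists (if i == j then c^-2 else 1); exact: tor_fv].
Qed.

Lemma chi_tor i c : c != 0 -> chi (tor i c) = c.
Proof.
move=> c0; rewrite /chi /tor !gamD !gamZ !gam_ev !gam_fv.
have -> : (wedge C i + contract C i) *m (c^-1 *: wedge C i + c *: contract C i) *m vac C = c *: vac C.
  rewrite -mulmxA.
  have -> : (c^-1 *: wedge C i + c *: contract C i) *m vac C = c *: (contract C i *m vac C).
    by rewrite mulmxDl -!scalemxAl wedge_vac scaler0 add0r.
  rewrite -scalemxAr mulmxDl.
  congr (_ *: _).
  have -> : contract C i *m (contract C i *m vac C) = 0.
    rewrite mulmxA -gam_fv gam_sq qf_fv raddf0 mul0mx //.
  have -> : wedge C i *m (contract C i *m vac C) =
      (1%:M - contract C i *m wedge C i) *m vac C.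
    by have := wedge_contract C i i; rewrite eqxx => <-; rewrite addrK mulmxA.
  by rewrite mulmxBl mul1mx -mulmxA wedge_vac mulmx0 subr0 addr0.
by rewrite spin_coordZ coord_vac mulr1.
Qed.

Lemma eigv_root g v w l m t : eigv g v l -> eigv g w m ->
  g *m spin_root v w t = spin_root v w (t * (l * m)) *m g.
Proof.
move=> hv hw; have e u k : eigv g u k -> g *m gam u = gam (k *: u) *m g.
  by rewrite /eigv gamZ -scalemxAl.
rewrite (spin_root_conj _ (e _ _ hv) (e _ _ hw)) /spin_root !gamZ -scalemxAl -scalemxAr.
by rewrite !scalerA -mulrA.
Qed.

(* A character is trivial on a root subgroup, because conjugation by the torus
   rescales the root subgroup. *)
Lemma omega4_chi h (omega : 'M[C]_spinor_dim -> C) : Spin8 C h -> is_omega4 h omega ->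
  forall p, P0 p -> omega (h *m p *m invmx h) = chi p.
Proof.
move=> Sh [[om0 omM _] om_coroot] p; have hU := Spin_unit Sh.
pose f x := omega (h *m x *m invmx h).
have fM x y : P0 x -> P0 y -> f (x *m y) = f x * f y.
  move=> Px Py; rewrite /f -omM; [|by exists x|by exists y].
  by rewrite !mulmxA mulmxKV.
have f0 x : P0 x -> f x != 0 by move=> Px; apply: om0; exists x.
have f1 : f 1%:M = 1.
  by have := fM _ _ (@P01 C) (@P01 C); rewrite mulmx1 => /esym; rewrite -[RHS]mulr1 => /mulfI; apply; apply: f0; exact: P01.
have f_root v w i l m : null_pair v w -> (forall t, P0 (spin_root v w t)) ->
    eigv (tor i 2) v l -> eigv (tor i 2) w m -> l * m != 1 ->
    forall t, f (spin_root v w t) = 1.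
  move=> vw Pvw hv hw lm t.
  have two0 : 2 != 0 :> C by rewrite pnatr_eq0.
  have Pt := std_torus_P0 (tor_std_torus i two0).
  have scale s : f (spin_root v w (s * (l * m))) = f (spin_root v w s).
    apply: (mulfI (f0 _ Pt)); rewrite [LHS]mulrC -!fM //.
    by rewrite (eigv_root s hv hw).
  have lm' : l * m - 1 != 0 by rewrite subr_eq0.
  (* This s satisfies l m s = t + s, so invariance under rescaling gives f(t) f(s) = f(s), and f(s)
     cancels. *)
  have := scale (t / (l * m - 1)).
  have -> : t / (l * m - 1) * (l * m) = t + t / (l * m - 1) by field.
  rewrite -spin_root_add // fM // => e.
  by apply: (mulIf (f0 _ (Pvw (t / (l * m - 1))))); rewrite e mul1r.
have four i l : (if i == i :> 'I_4 then 2 ^+ 2 else 1) * l = 4 * l :> C.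
  by rewrite eqxx -natrX.
have two0 : 2 != 0 :> C by rewrite pnatr_eq0.
have n1 : 4 * 1 != 1 :> C by rewrite mulr1 pnatr_eq1.
have ee i j t : i != j -> f (spin_root (ev i) (ev j) t) = 1.
  move=> ij; apply: (f_root _ _ i _ _ (null_ee C i j) _ (tor_ev i i two0) (tor_ev i j two0)).
    by move=> s; exact: P0_ee.
  by rewrite four (negPf ij).
have ef i j t : i != j -> f (spin_root (ev i) (fv j) t) = 1.
  move=> ij; apply: (f_root _ _ i _ _ (null_ef C ij) _ (tor_ev i i two0) (tor_fv i j two0)).
    by move=> s; exact: P0_ef.
  by rewrite four (negPf ij).
pose K := [set x | P0 x /\ f x = chi x].
move=> Pp; suff [] : K p by [].
apply: smallest_sub Pp => [|x Gx].
  split=> [x [/P0_Spin /Spin_unit]//||x y [xP hx] [yP hy]|x [xP hx]] /=.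
  - by split; [exact: P01|rewrite f1 chi1].
  - by split; [exact: P0M|rewrite fM // chiM // hx hy].
  - have xU := Spin_unit (P0_Spin xP); have xP' := P0V xP.
    split=> //; apply: (mulfI (f0 _ xP)); rewrite -fM // mulmxV // f1 hx -chiM //.
    by rewrite mulmxV // chi1.
split; first exact: sub_smallest_subgroup.
case: Gx => [[[k [z [z0 ->]]]|[i [j [t [ij [->|->]]]]]]|[k [t [k3 ->]]]].
- by rewrite /f om_coroot // /chi chi_coroot // spin_coordZ coord_vac mulr1.
- have ne : i != j by rewrite -(inj_eq val_inj) neq_ltn ij.
  by rewrite chi_fix ?vac_fix ?wc_vac // root_elt_wc ef.
- have ne : i != j by rewrite -(inj_eq val_inj) neq_ltn ij.
  by rewrite chi_fix ?vac_fix -?mulmxA ?wedge_vac ?mulmx0 // root_elt_we ee.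
- rewrite /neg_simple_root_vec k3; have ne := succ_neq k3; rewrite eq_sym in ne.
  by rewrite chi_fix ?vac_fix ?wc_vac // root_elt_wc ef.
Qed.

(** The multiplicity of eps_i in the negative of the root of [uroot l]. *)
Definition touch i (l : 'I_6) : nat := (i == (upair l).1) + (i == (upair l).2).

Lemma tor_uelt i c (a : 'I_6 -> C) : c != 0 ->
  tor i c *m uelt a = uelt (fun l : 'I_6 => a l * c^-2 ^+ touch i l) *m tor i c.
Proof.
move=> c0; rewrite /uelt; elim: (index_enum _) => [|l r IH].
  by rewrite !big_nil mul1mx mulmx1.
rewrite !big_cons mulmxA.
have -> : tor i c *m uroot l (a l) = uroot l (a l * c^-2 ^+ touch i l) *m tor i c.
  rewrite /uroot (eigv_root _ (tor_fv i _ c0) (tor_fv i _ c0)); congr (spin_root _ _ (_ * _) *m _).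
  by rewrite /touch exprD; do 2 case: (_ == _); rewrite ?expr0 ?expr1.
by rewrite -mulmxA IH mulmxA.
Qed.

End Weights.

(** * Invariant sections *)

Section Invariants.
Variable C : numClosedFieldType.
Notation P0 := (std_parabolic4 C).
Notation Spin := (Spin8 C).
Implicit Types (i j : 'I_4) (c t : C) (g h p x y : 'M[C]_spinor_dim) (a : 'I_6 -> C).

Definition weight_coord g (b0 b1 b2 b3 : bool) : C := spin_coord (g *m vac C) b0 b1 b2 b3.

(** Products of weight coordinates of [g *m vac C] at complementary two-element subsets. *)
Definition inv_section (n : nat) g : C :=
  match n with
  | 0 => weight_coord g false false true true * weight_coord g true true false false
  | 1 => weight_coord g false true false true * weight_coord g true false true false
  | _ => weight_coord g false true true false * weight_coord g true false false true
  end.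

Lemma weight_coordMr g p b0 b1 b2 b3 : P0 p ->
  weight_coord (g *m p) b0 b1 b2 b3 = chi p * weight_coord g b0 b1 b2 b3.
Proof. by move=> /P0_vac hp; rewrite /weight_coord -mulmxA hp -scalemxAr spin_coordZ. Qed.

Lemma inv_sectionMr n g p : P0 p -> inv_section n (g *m p) = chi p ^+ 2 * inv_section n g.
Proof. by move=> Pp; case: n => [|[|n]] /=; rewrite !weight_coordMr //; ring. Qed.

Lemma inv_section_torus n x g : @std_torus C x -> inv_section n (x *m g) = inv_section n g.
Proof.
move=> [Sx dx]; have W b0 b1 b2 b3 : weight_coord (x *m g) b0 b1 b2 b3 =
    tau x b0 b1 b2 b3 * weight_coord g b0 b1 b2 b3.
  by rewrite /weight_coord -mulmxA tau_coord.
have T b0 b1 b2 b3 := tau_compl b0 b1 b2 b3 dx Sx.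
by case: n => [|[|n]] /=; rewrite !W mulrACA T mul1r.
Qed.

Lemma coord_ff i j t (v : 'cV[C]_spinor_dim) b0 b1 b2 b3 :
  spin_coord (spin_root (fv C i) (fv C j) t *m v) b0 b1 b2 b3 =
  spin_coord v b0 b1 b2 b3 + t * spin_coord (contract C i *m (contract C j *m v)) b0 b1 b2 b3.
Proof.
by rewrite /spin_root !gam_fv mulmxDl mul1mx -scalemxAl spin_coordD spin_coordZ mulmxA.
Qed.

(** The coordinate of [uelt a *m vac C] at the complement of {i, j} is a_ij up to a sign, and the
    two signs agree for complementary pairs. *)
Lemma inv_section_uelt n a : inv_section n (uelt a) =
  match n with
  | 0 => a (inord 0) * a (inord 5)
  | 1 => a (inord 1) * a (inord 2)
  | _ => a (inord 3) * a (inord 4)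
  end.
Proof.
have U b0 b1 b2 b3 : weight_coord (uelt a) b0 b1 b2 b3 =
  spin_coord (spin_root (fv C (inord 0)) (fv C (inord 1)) (a (inord 0)) *m
   (spin_root (fv C (inord 0)) (fv C (inord 2)) (a (inord 1)) *m
   (spin_root (fv C (inord 1)) (fv C (inord 3)) (a (inord 2)) *m
   (spin_root (fv C (inord 0)) (fv C (inord 3)) (a (inord 3)) *m
   (spin_root (fv C (inord 1)) (fv C (inord 2)) (a (inord 4)) *m
   (spin_root (fv C (inord 2)) (fv C (inord 3)) (a (inord 5)) *m vac C)))))) b0 b1 b2 b3.
  rewrite /weight_coord /uelt !big_ord_recl big_ord0 mulmx1 /uroot /upair /=.
  congr (spin_coord _ b0 b1 b2 b3); rewrite -!mulmxA.
  by do 6 (congr (spin_root _ _ _ *m _); first by congr a; apply: val_inj; rewrite /= inordK).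
pose s := sgn C.
have F01 t (v : 'cV[C]_spinor_dim) b0 b1 b2 b3 :
    spin_coord (spin_root (fv C (inord 0)) (fv C (inord 1)) t *m v) b0 b1 b2 b3 =
    spin_coord v b0 b1 b2 b3 + t * (if b0 || b1 then 0 else - spin_coord v true true b2 b3).
  by rewrite coord_ff !coord_contract /= !inordK //=; case: b0; case: b1; rewrite /sgn //=; ring.
have F02 t (v : 'cV[C]_spinor_dim) b0 b1 b2 b3 :
    spin_coord (spin_root (fv C (inord 0)) (fv C (inord 2)) t *m v) b0 b1 b2 b3 =
    spin_coord v b0 b1 b2 b3 + t * (if b0 || b2 then 0 else - s b1 * spin_coord v true b1 true b3).
  by rewrite coord_ff !coord_contract /= !inordK //=; case: b0; case: b1; case: b2; rewrite /s /sgn //=; ring.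
have F03 t (v : 'cV[C]_spinor_dim) b0 b1 b2 b3 :
    spin_coord (spin_root (fv C (inord 0)) (fv C (inord 3)) t *m v) b0 b1 b2 b3 =
    spin_coord v b0 b1 b2 b3 + t * (if b0 || b3 then 0 else - s b1 * s b2 * spin_coord v true b1 b2 true).
  by rewrite coord_ff !coord_contract /= !inordK //=; case: b0; case: b1; case: b2; case: b3; rewrite /s /sgn //=; ring.
have F12 t (v : 'cV[C]_spinor_dim) b0 b1 b2 b3 :
    spin_coord (spin_root (fv C (inord 1)) (fv C (inord 2)) t *m v) b0 b1 b2 b3 =
    spin_coord v b0 b1 b2 b3 + t * (if b1 || b2 then 0 else - spin_coord v b0 true true b3).
  by rewrite coord_ff !coord_contract /= !inordK //=; case: b0; case: b1; case: b2; rewrite /s /sgn //=; ring.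
have F13 t (v : 'cV[C]_spinor_dim) b0 b1 b2 b3 :
    spin_coord (spin_root (fv C (inord 1)) (fv C (inord 3)) t *m v) b0 b1 b2 b3 =
    spin_coord v b0 b1 b2 b3 + t * (if b1 || b3 then 0 else - s b2 * spin_coord v b0 true b2 true).
  by rewrite coord_ff !coord_contract /= !inordK //=; case: b0; case: b1; case: b2; case: b3; rewrite /s /sgn //=; ring.
have F23 t (v : 'cV[C]_spinor_dim) b0 b1 b2 b3 :
    spin_coord (spin_root (fv C (inord 2)) (fv C (inord 3)) t *m v) b0 b1 b2 b3 =
    spin_coord v b0 b1 b2 b3 + t * (if b2 || b3 then 0 else - spin_coord v b0 b1 true true).
  by rewrite coord_ff !coord_contract /= !inordK //=; case: b0; case: b1; case: b2; case: b3; rewrite /s /sgn //=; ring.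
by case: n => [|[|n]]; rewrite /inv_section !U;
  move: (spin_root (fv C (inord 0)) (fv C (inord 1))) F01 => r01 F01;
  move: (spin_root (fv C (inord 0)) (fv C (inord 2))) F02 => r02 F02;
  move: (spin_root (fv C (inord 1)) (fv C (inord 3))) F13 => r13 F13;
  move: (spin_root (fv C (inord 0)) (fv C (inord 3))) F03 => r03 F03;
  move: (spin_root (fv C (inord 1)) (fv C (inord 2))) F12 => r12 F12;
  move: (spin_root (fv C (inord 2)) (fv C (inord 3))) F23 => r23 F23;
  rewrite !F01 /= !F02 /= !F13 /= !F03 /= !F12 /= !F23 /= !coord_vac /= /s /sgn; ring.
Qed.

End Invariants.

(** * Polynomial functions as lists of monomials, and their weights *)

Section Monomials.
Variables (C : numClosedFieldType) (n : nat).
Implicit Types (a : 'I_n -> C) (m : C * {ffun 'I_n -> nat}) (s : seq (C * {ffun 'I_n -> nat})).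

Definition monomial m a : C := m.1 * \prod_l a l ^+ m.2 l.

Lemma meval_monomials (q : mpoly.mpoly n C) : exists s, forall a,
  mpoly.meval a q = \sum_(m <- s) monomial m a.
Proof.
exists [seq (mpoly.mcoeff e q, [ffun l => mpoly.fun_of_multinom e l]) | e <- mpoly.msupp q] => a.
rewrite mpoly.mevalE [RHS]big_map; apply: eq_bigr => e _; rewrite /monomial /=.
by congr (_ * _); apply: eq_bigr => l _; rewrite ffunE.
Qed.

Definition weight (e : 'I_n -> nat) m := (\sum_(l < n) m.2 l * e l)%N.

(** For fixed [a], homogeneity is an identity between polynomials in the scaling parameter [x]; its
    coefficient of degree [k] selects the monomials of weight [k]. *)
Lemma weight_filter (f : ('I_n -> C) -> C) (e : 'I_n -> nat) k s :
  (forall a, f a = \sum_(m <- s) monomial m a) ->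
  (forall x a, x != 0 -> f (fun l => a l * x ^+ e l) = x ^+ k * f a) ->
  forall a, f a = \sum_(m <- [seq m <- s | weight e m == k]) monomial m a.
Proof.
move=> fs fk a; pose d m := weight e m.
pose q : {poly C} := \sum_(m <- s) monomial m a *: 'X^(d m) - f a *: 'X^k.
have q0 : q = 0.
  (* The factor 'X takes care of x = 0, where homogeneity is not assumed. *)
  have : q * 'X = 0.
    apply: poly_fun0 => x; rewrite hornerM hornerX.
    have [->|x0] := eqVneq x 0; first by rewrite mulr0.
    rewrite /q hornerD hornerN hornerZ hornerXn horner_sum.
    have := fk x a x0; rewrite mulrC => <-; rewrite fs -sumrB big1 ?mul0r // => m _.
    rewrite hornerZ hornerXn /monomial -mulrA [X in _ - _ * X](_ : _ = (\prod_l a l ^+ m.2 l) * x ^+ d m) ?subrr //.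
    rewrite /d /weight -prodrXr -big_split; apply: eq_bigr => l _ /=.
    by rewrite exprMn mulnC exprM.
  by move/eqP; rewrite mulf_eq0 polyX_eq0 orbF => /eqP.
have := congr1 (fun p : {poly C} => p`_k) q0.
rewrite /q coef0 coefB coefZ coefXn eqxx mulr1 => /eqP; rewrite subr_eq0 => /eqP <-.
rewrite coef_sum big_filter [RHS]big_mkcond; apply: eq_bigr => m _.
by rewrite coefZ coefXn eq_sym; case: ifP; rewrite ?mulr1 ?mulr0.
Qed.

End Monomials.

(** * Invariants for the standard torus and the standard parabolic subgroup *)

Section Core.
Variable C : numClosedFieldType.
Notation P0 := (std_parabolic4 C).
Notation Spin := (Spin8 C).
Implicit Types (i j : 'I_4) (c t : C) (g h p x y : 'M[C]_spinor_dim) (a : 'I_6 -> C).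

Definition matrix_poly (D : 'M[C]_spinor_dim -> C) :=
  exists p : mpoly.mpoly _ C, forall g, D g = mpoly.meval (entries g) p.

Lemma matrix_poly_cst c : matrix_poly (fun=> c).
Proof. by exists (mpoly.mpolyC _ c) => g; rewrite mpoly.mevalC. Qed.

Lemma matrix_polyD D E : matrix_poly D -> matrix_poly E -> matrix_poly (fun g => D g + E g).
Proof. by move=> [p hp] [q hq]; exists (p + q) => g; rewrite mpoly.mevalD hp hq. Qed.

Lemma matrix_polyM D E : matrix_poly D -> matrix_poly E -> matrix_poly (fun g => D g * E g).
Proof. by move=> [p hp] [q hq]; exists (p * q) => g; rewrite mpoly.mevalM hp hq. Qed.

Lemma matrix_polyX D k : matrix_poly D -> matrix_poly (fun g => D g ^+ k).
Proof. by move=> [p hp]; exists (p ^+ k) => g; rewrite rmorphXn /= hp. Qed.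

Lemma matrix_poly_sum (I : Type) (r : seq I) (D : I -> 'M[C]_spinor_dim -> C) :
  (forall o, matrix_poly (D o)) -> matrix_poly (fun g => \sum_(o <- r) D o g).
Proof.
move=> h; elim: r => [|o r IH].
  rewrite (_ : (fun g => _) = (fun=> 0)); first exact: matrix_poly_cst.
  by apply/funext => g; rewrite big_nil.
rewrite (_ : (fun g => _) = (fun g => D o g + \sum_(o <- r) D o g)); first exact: matrix_polyD.
by apply/funext => g; rewrite big_cons.
Qed.

Lemma matrix_poly_entry (k l : 'I_spinor_dim) x y : matrix_poly (fun g => (x *m g *m y) k l).
Proof.
rewrite (_ : (fun g => _) = (fun g => \sum_a \sum_b (x k b * y a l) * g b a)).
  apply: matrix_poly_sum => a; apply: matrix_poly_sum => b; apply: matrix_polyM.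
    exact: matrix_poly_cst.
  exists (mpoly.mpolyX C (mpoly.mnm1 (mxvec_index b a))) => g.
  by rewrite mpoly.mevalXU /entries mxvecE.
apply/funext => g; rewrite mxE; apply: eq_bigr => a _; rewrite mxE mulr_suml.
by apply: eq_bigr => b _; rewrite mulrAC.
Qed.

Lemma matrix_poly_translate D x y : matrix_poly D -> matrix_poly (fun g => D (x *m g *m y)).
Proof.
move=> [p hp]; rewrite (_ : (fun g => _) = (fun g => mpoly.meval (entries (x *m g *m y)) p)).
  apply: (@meval_closed C _ matrix_poly) => [c|E F|E F|k].
  - exact: matrix_poly_cst.
  - exact: matrix_polyD.
  - exact: matrix_polyM.
  - case/mxvec_indexP: k => a b.
    rewrite (_ : (fun g => _) = (fun g => (x *m g *m y) a b)); first exact: matrix_poly_entry.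
    by apply/funext => g; rewrite /entries mxvecE.
by apply/funext => g; rewrite hp.
Qed.

Lemma matrix_poly_line D : matrix_poly D -> line_poly D.
Proof.
move=> [p hp] A B; pose K (u : C -> C) := exists q : {poly C}, forall t, u t = q.[t].
suff [q hq] : K (fun t => mpoly.meval (entries (A + t *: B)) p) by exists q => t; rewrite hp.
apply: (@meval_closed C C K) => [c|u v [a ha] [b hb]|u v [a ha] [b hb]|k].
- by exists c%:P => z; rewrite hornerC.
- by exists (a + b) => z; rewrite hornerD ha hb.
- by exists (a * b) => z; rewrite hornerM ha hb.
- case/mxvec_indexP: k => a b; exists ((A a b)%:P + B a b *: 'X) => t.
  by rewrite /entries mxvecE !mxE !hornerE mulrC.
Qed.

Lemma matrix_poly_uelt D : matrix_poly D -> exists q : mpoly.mpoly 6 C, forall a,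
  D (uelt a) = mpoly.meval a q.
Proof.
move=> [p hp]; pose K (u : ('I_6 -> C) -> C) := exists q : mpoly.mpoly 6 C, forall a, u a = mpoly.meval a q.
have Kc c : K (fun=> c) by exists (mpoly.mpolyC _ c) => a; rewrite mpoly.mevalC.
have Ka u v : K u -> K v -> K (fun a => u a + v a).
  by move=> [q hq] [r hr]; exists (q + r) => a; rewrite mpoly.mevalD hq hr.
have Km u v : K u -> K v -> K (fun a => u a * v a).
  by move=> [q hq] [r hr]; exists (q * r) => a; rewrite mpoly.mevalM hq hr.
suff [q hq] : K (fun a => mpoly.meval (entries (uelt a)) p) by exists q => a; rewrite hp.
apply: (@meval_closed C _ K) => // k; case/mxvec_indexP: k => i j.
rewrite (_ : (fun a => _) = (fun a => uelt a i j)); last first.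
  by apply/funext => a; rewrite /entries mxvecE.
rewrite /uelt; elim: (index_enum _) i j => [|l r IH] i j.
  rewrite (_ : (fun a => _) = (fun=> (1%:M : 'M[C]_spinor_dim) i j)); first exact: (Kc).
  by apply/funext => a; rewrite big_nil.
have Ks (s : seq 'I_spinor_dim) (u : 'I_spinor_dim -> ('I_6 -> C) -> C) :
    (forall k, K (u k)) -> K (fun a => \sum_(k <- s) u k a).
  move=> h; elim: s => [|k s IHs].
    rewrite (_ : (fun a => _) = (fun=> 0)); first exact: (Kc).
    by apply/funext => a; rewrite big_nil.
  rewrite (_ : (fun a => _) = (fun a => u k a + \sum_(k <- s) u k a)); first exact: (Ka).
  by apply/funext => a; rewrite big_cons.
rewrite (_ : (fun a => _) = (fun a => \sum_k uroot l (a l) i k *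
   (\big[mulmx/1%:M]_(l <- r) uroot l (a l)) k j)); last first.
  by apply/funext => a; rewrite big_cons mxE.
apply: (Ks) => k; apply: (Km) => //.
rewrite (_ : (fun a => _) = (fun a => (1%:M : 'M[C]_spinor_dim) i k +
  a l * (gam (fv C (upair l).1) *m gam (fv C (upair l).2)) i k)); last first.
  by apply/funext => a; rewrite /uroot /spin_root !mxE.
apply: (Ka); first exact: (Kc).
apply: (Km); last exact: (Kc).
by exists (mpoly.mpolyX C (mpoly.mnm1 l)) => a; rewrite mpoly.mevalXU.
Qed.

Lemma uelt_Spin a : Spin (uelt a).
Proof.
rewrite /uelt; elim/big_rec: _ => [|l x _ Sx]; first exact: Spin1.
by apply: SpinM => //; exact: Spin_ff.
Qed.

(** The exponents are the edge multiplicities of a k-regular multigraph on four vertices. The edges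
    between {i, j} and its complement count equally for both sides, so comparing degree sums shows
    that complementary edges have equal multiplicity. *)
Lemma weight_equations (m : 'I_6 -> nat) k :
  (forall i, (\sum_l m l * touch i l)%N = k) ->
  [/\ m (inord 5) = m (inord 0), m (inord 2) = m (inord 1), m (inord 4) = m (inord 3) &
   (m (inord 0) + m (inord 1) + m (inord 3) = k)%N].
Proof.
move=> h.
have S i : (m (inord 0) * touch i (inord 0) + (m (inord 1) * touch i (inord 1) +
   (m (inord 2) * touch i (inord 2) + (m (inord 3) * touch i (inord 3) +
   (m (inord 4) * touch i (inord 4) + m (inord 5) * touch i (inord 5))))) = k)%N.
  rewrite -(h i) !big_ord_recl big_ord0 addn0.
  by repeat (congr (_ + _)%N); congr (m _ * touch i _)%N; apply: val_inj; rewrite /= inordK.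
have := (S (inord 0), S (inord 1), S (inord 2), S (inord 3)).
rewrite /touch /upair !inordK //= -!(inj_eq val_inj) /= !inordK //=.
by rewrite !(muln0, muln1, addn0, add0n) => -[[[h0 h1] h2] h3]; split; lia.
Qed.

Lemma matrix_poly_inv_section n : matrix_poly (@inv_section C n).
Proof.
have pW b0 b1 b2 b3 : matrix_poly (fun g => weight_coord g b0 b1 b2 b3).
  rewrite (_ : (fun g => _) = (fun g => (1%:M *m g *m 1%:M)
     (enum_rank (bitset b0 b1 b2 b3)) (enum_rank (bitset true true true true)))).
    exact: matrix_poly_entry.
  by apply/funext => g; rewrite /weight_coord /spin_coord /vac -colE mxE mul1mx mulmx1.
by case: n => [|[|n]]; apply: matrix_polyM.
Qed.

Theorem invariants_generated k D : matrix_poly D ->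
  (forall x y, @std_torus C x -> Spin y -> D (x *m y) = D y) ->
  (forall y p, Spin y -> P0 p -> D (y *m p) = (chi p ^+ 2) ^+ k * D y) ->
  exists s : seq (C * (nat * nat * nat)),
    all (fun m => m.2.1.1 + m.2.1.2 + m.2.2 == k)%N s /\
    forall y, Spin y -> D y = \sum_(m <- s) m.1 *
      (inv_section 0 y ^+ m.2.1.1 * inv_section 1 y ^+ m.2.1.2 * inv_section 2 y ^+ m.2.2).
Proof.
move=> pD Dt Dp.
have [q hq] := matrix_poly_uelt pD; have [s0 hs0] := meval_monomials q.
pose f a := D (uelt a).
have f0 a : f a = \sum_(m <- s0) monomial m a by rewrite /f hq.
have fw i (x : C) a : x != 0 -> f (fun l => a l * x ^+ touch i l) = x ^+ k * f a.
  (* [tor i c] rescales the coordinates by powers of c^-2, hence the inverse square root. *)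
  move=> x0; pose c := (sqrtC x)^-1.
  have c0 : c != 0 by rewrite invr_eq0 sqrtC_eq0.
  have cx : c^-2 = x by rewrite /c -exprVn invrK sqrtCK.
  have Tc := tor_std_torus i c0; have Pc := std_torus_P0 Tc.
  have U := tor_uelt i a c0; rewrite cx in U.
  have tU := Spin_unit (tor_Spin i c0).
  have ct : chi (invmx (tor i c)) = c^-1.
    apply: (mulIf c0); rewrite -{2}(chi_tor i c0) -chiM // mulVmx // chi1 mulVf //.
  rewrite /f -[uelt _](mulmxK tU) -U -mulmxA Dt //; last first.
    by apply: SpinM; [exact: uelt_Spin|apply: SpinV; exact: tor_Spin].
  by rewrite (Dp _ _ (uelt_Spin a) (P0V Pc)) ct exprVn cx.
have [s [hs sk]] : exists s, (forall a, f a = \sum_(m <- s) monomial m a) /\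
    all (fun m => [forall i, weight (touch i) m == k]) s.
  have W i s (hs : forall a, f a = \sum_(m <- s) monomial m a) := weight_filter hs (fw i).
  have h0 := W (inord 0) _ f0; have h1 := W (inord 1) _ h0.
  have h2 := W (inord 2) _ h1; have h3 := W (inord 3) _ h2.
  eexists; split; first exact: h3.
  apply/allP => m; rewrite !mem_filter => /and5P [e3 e2 e1 e0 _].
  apply/forallP => i; rewrite -(inord_val i).
  by case: i => [[|[|[|[|]]]]].
(* The exponents of a_01, a_02 and a_03; those of a_23, a_13 and a_12 are the same by
   [weight_equations]. *)
pose ex (m : C * {ffun 'I_6 -> nat}) := (m.1, (m.2 (inord 0), m.2 (inord 1), m.2 (inord 3))).
exists [seq ex m | m <- s]; split.
  rewrite all_map; apply: sub_all sk => m /forallP h /=.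
  by have [_ _ _ ->] := @weight_equations (m.2) k (fun i => eqP (h i)).
pose E y := \sum_(m <- s) m.1 * (inv_section 0 y ^+ m.2 (inord 0) *
  inv_section 1 y ^+ m.2 (inord 1) * inv_section 2 y ^+ m.2 (inord 3)).
have pE : matrix_poly E.
  apply: matrix_poly_sum => m; apply: matrix_polyM; first exact: matrix_poly_cst.
  by apply: matrix_polyM; [apply: matrix_polyM|]; apply: matrix_polyX; exact: matrix_poly_inv_section.
have Ep y p : P0 p -> E (y *m p) = (chi p ^+ 2) ^+ k * E y.
  move=> Pp; rewrite /E mulr_sumr; apply: eq_big_seq => m ms.
  have /forallP h := allP sk _ ms.
  have [_ _ _ <-] := @weight_equations (m.2) k (fun i => eqP (h i)).
  by rewrite !inv_sectionMr // !exprMn !exprD; ring.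
have Eu a : E (uelt a) = D (uelt a).
  rewrite -/(f a) hs; apply: eq_big_seq => m ms; rewrite /monomial; congr (_ * _).
  have /forallP h := allP sk _ ms.
  have [h5 h2 h4 _] := @weight_equations (m.2) k (fun i => eqP (h i)).
  have -> : \prod_l a l ^+ m.2 l = a (inord 0) ^+ m.2 (inord 0) * (a (inord 1) ^+ m.2 (inord 1) *
     (a (inord 2) ^+ m.2 (inord 2) * (a (inord 3) ^+ m.2 (inord 3) *
     (a (inord 4) ^+ m.2 (inord 4) * a (inord 5) ^+ m.2 (inord 5))))).
    rewrite !big_ord_recl big_ord0 mulr1.
    by repeat (congr (_ * _)); congr (a _ ^+ m.2 _); apply: val_inj; rewrite /= inordK.
  by rewrite !inv_section_uelt h5 h2 h4 !exprMn; ring.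
move=> y Sy; rewrite big_map; apply/eqP; rewrite -subr_eq0; apply/eqP.
pose DE y := D y + (-1) * E y.
have -> : D y - \sum_(m <- s) (ex m).1 * (inv_section 0 y ^+ (ex m).2.1.1 *
   inv_section 1 y ^+ (ex m).2.1.2 * inv_section 2 y ^+ (ex m).2.2) = DE y.
  by rewrite /DE mulN1r.
apply: (big_cell_density (D := DE)) => //.
  by apply: matrix_poly_line; apply: matrix_polyD => //; apply: matrix_polyM => //; exact: matrix_poly_cst.
move=> _ [_ [a ->] [p Pp ->]]; rewrite /DE Ep // Dp //; last exact: uelt_Spin.
by rewrite Eu mulN1r subrr.
Qed.

End Core.

(** * The graded algebra *)

Section Graded.
Variable C : fieldType.
Variable M : nat -> set (spin8_fun C).
Hypothesis M_cst : forall c, M 0%N (cst c).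
Hypothesis M_zero : forall k, M k 0.
Hypothesis MD : forall k f g, M k f -> M k g -> M k (f + g).
Hypothesis MM : forall i j f g, M i f -> M j g -> M (i + j)%N (f * g).

Lemma graded_sum_subalgebra : is_subalgebra (graded_sum M).
Proof.
split=> [c k|r s hr hs k|r s hr hs k].
- by rewrite coefC; case: k => [|k] /=; [exact: M_cst|exact: M_zero].
- by rewrite coefD; exact: MD.
- rewrite coefM; elim/big_ind: _ => [|f g|i _]; [exact: M_zero|exact: MD|].
  by rewrite -{1}(subnKC (leq_ord i)); exact: MM.
Qed.

Lemma generated_in_degree1_monomials (F0 F1 F2 : spin8_fun C) :
  M 1%N F0 -> M 1%N F1 -> M 1%N F2 ->
  (forall k f, M k f -> exists s : seq (C * (nat * nat * nat)),
    all (fun m => m.2.1.1 + m.2.1.2 + m.2.2 == k)%N s /\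
    f = \sum_(m <- s) cst m.1 * (F0 ^+ m.2.1.1 * F1 ^+ m.2.1.2 * F2 ^+ m.2.2)) ->
  generated_in_degree1 M.
Proof.
move=> h0 h1 h2 gen; rewrite /generated_in_degree1; apply/seteqP; split; last first.
  apply: smallest_sub; first exact: graded_sum_subalgebra.
  move=> _ [f Mf <-] k; rewrite coefMX coefC; by case: k => [|[|k]] //=; exact: M_zero.
move=> r hr A [[Ac AD AM] Ag].
have A0 : A 0 by have := Ac 0; rewrite (_ : cst 0 = 0 :> spin8_fun C) // polyC0.
have A1 : A 1 by have := Ac 1; rewrite (_ : cst 1 = 1 :> spin8_fun C) // polyC1.
have AX p k : A p -> A (p ^+ k).
  by move=> Ap; elim: k => [|k IH]; rewrite ?expr0 // exprS; exact: AM.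
have AF f : M 1%N f -> A (f%:P * 'X) by move=> Mf; apply: Ag; exists f.
rewrite -[r]coefK poly_def; elim/big_ind: _ => // k _.
have [s [sk ->]] := gen k _ (hr k).
rewrite scaler_suml big_seq; elim/big_ind: _ => // m ms.
have /eqP <- := allP sk _ ms; rewrite -mul_polyC !rmorphM !rmorphXn /= !exprD.
(* The monomial has total degree [k], so 'X^k can be shared out, one 'X to each of its factors. *)
have -> : (cst m.1)%:P * (F0%:P ^+ m.2.1.1 * F1%:P ^+ m.2.1.2 * F2%:P ^+ m.2.2) *
   ('X^(m.2.1.1) * 'X^(m.2.1.2) * 'X^(m.2.2)) = (cst m.1)%:P * ((F0%:P * 'X) ^+ m.2.1.1 *
   (F1%:P * 'X) ^+ m.2.1.2 * (F2%:P * 'X) ^+ m.2.2).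
  rewrite !exprMn -mulrA; congr (_ * _).
  by rewrite mulrACA; congr (_ * _); rewrite mulrACA.
by do ?apply: (AM); first [exact: Ac|apply: AX; exact: AF].
Qed.

End Graded.

(** * Transport to an arbitrary maximal torus and a conjugate parabolic subgroup *)

Section Main.
Variable C : numClosedFieldType.
Notation P0 := (std_parabolic4 C).
Notation Spin := (Spin8 C).
Variables (T P : set 'M[C]_spinor_dim) (h : 'M[C]_spinor_dim) (omega : 'M[C]_spinor_dim -> C).

Lemma invmx_conj n (y t : 'M[C]_n) : y \in unitmx -> t \in unitmx ->
  invmx (y *m t *m invmx y) = y *m invmx t *m invmx y.
Proof.
move=> yU tU; have e : (y *m t *m invmx y) *m (y *m invmx t *m invmx y) = 1%:M.
  by rewrite !mulmxA mulmxKV // mulmxK ?mulmxV.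
by rewrite (mulmx_unit_cancel e).2.
Qed.

Lemma spin8_val (g : spin8_type C) : Spin (val g).
Proof. exact: set_valP. Qed.

Lemma spin8_elt x : Spin x -> exists g : spin8_type C, val g = x.
Proof. by move=> /mem_set Sx; exists (exist (fun g => g \in Spin) _ Sx). Qed.

Lemma regular_matrix_poly (f : spin8_type C -> C) : @regular C spinor_dim Spin f <->
  exists D, matrix_poly D /\ forall g, f g = D (val g).
Proof.
split=> [[p [m hp]]|[D [[p hp] hD]]]; last first.
  by exists p, 0%N => g; rewrite expr0 divr1 -hp.
exists (fun g => mpoly.meval (entries g) p * \det g ^+ m); split.
  by exists (p * det_mpoly C _ ^+ m) => g; rewrite mpoly.mevalM rmorphXn /= meval_det.
move=> g; rewrite hp; congr (_ * _); rewrite -exprVn; congr (_ ^+ _).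
have d2 := Spin_det_sq (spin8_val g); have d0 : \det (val g) != 0.
  by have := Spin_unit (spin8_val g); rewrite unitmxE unitfE.
by apply: (mulfI d0); rewrite mulfV // -expr2.
Qed.

Lemma Rk_cst c : Rk T P omega 0 (cst c).
Proof.
split=> //; split; first by apply/regular_matrix_poly; exists (fun=> c); split=> //; exact: matrix_poly_cst.
by move=> g g' p _ _; rewrite /cst /= expr0 mul1r.
Qed.

Lemma Rk_zero k : Rk T P omega k 0.
Proof.
split=> //; split; first by apply/regular_matrix_poly; exists (fun=> 0); split=> //; exact: matrix_poly_cst.
by move=> g g' p _ _; rewrite /= mulr0.
Qed.

Lemma RkD k f g : Rk T P omega k f -> Rk T P omega k g -> Rk T P omega k (f + g).
Proof.
move=> [[/regular_matrix_poly [D [pD fD]] fP] fT] [[/regular_matrix_poly [E [pE gE]] gP] gT].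
split; first split.
- apply/regular_matrix_poly; exists (fun x => D x + E x); split; first exact: matrix_polyD.
  by move=> x; rewrite -fD -gE.
- by move=> x x' p Pp e; rewrite fctE (fP _ _ _ Pp e) (gP _ _ _ Pp e) -mulrDr.
- by move=> x x' t Tt e; rewrite !fctE (fT _ _ _ Tt e) (gT _ _ _ Tt e).
Qed.

Lemma RkM i j f g : Rk T P omega i f -> Rk T P omega j g -> Rk T P omega (i + j) (f * g).
Proof.
move=> [[/regular_matrix_poly [D [pD fD]] fP] fT] [[/regular_matrix_poly [E [pE gE]] gP] gT].
split; first split.
- apply/regular_matrix_poly; exists (fun x => D x * E x); split; first exact: matrix_polyM.
  by move=> x; rewrite -fD -gE.
- by move=> x x' p Pp e; rewrite fctE (fP _ _ _ Pp e) (gP _ _ _ Pp e) exprD mulrACA.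
- by move=> x x' t Tt e; rewrite !fctE (fT _ _ _ Tt e) (gT _ _ _ Tt e).
Qed.

Hypothesis Tmax : maximal_torus Spin T.
Hypothesis Sh : Spin h.
Hypothesis PE : P = conj_set h P0.
Hypothesis om : is_omega4 h omega.

Lemma generated_Rk : generated_in_degree1 (Rk T P omega).
Proof.
have [x Sx TE] := maximal_torus_conj Tmax.
have chiE := omega4_chi Sh om.
have xU := Spin_unit Sx; have hU := Spin_unit Sh.
pose F n : spin8_fun C := fun g => inv_section n (invmx x *m val g *m h).
have FR n : Rk T P omega 1 (F n).
  split; first split.
  - apply/regular_matrix_poly; exists (fun g => inv_section n (invmx x *m g *m h)); split=> //.
    exact: (matrix_poly_translate _ _ (matrix_poly_inv_section C n)).
  - move=> g g' p; rewrite PE => -[q Pq <-] e.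
    rewrite /F e expr1 chiE // !mulmxA mulmxKV //.
    exact: inv_sectionMr.
  - move=> g g' t; rewrite TE => -[s Ts <-] e; rewrite /F e.
    have sU : s \in unitmx by case: Ts => /Spin_unit.
    have Ts' : @std_torus C (invmx s) by case: (std_torus_subgroup C) => _ _ _; apply.
    transitivity (inv_section n (invmx s *m (invmx x *m val g *m h))).
      by rewrite invmx_conj // !mulmxA mulVmx // mul1mx.
    exact: inv_section_torus.
apply: (@generated_in_degree1_monomials C _ Rk_cst Rk_zero RkD RkM (F 0%N) (F 1%N) (F 2%N)) => //.
move=> k f [[/regular_matrix_poly [D [pD fD]] fP] fT].
(* Undoes the translations in [F]: left invariance under [T] becomes invariance under the standard
   torus, and right equivariance under [P] becomes that under the standard parabolic subgroup. *)
pose H y := D (x *m y *m invmx h).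
have SH y : Spin y -> Spin (x *m y *m invmx h).
  by move=> Sy; apply: SpinM; [exact: SpinM|exact: SpinV].
have [||s [sk hs]] := @invariants_generated C k H (matrix_poly_translate _ _ pD).
- move=> t y Tt Sy; rewrite /H.
  have [g hg] := spin8_elt (SH _ Sy).
  have [g' hg'] := spin8_elt (SH _ (SpinM Tt.1 Sy)).
  rewrite -hg -hg' -!fD; apply: (fT _ _ (x *m invmx t *m invmx x)).
    by rewrite TE; exists (invmx t) => //; case: (std_torus_subgroup C) => _ _ _; apply.
  have tU : t \in unitmx by case: Tt => /Spin_unit.
  by rewrite hg hg' invmx_conj ?unitmx_inv // invmxK !mulmxA mulmxKV.
- move=> y p Sy Pp; rewrite /H.
  have [g hg] := spin8_elt (SH _ Sy).
  have [g' hg'] := spin8_elt (SH _ (SpinM Sy (P0_Spin Pp))).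
  rewrite -hg -hg' -!fD -(chiE _ Pp); apply: fP; first by rewrite PE; exists p.
  by rewrite hg hg' !mulmxA mulmxKV.
exists s; split=> //; apply/funext => g.
have Sg : Spin (invmx x *m val g *m h).
  by apply: SpinM => //; apply: SpinM; [exact: SpinV|exact: spin8_val].
have -> : f g = H (invmx x *m val g *m h).
  by rewrite fD /H !mulmxA mulmxV // mul1mx mulmxK.
rewrite hs // fct_sumE; apply: eq_bigr => m _.
by rewrite !fctE.
Qed.

End Main.

Unset Implicit Arguments.

Theorem lemma3p1 (R : realType) (T P : set 'M[R[i]%C]_spinor_dim)
    (h : 'M[R[i]%C]_spinor_dim) (omega : 'M[R[i]%C]_spinor_dim -> R[i]%C) :
  maximal_torus (Spin8 R[i]%C) T ->
  Spin8 R[i]%C h ->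
  P = conj_set h (std_parabolic4 R[i]%C) ->
  T `<=` P ->
  is_omega4 h omega ->
  generated_in_degree1 (Rk T P omega).
Proof. by move=> Tmax Sh PE _ om; exact: (generated_Rk Tmax Sh PE om). Qed.
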